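(* Let $n \geq 4$ and $2 \leq k \leq n-2$. Then $SL_{-k}^n \setminus D_{-k}^n \neq \emptyset$.
   Context: A (centrally-symmetric) star-body $K\subset\mathbb{R}^n$ is a compact set with non-empty interior such that $K=-K$, $tK\subset K$ for all $t\in[0,1]$, and whose radial function $\rho_K(\theta)=\max\{r\ge 0: r\theta\in K\}$ is an even continuous function on $S^{n-1}$. Its Minkowski functional is $\|x\|_K=\min\{t\ge 0: x\in tK\}$, so that $\rho_K(\theta)=\|\theta\|_K^{-1}$ on $S^{n-1}$. The radial metric is $d_r(K_1,K_2)=\sup_{\theta\in S^{n-1}}|\rho_{K_1}(\theta)-\rho_{K_2}(\theta)|$. Embedding in $L_{-p}$: for $0<p<n$, the space $(\mathbb{R}^n,\|\cdot\|)$ embeds in $L_{-p}$ iff there exists a non-negative Borel measure $\mu$ on $S^{n-1}$ such that for every even rapidly decreasing infinitely differentiable test function $\phi$ on $\mathbb{R}^n$, $$\int_{\mathbb{R}^n}\|x\|^{-p}\phi(x)\,dx=\int_{S^{n-1}}\int_0^\infty t^{p-1}\hat\phi(t\theta)\,dt\,d\mu(\theta),$$ where $\hat\phi(y)=\int\phi(x)\exp(-i\langle x,y\rangle)\,dx$. $SL_{-k}^n$ is the set of all star-bodies $K$ in $\mathbb{R}^n$ for which $(\mathbb{R}^n,\|\cdot\|_K)$ embeds in $L_{-k}$. For $p\ne 0$ the $p$-norm sum of two bodies $L_1,L_2$ is the body $L$ with $\|\cdot\|_L^p=\|\cdot\|_{L_1}^p+\|\cdot\|_{L_2}^p$. $D_p^n$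 is the class of star-bodies created from the Euclidean unit ball of $\mathbb{R}^n$ by applying full-rank linear transformations, $p$-norm sums, and taking limits in the radial metric; $D_{-k}^n$ is this class for $p=-k$. *)

(* Defs.v *)
From HB Require Import structures.
From mathcomp Require Import all_boot all_order all_algebra.
From mathcomp Require Import all_classical all_reals all_analysis.
From mathcomp Require Import measurable_realfun complex.

Set Implicit Arguments.
Unset Strict Implicit.
Unset Printing Implicit Defensive.

Import Order.TTheory GRing.Theory Num.Theory.
Import numFieldNormedType.Exports.

Local Open Scope classical_set_scope.
Local Open Scope ring_scope.

(* R^n is 'rV[R]_n, with the product topology (which is the topology of the
   Euclidean norm) and its Borel sigma-algebra. *)

Definition borelRn (R : realType) (n : nat) :=
  g_sigma_algebraType (@open 'rV[R]_n).

Definition dotp (R : realType) (n : nat) (x y : 'rV[R]_n) : R :=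
  \sum_(i < n) x ord0 i * y ord0 i.

(* The library norm `|x| on 'rV[R]_n is the sup norm. *)
Definition enorm (R : realType) (n : nat) (x : 'rV[R]_n) : R :=
  Num.sqrt (dotp x x).

Definition unit_sphere (R : realType) (n : nat) : set 'rV[R]_n :=
  [set x | enorm x = 1].

Definition unit_ball (R : realType) (n : nat) : set 'rV[R]_n :=
  [set x | enorm x <= 1].

Section BorelRn.
Variable R : realType.

Let cube n (c : 'rV[rat]_n * nat) : set 'rV[R]_n :=
  [set v | forall j, `|ratr (c.1 ord0 j) - v ord0 j| < c.2.+1%:R^-1].

Let open_cubes n (U : set 'rV[R]_n) : open U ->
  U = \bigcup_(c in [set c | cube c `<=` U]) cube c.
Proof.
move=> oU; apply/seteqP; split=> [v Uv|v [c cU cv]]; last exact: cU.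
have /nbhs_ballP[e /= e0 veU] : nbhs v U by apply: open_nbhs_nbhs.
have [m m0] : exists m : nat, m.+1%:R^-1 < e / 2 :> R.
  have e20 : 0 < e / 2 by rewrite divr_gt0.
  exists (Num.truncn (e / 2)^-1); rewrite invf_plt ?posrE//.
  exact: truncnS_gt.
have m1 : 0 < m.+1%:R^-1 :> R by rewrite invr_gt0.
have /choice[q qv] (j : 'I_n) :
    exists q : rat, `|ratr q - v ord0 j| < m.+1%:R^-1.
  have : v ord0 j - m.+1%:R^-1 < v ord0 j + m.+1%:R^-1.
    by rewrite ltrBlDr -addrA ltrDl addr_gt0.
  move/rat_in_itvoo => [q /[!in_itv]/= /andP[q1 q2]].
  exists q; rewrite distrC ltr_norml; apply/andP; split.
    by rewrite ltrBrDl ltrBlDr.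
  by rewrite ltrBlDr addrC -ltrBlDr.
exists (\row_j q j, m) => /= [w /= wq|j]; last by rewrite mxE.
apply: veU; split=> // i j; rewrite (ord1 i) /ball/=.
have := wq j; rewrite mxE => wqj.
rewrite -(subrKA (ratr (q j))) (le_lt_trans (ler_normD _ _))//.
by rewrite [ltRHS](splitr e) ltrD// ?(lt_trans wqj)// distrC (lt_trans (qv j)).
Qed.

Lemma measurable_fun_borelRn d (T : measurableType d) n (f : T -> borelRn R n) :
  (forall j, measurable_fun setT (fun t => (f t : 'rV[R]_n) ord0 j)) ->
  measurable_fun setT f.
Proof.
move=> mf; apply: (@measurability _ _ T (borelRn R n) setT f (@open 'rV[R]_n)) => //.
move=> _ [U oU <-]; rewrite setTI (open_cubes oU) preimage_bigcup.
rewrite bigcup_mkcond; apply: countable_bigcupT_measurable => [|c]; first exact: countableP.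
case: ifPn => _ //.
rewrite (_ : _ @^-1` _ = \bigcap_(j in [set: 'I_n])
    (fun t => (f t : 'rV[R]_n) ord0 j) @^-1`
      ball (ratr (c.1 ord0 j) : R) c.2.+1%:R^-1).
  apply: fin_bigcap_measurable => // j _.
  rewrite -[X in measurable X]setTI; apply: mf => //.
  by apply: open_measurable; exact: ball_open.
by apply/seteqP; split=> t /= h j; [move=> _; exact: h|exact: h].
Qed.

Lemma measurable_coord n (j : 'I_n) :
  measurable_fun setT (fun v : borelRn R n => (v : 'rV[R]_n) ord0 j).
Proof.
apply: (@measurability _ _ (borelRn R n) R setT _ _
  (RGenOInfty.measurableE R)) => //.
move=> _ [_ [x ->] <-]; rewrite setTI; apply: sub_sigma_algebra.
apply: open_comp; last exact: interval_open.
by move=> v _; exact: coord_continuous.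
Qed.

(* Lebesgue measure on R^(n+1) is the image of the product of the Lebesgue
   measures on R and R^n under (a, v) |-> row_mx a v. *)

Definition Rn_cons n (p : R * borelRn R n) : borelRn R n.+1 :=
  row_mx p.1%:M (p.2 : 'rV[R]_n) : 'rV[R]_(1 + n).

Let Rn_cons_head n (p : R * borelRn R n) (i : 'I_1) :
  (Rn_cons p : 'rV[R]_n.+1) ord0 (lshift n i) = p.1.
Proof.
by apply: etrans (row_mxEl _ _ _ _) _; rewrite (ord1 i) mxE eqxx mulr1n.
Qed.

Let Rn_cons_tail n (p : R * borelRn R n) (i : 'I_n) :
  (Rn_cons p : 'rV[R]_n.+1) ord0 (rshift 1 i) = (p.2 : 'rV[R]_n) ord0 i.
Proof. exact: row_mxEr. Qed.

Let Rn_uncons n (v : borelRn R n.+1) : R * borelRn R n :=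
  ((v : 'rV[R]_n.+1) ord0 ord0, rsubmx (v : 'rV[R]_(1 + n))).

Let Rn_consK n : cancel (@Rn_cons n) (@Rn_uncons n).
Proof.
move=> [a v]; congr pair; last exact: row_mxKr.
apply: etrans (Rn_cons_head (a, v) ord0).
by congr (fun_of_matrix _ _ _); exact: val_inj.
Qed.

Lemma measurable_Rn_cons n : measurable_fun setT (@Rn_cons n).
Proof.
apply: measurable_fun_borelRn => j.
have [i ->|i ->] := @split_ordP 1 n j.
  under eq_fun do rewrite Rn_cons_head.
  exact: measurable_fst.
under eq_fun do rewrite Rn_cons_tail.
exact: (measurableT_comp (measurable_coord i) measurable_snd).
Qed.

Let measurable_Rn_uncons n : measurable_fun setT (@Rn_uncons n).
Proof.
apply: measurable_fun_pair; first exact: measurable_coord.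
apply: measurable_fun_borelRn => j.
under eq_fun do rewrite mxE.
exact: measurable_coord.
Qed.

Section Step.
Local Open Scope ereal_scope.
Variables (n : nat) (m : {sigma_finite_measure set (borelRn R n) -> \bar R}).

Definition lebesgue_Rn_step : set (borelRn R n.+1) -> \bar R :=
  pushforward (@lebesgue_measure R \x m) (@Rn_cons n).

Let mcons := @measurable_Rn_cons n.

Let step0 : lebesgue_Rn_step set0 = 0.
Proof. by rewrite /lebesgue_Rn_step /pushforward preimage_set0 measure0. Qed.

Let step_ge0 A : 0 <= lebesgue_Rn_step A.
Proof. by rewrite /lebesgue_Rn_step /pushforward measure_ge0. Qed.

Let step_sigma_additive : semi_sigma_additive lebesgue_Rn_step.
Proof.
rewrite /lebesgue_Rn_step.
exact: (@measure_semi_sigma_additive _ _ _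
  (measure_function_pushforward__canonical__measure_function_Measure
     (lebesgue_measure \x m) mcons)).
Qed.

HB.instance Definition _ := isMeasure.Build _ _ _ lebesgue_Rn_step
  step0 step_ge0 step_sigma_additive.

Let sigma_finite_step : sigma_finite setT lebesgue_Rn_step.
Proof.
have /sigma_finiteP[F [TF ndF Foo]] := sigma_finiteT (@lebesgue_measure R).
have /sigma_finiteP[G [TG ndG Goo]] := sigma_finiteT m.
exists (fun k => @Rn_uncons n @^-1` (F k `*` G k)).
  apply/seteqP; split=> // v _.
  have [i _ Fi] : (\bigcup_k F k) (@Rn_uncons n v).1 by rewrite -TF.
  have [j _ Gj] : (\bigcup_k G k) (@Rn_uncons n v).2 by rewrite -TG.
  exists (maxn i j) => //; split.
    by move: Fi; exact/subsetPset/ndF/leq_maxl.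
  by move: Gj; exact/subsetPset/ndG/leq_maxr.
move=> k; have [mF Fk] := Foo k; have [mG Gk] := Goo k; split.
  rewrite -[X in measurable X]setTI; apply: measurable_Rn_uncons => //.
  exact: measurableX.
rewrite /lebesgue_Rn_step /pushforward -comp_preimage.
rewrite (_ : _ \o _ = id); last by apply/funext => p; exact: Rn_consK.
by rewrite product_measure1E// lte_mul_pinfty// ge0_fin_numE.
Qed.

HB.instance Definition _ :=
  Measure_isSigmaFinite.Build _ _ _ lebesgue_Rn_step sigma_finite_step.

End Step.

Fixpoint lebesgue_Rn (n : nat) :
    {sigma_finite_measure set (borelRn R n) -> \bar R} :=
  match n with
  | 0 => \d_ ((0 : 'rV[R]_0) : borelRn R 0)
  | n'.+1 => lebesgue_Rn_step (lebesgue_Rn n')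
  end.

End BorelRn.

Section TestFunctions.
Variables (R : realType) (n : nat).
Implicit Types (f : 'rV[R]_n -> R) (x y : 'rV[R]_n).

(* The iterated partial derivative of f along the coordinates listed in s. *)
Definition pderiv (s : seq 'I_n) f : 'rV[R]_n -> R :=
  foldr (fun i (g : 'rV[R]_n -> R) x => 'D_(delta_mx ord0 i) g x) f s.

Definition smooth f := forall s x, differentiable (pderiv s f) x.

Definition rapidly_decreasing f := forall (s : seq 'I_n) (m : nat),
  exists C : R, forall x, enorm x ^+ m * `|pderiv s f x| <= C.

Definition even_test_function f :=
  [/\ smooth f, rapidly_decreasing f & forall x, f (- x) = f x].

Definition cexpi (a : R) : R[i] := (cos a +i* sin a)%C.

Definition Rn_cintegral (g : 'rV[R]_n -> R[i]) : R[i] :=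
  (Rintegral (lebesgue_Rn R n) setT (fun x => complex.Re (g x)) +i*
   Rintegral (lebesgue_Rn R n) setT (fun x => complex.Im (g x)))%C.

Definition fourier f y : R[i] :=
  Rn_cintegral (fun x => (f x)%:C%C * cexpi (- dotp x y)).

End TestFunctions.

Section StarBodies.
Variables (R : realType) (n : nat).
Implicit Types (K L : set 'rV[R]_n) (x : 'rV[R]_n).

(* For a star body and x != 0 the supremum is a maximum. *)
Definition radial K x : R := sup [set r | 0 <= r /\ K (r *: x)].

(* For a star body the infimum is a minimum, unless no multiple of K contains
   x. That case (radial K x = 0, the norm is +oo) gets the value 0; as the norm
   is used below under negative exponents only and 0 `^ (- p) = 0 for p != 0,
   this gives (+oo) `^ (- p) = 0 as it should. *)
Definition minkowski K x : R :=
  inf [set t | 0 <= t /\ ((fun y => t *: y) @` K) x].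

Definition star_body K :=
  [/\ compact K /\ K° !=set0,
      K = -%R @` K,
      forall t : R, 0 <= t <= 1 -> (fun y => t *: y) @` K `<=` K,
      {within @unit_sphere R n, continuous (radial K)} &
      forall x, unit_sphere x -> radial K (- x) = radial K x].

Definition radial_dist K L : R :=
  sup [set `|radial K x - radial L x| | x in @unit_sphere R n].

(* The space (R^n, N) embeds in L_{-p}, for 0 < p < n. A measure on the sphere
   is a measure on R^n that vanishes outside the sphere. The test functions are
   real-valued, so that the Fourier transform of an even one is real-valued. *)
Definition embeds_Lneg (p : R) (N : 'rV[R]_n -> R) :=
  exists2 mu : {measure set (borelRn R n) -> \bar R},
    mu (~` @unit_sphere R n) = 0%E &
    forall phi, even_test_function phi ->
      (\int[lebesgue_Rn R n]_x (N x `^ (- p) * phi x)%:E =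
       \int[mu]_(x in @unit_sphere R n)
         (\int[lebesgue_measure]_(t in `]0, +oo[)
            (t `^ (p - 1) * complex.Re (fourier phi (t *: (x : 'rV[R]_n)))))%R%:E)%E.

Definition SLneg (p : R) : set (set 'rV[R]_n) :=
  [set K | star_body K /\ embeds_Lneg p (minkowski K)].

(* L is the (-p)-norm sum of L1 and L2, for 0 < p. *)
Definition is_neg_norm_sum (p : R) L1 L2 L :=
  star_body L /\ forall x,
    minkowski L x `^ (- p) = minkowski L1 x `^ (- p) + minkowski L2 x `^ (- p).

Inductive Dneg (p : R) : set 'rV[R]_n -> Prop :=
| Dneg_ball : Dneg p (@unit_ball R n)
| Dneg_linear K (A : 'M[R]_n) :
    Dneg p K -> A \in unitmx -> Dneg p ((fun x => x *m A) @` K)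
| Dneg_sum L1 L2 L :
    Dneg p L1 -> Dneg p L2 -> is_neg_norm_sum p L1 L2 L -> Dneg p L
| Dneg_lim (K_ : nat -> set 'rV[R]_n) L :
    (forall i, Dneg p (K_ i)) -> star_body L ->
    radial_dist (K_ i) L @[i --> \oo] --> 0 -> Dneg p L.

End StarBodies.

(* Main.v *)
Require Import Defs.
From HB Require Import structures.
From mathcomp Require Import all_boot all_order all_algebra.
From mathcomp Require Import all_classical all_reals all_analysis.
From mathcomp Require Import measurable_realfun ring lra.

Set Implicit Arguments.
Unset Strict Implicit.
Unset Printing Implicit Defensive.

Import Order.TTheory GRing.Theory Num.Theory.
Import numFieldNormedType.Exports.

Local Open Scope classical_set_scope.
Local Open Scope ring_scope.

(** Put [p := k - 1], write [x_0] for the head coordinate, and let [K] be the set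
    of the [x] with [enorm x ^+ (p + 5) <= ((p + 3) * x_0 ^+ 2 - 3 * dotp x x) ^+ 2].
    The [k]-th power of its radial function is the function [cone_gauge], the
    square of a quadratic form divided by a power of the Euclidean norm; it
    vanishes to second order along a cone. This body is in [SLneg k] and not in
    [Dneg k].

    Membership. The function
    [gauss_weight y = (6 * p + (p + 3) * y_0 ^+ 4) * expR (- (dotp y y / 2))] is
    positive, and its Fourier transform is again a polynomial of degree four in
    [x_0] times a Gaussian, by the recurrence of the Gaussian moments
    ([cosmom4E]). Integrated with the weight [s ^+ p] along the ray through [x],
    this transform gives a positive multiple of [cone_gauge x]: the two
    coefficients of the weight are those for which the resulting polynomial is a
    perfect square ([integral_posX_gauss_weight_hat]). So for a test function [f]
    the integral of [cone_gauge * f] is, up to a constant and three exchanges of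
    integrals ([weighted_radial_cosint]), the integral over [y] of [gauss_weight y]
    times the integral of [s ^+ p] times the transform of [f] along the ray
    through [y]. The latter is homogeneous of degree [- k] in [y], so the measure
    [gauss_weight y * enorm y ^- k dy] can be pushed to the sphere
    ([integral_sphere_measure]). The exchanges are absolutely convergent because
    [k] is less than the dimension; all the estimates compare with the product
    [lorentzn] of the functions [1 / (1 + x_i ^+ 2)].

    Exclusion. Let [m] be the dimension minus one, and integrate the [k]-th power
    of the radial function over balls of the affine hyperplane [x_0 = 1]. A body
    in [Dneg k], or a linear image of it, satisfies the inequality [spreads]: for
    [1 <= l] the integral over the ball of radius [(2 * l - 1) * r] is at least
    [l] times the integral over the ball of radius [r]. For an ellipsoid, a
    homothety of ratio [l] whose center is the point of the small ball nearest to
    the origin (in the norm of the ellipsoid) multiplies this norm by at most [l]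
    and maps the small ball into the large one; this costs a factor [l ^- k] and
    the change of variables gains [l ^+ m], where [k + 1 <= m]. The inequality is
    linear in the [k]-th power of the radial function, hence preserved by the
    sums, and it passes to limits in the radial metric by dominated convergence
    ([Dneg_spreads]). For [K], the integrand is
    [(p - 3 * dotp y y) ^+ 2] over a power of [1 + dotp y y], with a double zero
    at the radius [r = Num.sqrt (p / 3)]. With [l = 1 + e] the annulus contributes
    only [O(e ^+ 3)], bounded here by [O(e ^+ 2)], whereas the inequality demands
    [e] times a positive constant ([quartic_body_not_spreads]). *)

(** * Iterated integration over the coordinates *)

Section CoordinatewiseIntegration.
Variable R : realType.
Local Notation leb := (@lebesgue_measure R).
Local Notation lebn n := (lebesgue_Rn R n).

Lemma Rn_cons0 n (a : R) (v : 'rV[R]_n) :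
  (Rn_cons (a, v : borelRn R n) : 'rV[R]_n.+1) ord0 ord0 = a.
Proof.
rewrite (_ : ord0 = lshift n (ord0 : 'I_1)); last exact: val_inj.
by apply: etrans (row_mxEl _ _ _ _) _; rewrite mxE eqxx mulr1n.
Qed.

Lemma Rn_consS n (a : R) (v : 'rV[R]_n) (i : 'I_n) :
  (Rn_cons (a, v : borelRn R n) : 'rV[R]_n.+1) ord0 (lift ord0 i) = v ord0 i.
Proof.
rewrite (_ : lift ord0 i = rshift 1 i); last exact: val_inj.
exact: row_mxEr.
Qed.

Lemma measurable_dotp n d (T : measurableType d) (f g : T -> borelRn R n) :
  measurable_fun setT f -> measurable_fun setT g ->
  measurable_fun setT (fun t => dotp (f t) (g t)).
Proof.
move=> mf mg; rewrite /dotp; apply: measurable_sum => i.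
by apply: measurable_funM;
  [exact: (measurableT_comp (measurable_coord i) mf)
  |exact: (measurableT_comp (measurable_coord i) mg)].
Qed.

Lemma continuous_measurable_Rn n (f : 'rV[R]_n -> R) :
  continuous f -> measurable_fun setT (f : borelRn R n -> R).
Proof.
move=> cf; apply: (@measurability _ _ (borelRn R n) R setT _ _
  (RGenOInfty.measurableE R)) => //.
move=> _ [_ [x ->] <-]; rewrite setTI; apply: sub_sigma_algebra.
by apply: open_comp; [move=> v _; exact: cf|exact: interval_open].
Qed.

(** [lebesgue_Rn n.+1] is by definition the image of this measure under [Rn_cons],
    so Fubini's theorem is applied to it. *)
Definition lebcons n : {measure set (measurableTypeR R * borelRn R n) -> \bar R} :=
  (leb \x lebn n)%E.

Lemma lebesgue_RnS n : (lebn n.+1 : set _ -> \bar R) =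
  pushforward (lebcons n) (@Rn_cons R n).
Proof. by []. Qed.

Let measurable_cons n : measurable_fun setT
  (@Rn_cons R n : (measurableTypeR R * borelRn R n) -> borelRn R n.+1).
Proof. exact: measurable_Rn_cons. Qed.

Lemma ge0_integral_Rn_cons n (F : borelRn R n.+1 -> \bar R) :
  measurable_fun setT F -> (forall x, 0 <= F x)%E ->
  (\int[lebn n.+1]_x F x = \int[leb]_a \int[lebn n]_v F (Rn_cons (a, v)))%E.
Proof.
move=> mF F0.
have mFc := measurableT_comp mF (@measurable_cons n).
transitivity (\int[lebcons n]_p F (Rn_cons p))%E.
  have := @ge0_integral_pushforward _ _ _ _ _ _ (@measurable_cons n)
    (lebcons n) setT F measurableT mF (fun y _ => F0 y).
  by rewrite preimage_setT -lebesgue_RnS.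
exact: (@fubini_tonelli1 _ _ _ _ R leb (lebn n) (F \o @Rn_cons R n) mFc
  (fun p => F0 _)).
Qed.

Lemma integrable_Rn_cons n (F : borelRn R n.+1 -> \bar R) :
  (lebn n.+1).-integrable setT F ->
  (lebcons n).-integrable setT (F \o @Rn_cons R n).
Proof.
move=> /integrableP[mF Foo]; apply/integrableP; split.
  exact: measurableT_comp mF (@measurable_cons n).
apply: le_lt_trans Foo; rewrite le_eqVlt; apply/orP; left; apply/eqP.
apply/esym.
have := @ge0_integral_pushforward _ _ _ _ _ _ (@measurable_cons n)
  (lebcons n) setT (abse \o F) measurableT
  (measurableT_comp (@abse_measurable R setT) mF) (fun y _ => abse_ge0 _).
by rewrite preimage_setT -lebesgue_RnS.
Qed.

Lemma integral_Rn_cons n (F : borelRn R n.+1 -> \bar R) :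
  (lebn n.+1).-integrable setT F ->
  (\int[lebn n.+1]_x F x = \int[leb]_a \int[lebn n]_v F (Rn_cons (a, v)))%E.
Proof.
move=> iF; have iFc := integrable_Rn_cons iF.
have mF := measurable_int _ iF.
transitivity (\int[lebcons n]_p F (Rn_cons p))%E; last first.
  by apply/esym; exact: (integral12_prod_meas1 iFc).
have := @integral_pushforward _ _ _ _ _ _ (@measurable_cons n)
  (lebcons n) setT F mF.
by rewrite preimage_setT -lebesgue_RnS; apply.
Qed.

Lemma integral_Rn_consC n (F : borelRn R n.+1 -> \bar R) :
  (lebn n.+1).-integrable setT F ->
  (\int[lebn n.+1]_x F x = \int[lebn n]_v \int[leb]_a F (Rn_cons (a, v)))%E.
Proof.
by move=> iF; rewrite integral_Rn_cons//; exact: (Fubini (integrable_Rn_cons iF)).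
Qed.

Lemma ge0_integral_Rn_tensor n (f : R -> R) (g : 'rV[R]_n -> R) :
  measurable_fun setT f -> measurable_fun setT (g : borelRn R n -> R) ->
  (forall x, 0 <= f x) -> (forall x, 0 <= g x) ->
  (\int[lebn n.+1]_x
     (f ((x : 'rV[R]_n.+1) ord0 ord0) * g (\row_j (x : 'rV[R]_n.+1) ord0 (lift ord0 j)))%:E =
   \int[leb]_a (f a)%:E * \int[lebn n]_v (g v)%:E)%E.
Proof.
move=> mf mg f0 g0.
have mtl : measurable_fun setT (fun x : borelRn R n.+1 =>
    (\row_j (x : 'rV[R]_n.+1) ord0 (lift ord0 j)) : borelRn R n).
  apply: measurable_fun_borelRn => j; under eq_fun do rewrite mxE.
  exact: measurable_coord.
rewrite ge0_integral_Rn_cons; last 2 first.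
- apply/measurable_EFinP/measurable_funM.
    exact: (measurableT_comp mf (measurable_coord _)).
  exact: (measurableT_comp mg mtl).
- by move=> x; rewrite lee_fin mulr_ge0.
have mg' : measurable_fun setT (fun v : borelRn R n => (g v)%:E) by exact/measurable_EFinP.
rewrite -ge0_integralZr//; last 3 first.
- exact/measurable_EFinP.
- by move=> a _; rewrite lee_fin.
- by apply: integral_ge0 => v _; rewrite lee_fin.
apply: eq_integral => a _.
rewrite -ge0_integralZl//; last 2 first.
- by move=> v _; rewrite lee_fin.
- by rewrite lee_fin.
apply: eq_integral => v _; rewrite EFinM Rn_cons0; congr (_ * (g _)%:E)%E.
by apply/rowP => j; rewrite mxE Rn_consS.
Qed.

End CoordinatewiseIntegration.

(** * Homotheties *)

Section AffineSubstitution.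
Variable R : realType.
Local Notation leb := (@lebesgue_measure R).
Local Notation lebn n := (lebesgue_Rn R n).

Lemma measurable_affine (a b : R) :
  measurable_fun setT ((fun t => a * t + b) : measurableTypeR R -> measurableTypeR R).
Proof.
apply: measurable_funD; last exact: measurable_cst.
by apply: measurable_funM; [exact: measurable_cst|exact: measurable_id].
Qed.

Let affine_measure (a b : R) : {measure set (measurableTypeR R) -> \bar R} :=
  measure_function_pushforward__canonical__measure_function_Measure leb
    (measurable_affine a b).

(** Both sides are measures, and they agree on intervals. *)
Lemma lebesgue_measure_affine (a b : R) (a0 : 0 < a) (A : set R) : measurable A ->
  leb A = (a%:E * leb ((fun t => (a * t + b)%R) @^-1` A))%E.
Proof.
move=> mA; pose k := NngNum (ltW a0).
have -> : (a%:E * leb ((fun t => (a * t + b)%R) @^-1` A))%E =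
    mscale k (affine_measure a b) A by [].
apply: (lebesgue_measure_unique _ mA) => _ [[u v]] _ <-.
have E : (fun t => a * t + b) @^-1` `]u, v] = `](u - b) / a, (v - b) / a]%classic.
  apply/seteqP; split=> t /=; rewrite !in_itv/= ltr_pdivrMr// ler_pdivlMr//;
    by rewrite ltrBlDr lerBrDr mulrC.
transitivity (a%:E * leb ((fun t => a * t + b)%R @^-1` `]u, v]))%E; last by [].
rewrite E.
rewrite !lebesgue_measure_itv/= !lte_fin ltr_pM2r ?invr_gt0// ltrD2r.
case: ifPn => _; last by rewrite mule0.
rewrite -EFinD -EFinM; congr (_%:E).
by field; rewrite gt_eqF.
Qed.

Lemma ge0_integral_affine (a b : R) (F : R -> \bar R) : 0 < a ->
  measurable_fun setT F -> (forall t, 0 <= F t)%E ->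
  (\int[leb]_t F t = a%:E * \int[leb]_t F (a * t + b)%R)%E.
Proof.
move=> a0 mF F0.
have := @ge0_integral_pushforward _ _ _ _ _ _ (measurable_affine a b)
    leb setT F measurableT mF (fun y _ => F0 y).
rewrite preimage_setT => <-; pose k := NngNum (ltW a0).
rewrite -(@ge0_integral_mscale _ _ R (affine_measure a b) _ measurableT k F mF)//.
apply: eq_measure_integral => A mA _.
exact: (lebesgue_measure_affine b a0 mA).
Qed.

Lemma Rn_cons_affine n (a t : R) (b : 'rV[R]_n.+1) (v : 'rV[R]_n) :
  a *: (Rn_cons (t, v : borelRn R n) : 'rV[R]_n.+1) + b =
  Rn_cons (a * t + b ord0 ord0,
           (a *: v + \row_j b ord0 (lift ord0 j)) : borelRn R n).
Proof.
have E m (x y : 'rV[R]_m) j : (a *: x + y) ord0 j = a * x ord0 j + y ord0 j.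
  by rewrite !mxE.
apply/rowP => j; rewrite E; case: (unliftP ord0 j) => [i ->|->].
  by rewrite !Rn_consS E mxE.
by rewrite !Rn_cons0.
Qed.

Lemma measurable_Rn_affine n (a : R) (b : 'rV[R]_n) :
  measurable_fun setT (fun x : borelRn R n => (a *: (x : 'rV[R]_n) + b) : borelRn R n).
Proof.
apply: measurable_fun_borelRn => j; under eq_fun do rewrite !mxE.
by apply: measurable_funD => //; apply: measurable_funM => //; exact: measurable_coord.
Qed.

Lemma ge0_integral_Rn_affine n (a : R) (b : 'rV[R]_n) (F : 'rV[R]_n -> \bar R) :
  0 < a -> measurable_fun setT (F : borelRn R n -> \bar R) ->
  (forall x, 0 <= F x)%E ->
  (\int[lebn n]_x F x = (a ^+ n)%:E * \int[lebn n]_x F (a *: (x : 'rV[R]_n) + b)%R)%E.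
Proof.
move=> a0; elim: n b F => [|n IH] b F mF F0.
  rewrite expr0 mul1e /=; apply: eq_integral => x _.
  by congr F; rewrite [LHS]thinmx0 [RHS]thinmx0.
have ma := @measurable_Rn_affine n.+1 a b.
have mc : measurable_fun setT
  (@Rn_cons R n : (measurableTypeR R * borelRn R n) -> borelRn R n.+1).
  exact: measurable_Rn_cons.
rewrite (ge0_integral_Rn_cons mF F0).
rewrite (@ge0_integral_Rn_cons _ _ (fun x : borelRn R n.+1 => F (a *: (x : 'rV[R]_n.+1) + b)));
  last 2 first.
- exact: measurableT_comp mF ma.
- by move=> x; exact: F0.
have mG : measurable_fun setT (fun t => \int[lebn n]_v F (Rn_cons (t, v)))%E.
  apply: (@measurable_fun_fubini_tonelli_F _ _ _ _ R (lebn n) (F \o @Rn_cons R n)).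
    exact: measurableT_comp mF mc.
  by move=> ?; exact: F0.
have G0 t : (0 <= \int[lebn n]_v F (Rn_cons (t, v)))%E.
  by apply: integral_ge0 => v _; exact: F0.
apply: etrans (@ge0_integral_affine a (b ord0 ord0) _ a0 mG G0) _.
pose b' : 'rV[R]_n := \row_j b ord0 (lift ord0 j).
transitivity (a%:E * \int[leb]_t ((a ^+ n)%:E *
    \int[lebn n]_v F (Rn_cons (a * t + b ord0 ord0, a *: (v : 'rV[R]_n) + b'))%R))%E.
  congr (_ * _)%E; apply: eq_integral => t _; apply: (IH b' (fun v => F (Rn_cons (_, v)))).
    exact: (measurableT_comp mF (measurableT_comp mc (pair1_measurable _))).
  by move=> x; exact: F0.
rewrite ge0_integralZl//; last 3 first.
- have mA : measurable_fun setT (fun p : measurableTypeR R * borelRn R n =>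
    F (a *: (Rn_cons p : 'rV[R]_n.+1) + b)).
    exact: measurableT_comp mF (measurableT_comp ma mc).
  apply: eq_measurable_fun (@measurable_fun_fubini_tonelli_F _ _ _ _ R (lebn n)
     (fun p => F (a *: (Rn_cons p : 'rV[R]_n.+1) + b)) mA _) => //.
  by move=> t _; apply: eq_integral => v _; rewrite /= Rn_cons_affine.
- by move=> t _; apply: integral_ge0 => v _; exact: F0.
- by rewrite lee_fin exprn_ge0// ltW.
rewrite muleA -EFinM -exprS; congr (_ * _)%E.
apply: eq_integral => t _; apply: eq_integral => v _.
by rewrite Rn_cons_affine.
Qed.

End AffineSubstitution.

(** * Integrals of derivatives on the line *)

Section LineIntegrals.
Variable R : realType.
Local Notation leb := (@lebesgue_measure R).

Lemma is_derive_continuous (h h' : R -> R) :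
  (forall t, is_derive t (1 : R) h (h' t)) -> continuous h.
Proof.
move=> dh t; apply: differentiable_continuous; apply/derivable1_diffP.
by have [] := dh t.
Qed.

(** The fundamental theorem of calculus on segments that exhaust [D], and
    dominated convergence. *)
Lemma integral_derive_cvg (D : set R) (a_ b_ : nat -> R) (h h' g : R -> R) (l : R) :
  measurable D -> (forall n, a_ n < b_ n) -> (forall n, `[a_ n, b_ n] `<=` D) ->
  (forall t, D t -> \forall n \near \oo, a_ n <= t <= b_ n) ->
  (forall t, is_derive t (1 : R) h (h' t)) -> continuous h' ->
  leb.-integrable D (EFin \o g) -> (forall t, D t -> `|h' t| <= g t) ->
  h (b_ n) - h (a_ n) @[n --> \oo] --> l ->
  (\int[leb]_(t in D) (h' t)%:E = l%:E)%E.
Proof.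
move=> mD ab abD abnear dh ch' ig h'g hl.
have mh' : measurable_fun setT h' by exact: continuous_measurable_fun.
pose f_ n t := ((h' \_ `[a_ n, b_ n]) t)%:E.
have mf_ n : measurable_fun D (f_ n).
  apply/measurable_EFinP; apply: measurable_funTS.
  by apply/(measurable_restrictT _ _).1 => //; exact: measurable_funTS.
have [|||_ _] := @dominated_convergence _ _ R leb D mD f_ (EFin \o h')
    (EFin \o g) mf_ _ _ ig.
- by apply/measurable_EFinP; exact: measurable_funTS.
- apply: aeW => t Dt; apply: cvg_near_cst.
  near=> n; rewrite /f_ patchE mem_set//= in_itv/=.
  by near: n; exact: abnear.
- apply: aeW => t n Dt; rewrite /f_ lee_fin patchE; case: ifPn => _.
    exact: h'g.
  by rewrite normr0 (le_trans _ (h'g _ Dt)).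
move=> cvI; have E n : (\int[leb]_(t in D) f_ n t)%E = (h (b_ n) - h (a_ n))%:E.
  rewrite (_ : f_ n = (EFin \o h') \_ `[a_ n, b_ n]); last first.
    by rewrite restrict_EFin.
  rewrite -integral_mkcondr setIidr//=.
  rewrite (@continuous_FTC2 _ h' h)//; first exact: continuous_subspaceT.
    split.
    - by move=> x _; have [] := dh x.
    - by apply: cvg_at_right_filter; exact: is_derive_continuous dh _.
    - by apply: cvg_at_left_filter; exact: is_derive_continuous dh _.
  by move=> x _; rewrite derive1E; have [_] := dh x.
rewrite -(cvg_lim _ cvI)//; apply/cvg_lim => //.
rewrite (_ : (fun n => _) = (fun n => (h (b_ n) - h (a_ n))%:E)); last exact/funext.
by apply: cvg_EFin => //; exact: nearW.
Unshelve. all: by end_near. Qed.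

(** The majorant of all the estimates: unlike a power of [1 + dotp x x], it yields
    a majorant in several variables that is a product ([lorentzn]). *)
Definition lorentz (t : R) : R := (1 + t ^+ 2)^-1.

Lemma lorentz_gt0 t : 0 < lorentz t.
Proof. by rewrite invr_gt0 ltr_wpDr// sqr_ge0. Qed.

Lemma lorentz_le1 t : lorentz t <= 1.
Proof. by rewrite invf_le1 ?lerDl ?sqr_ge0// ltr_wpDr// sqr_ge0. Qed.

Lemma continuous_lorentz : continuous lorentz.
Proof. exact: continuous_oneDsqrV. Qed.

Lemma measurable_lorentz : measurable_fun setT lorentz.
Proof. exact: continuous_measurable_fun continuous_lorentz. Qed.

Lemma integral_lorentz : (\int[leb]_t (lorentz t)%:E < +oo)%E.
Proof.
rewrite ge0_symfun_integralT; last 3 first.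
- by move=> x; exact: ltW (lorentz_gt0 x).
- exact: continuous_lorentz.
- by move=> x; rewrite /= /lorentz sqrrN.
rewrite -set_itvcy (@ge0_continuous_FTC2y _ lorentz (@atan R) 0 (pi / 2)).
- by rewrite -EFinB -EFinM ltry.
- by move=> x _; exact: ltW (lorentz_gt0 x).
- exact: continuous_subspaceT continuous_lorentz.
- exact: cvgy_atan.
- by move=> x _; exact: derivable_atan.
- by apply: cvg_at_right_filter; exact: continuous_atan.
- by move=> x _; rewrite derive1_atan.
Qed.

Lemma integrable_lorentz (C : R) (D : set R) : measurable D ->
  leb.-integrable D (EFin \o (fun t => C * lorentz t)).
Proof.
move=> mD; apply: (integrableS measurableT) => //.
rewrite (_ : EFin \o _ = (fun t => C%:E * (EFin \o lorentz) t)%E)//.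
apply: integrableZl => //; apply/integrableP; split.
  by apply/measurable_EFinP; exact: measurable_lorentz.
under eq_integral do rewrite /= ger0_norm ?(ltW (lorentz_gt0 _))//.
exact: integral_lorentz.
Qed.

Lemma cvg_lorentz_nat : lorentz (n.+1%:R : R) @[n --> \oo] --> (0 : R).
Proof.
apply: (@squeeze_cvgr _ _ _ _ (cst 0) (@harmonic R)).
- apply: nearW => n; rewrite (ltW (lorentz_gt0 _))/= /harmonic/= lef_pV2 ?posrE//.
    by rewrite (@le_trans _ _ (n.+1%:R ^+ 2)) ?lerDr// expr2 ler_peMr// ler1n.
- exact: cvg_cst.
- exact: cvg_harmonic.
Qed.

Lemma cvg_le_lorentz (h : R -> R) (C : R) (s : nat -> R) :
  (forall n, s n ^+ 2 = n.+1%:R ^+ 2) -> (forall t, `|h t| <= C * lorentz t) ->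
  h (s n) @[n --> \oo] --> (0 : R).
Proof.
move=> sn hC; apply: norm_cvg0.
apply: (@squeeze_cvgr _ _ _ _ (cst 0) (fun n => C * lorentz (n.+1%:R : R))).
- by apply: nearW => n; rewrite normr_ge0 (le_trans (hC _))// /lorentz sn.
- exact: cvg_cst.
- by rewrite -[X in _ --> X](mulr0 C); apply: cvgMr; exact: cvg_lorentz_nat.
Qed.

(** The bound on [h] makes the boundary terms vanish at infinity. *)
Lemma integral_derive_setT (h h' : R -> R) (C : R) :
  (forall t, is_derive t (1 : R) h (h' t)) -> continuous h' ->
  (forall t, `|h t| <= C * lorentz t) -> (forall t, `|h' t| <= C * lorentz t) ->
  (\int[leb]_t (h' t)%:E = 0)%E.
Proof.
move=> dh ch' hC h'C.
apply: (@integral_derive_cvg setT (fun n => - n.+1%:R) (fun n => n.+1%:R) h h'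
  (fun t => C * lorentz t)) => //.
- by move=> n; rewrite -subr_gt0 opprK addr_gt0.
- move=> t _; near=> n; rewrite -ler_norml.
  rewrite (@le_trans _ _ n%:R)// ?ler_nat//.
  by near: n; exact: nbhs_infty_ger.
- exact: integrable_lorentz.
- rewrite -[X in _ --> X](subr0 0); apply: cvgB; apply: cvg_le_lorentz hC => // n.
  by rewrite sqrrN.
Unshelve. all: by end_near. Qed.

(** Only the boundary term at zero remains. *)
Lemma integral_derive_itvcy (h h' : R -> R) (C : R) :
  (forall t, is_derive t (1 : R) h (h' t)) -> continuous h' ->
  (forall t, `|h t| <= C * lorentz t) -> (forall t, `|h' t| <= C * lorentz t) ->
  (\int[leb]_(t in `[0%R, +oo[) (h' t)%:E = (- h 0)%:E)%E.
Proof.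
move=> dh ch' hC h'C.
apply: (@integral_derive_cvg `[0, +oo[ (fun=> 0) (fun n => n.+1%:R) h h'
  (fun t => C * lorentz t)) => //.
- by move=> n t /=; rewrite !in_itv/= andbT => /andP[].
- move=> t /=; rewrite in_itv/= andbT => t0; near=> n; rewrite t0/=.
  rewrite (@le_trans _ _ n%:R)// ?ler_nat//.
  by near: n; exact: nbhs_infty_ger.
- exact: integrable_lorentz.
- rewrite -[X in _ --> X]add0r; apply: cvgB; last exact: cvg_cst.
  exact: cvg_le_lorentz hC.
Unshelve. all: by end_near. Qed.

End LineIntegrals.

(** * Gaussian moments *)

Section GaussianFourier.
Variable R : realType.
Local Notation leb := (@lebesgue_measure R).
Implicit Types (t x : R) (j : nat).

Definition gauss1 t : R := expR (- (t ^+ 2 / 2)).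

Lemma gauss1_gt0 t : 0 < gauss1 t. Proof. exact: expR_gt0. Qed.

Lemma gauss1N t : gauss1 (- t) = gauss1 t.
Proof. by rewrite /gauss1 sqrrN. Qed.

Lemma is_derive_gauss1 t : is_derive t (1 : R) gauss1 (- t * gauss1 t).
Proof.
rewrite /gauss1; apply: is_derive_eq.
by rewrite /GRing.scale/= ?mulr1 ?expr1; field.
Qed.

Lemma is_derive_exprn j t :
  is_derive t (1 : R) (fun t => t ^+ j) (j%:R * t ^+ j.-1).
Proof.
apply: DeriveDef; first exact: exprn_derivable.
by rewrite exp_derive [LHS]mulr1.
Qed.

(** One term of the exponential series of [expR (t ^+ 2 / 2)], of degree at
    least [j + 2] in [t], dominates [t ^+ j * (1 + t ^+ 2)] for large [t]. *)
Lemma gauss1_moment_bound j :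
  exists2 C, 0 <= C & forall t, `|t| ^+ j * gauss1 t <= C * lorentz t.
Proof.
pose m := j.+1; exists (2 * (1 + 2 ^+ m * m`!%:R)) => [|t].
  by rewrite mulr_ge0// addr_ge0// mulr_ge0// exprn_ge0.
rewrite /lorentz ler_pdivlMr; last by rewrite ltr_wpDr// sqr_ge0.
have x0 : 0 <= t ^+ 2 / 2 by rewrite divr_ge0// sqr_ge0.
rewrite /gauss1 expRN mulrAC ler_pdivrMr ?expR_gt0//.
rewrite (@le_trans _ _ (2 * (1 + (t ^+ 2) ^+ m)))//.
  rewrite -(real_normK (num_real t)); set a := `|t|.
  have a0 : 0 <= a by exact: normr_ge0.
  have [a1|/ltW a1] := lerP a 1.
    rewrite (@le_trans _ _ 2)//; last by rewrite ler_peMr// lerDl !exprn_ge0.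
    rewrite -[leRHS]mul1r ler_pM// ?exprn_ge0// ?exprn_ile1//.
      by rewrite addr_ge0// exprn_ge0.
    by rewrite -[2]/(1 + 1) lerD2l exprn_ile1.
  rewrite (@le_trans _ _ (a ^+ j * (2 * a ^+ 2)))//.
    rewrite ler_pM2l ?exprn_gt0// ?(lt_le_trans _ a1)// mulr_natl mulr2n lerD2r.
    by rewrite exprn_ege1.
  rewrite mulrCA ler_pM2l// -exprD -exprM (@le_trans _ _ (a ^+ (2 * m)))//.
    by apply: ler_weXn2l => //; rewrite /m mul2n -addnn addSnnS leq_add2l.
  by rewrite lerDr.
rewrite -mulrA ler_pM2l// mulrDl mul1r lerD//.
  by rewrite -[leLHS]expR0 ler_expR.
have e1 : (t ^+ 2 / 2) ^+ m / m`!%:R <= expR (t ^+ 2 / 2).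
  by apply: le_trans (expR_ge1Dxn j x0); rewrite lerDr.
have f0 : 0 < m`!%:R :> R by rewrite ltr0n fact_gt0.
move: e1; rewrite ler_pdivrMr// expr_div_n ler_pdivrMr ?exprn_gt0// => e1.
by rewrite (le_trans e1)// le_eqVlt; apply/orP; left; apply/eqP; ring.
Qed.

Definition cosmom j x : R := \int[leb]_t (t ^+ j * gauss1 t * cos (x * t)).
Definition sinmom j x : R := \int[leb]_t (t ^+ j * gauss1 t * sin (x * t)).

Lemma moment_bound j (u : R -> R) : (forall t, `|u t| <= 1) ->
  exists2 C, 0 <= C & forall t, `|t ^+ j * gauss1 t * u t| <= C * lorentz t.
Proof.
move=> u1; have [C C0 HC] := gauss1_moment_bound j; exists C => // t.
rewrite !normrM normrX (ger0_norm (ltW (gauss1_gt0 t))).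
by rewrite (le_trans _ (HC t))// ler_piMr// mulr_ge0 ?exprn_ge0// ltW// gauss1_gt0.
Qed.

Lemma continuous_gauss1 : continuous gauss1.
Proof. exact: is_derive_continuous is_derive_gauss1. Qed.

Lemma continuous_moment j (u : R -> R) : continuous u ->
  continuous (fun t => t ^+ j * gauss1 t * u t).
Proof.
move=> cu t; apply: cvgM; last exact: cu.
by apply: cvgM; [exact: exprn_continuous|exact: continuous_gauss1].
Qed.

Lemma continuous_cosM x : continuous (fun t => cos (x * t)).
Proof.
move=> t; apply: (continuous_comp (f := fun t => x * t)); last exact: continuous_cos.
exact: mulrl_continuous.
Qed.

Lemma continuous_sinM x : continuous (fun t => sin (x * t)).
Proof.
move=> t; apply: (continuous_comp (f := fun t => x * t)); last exact: continuous_sin.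
exact: mulrl_continuous.
Qed.

Lemma cos_norm_le1 t : `|cos t| <= 1.
Proof. by rewrite ler_norml cos_geN1 cos_le1. Qed.

Lemma sin_norm_le1 t : `|sin t| <= 1.
Proof. by rewrite ler_norml sin_geN1 sin_le1. Qed.

Lemma integrable_moment j (u : R -> R) : continuous u -> (forall t, `|u t| <= 1) ->
  leb.-integrable setT (EFin \o (fun t => t ^+ j * gauss1 t * u t)).
Proof.
move=> cu u1; have [C C0 HC] := moment_bound j u1.
apply: (le_integrable measurableT _ _ (integrable_lorentz C measurableT)) => //.
  apply/measurable_EFinP; apply: continuous_measurable_fun.
  exact: (@continuous_moment j u cu).
move=> t _ /=; rewrite lee_fin (le_trans (HC t))//.
by rewrite ger0_norm// mulr_ge0// ltW// lorentz_gt0.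
Qed.

Lemma is_derive_moment j (u u' : R -> R) t : is_derive t (1 : R) u (u' t) ->
  is_derive t (1 : R) (fun t => t ^+ j * gauss1 t * u t)
   (j%:R * (t ^+ j.-1 * gauss1 t * u t) - t ^+ j.+1 * gauss1 t * u t +
    t ^+ j * gauss1 t * u' t).
Proof.
move=> du; have dg := is_derive_gauss1 t; have dj := is_derive_exprn j t.
have d := is_deriveM (is_deriveM dj dg) du.
apply: (@is_derive_eq _ _ _ _ t (1 : R) _ _ d).
by rewrite fctE /GRing.scale/= exprS; ring.
Qed.

(** The integral of the derivative of [t ^+ j * gauss1 t * u t] is zero, and
    [gauss1' t = - t * gauss1 t]. With [j = 0] the first term is zero, so the
    truncation in [j.-1] is harmless. *)
Lemma moment_recurrence j (u v : R -> R) x :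
  (forall t, is_derive t (1 : R) u (x * v t)) -> continuous v ->
  (forall t, `|u t| <= 1) -> (forall t, `|v t| <= 1) ->
  j%:R * (\int[leb]_t (t ^+ j.-1 * gauss1 t * u t)) -
  (\int[leb]_t (t ^+ j.+1 * gauss1 t * u t)) +
  x * (\int[leb]_t (t ^+ j * gauss1 t * v t)) = 0.
Proof.
move=> du cv u1 v1; have cu := is_derive_continuous du.
pose h' t := j%:R * (t ^+ j.-1 * gauss1 t * u t) - t ^+ j.+1 * gauss1 t * u t +
    x * (t ^+ j * gauss1 t * v t).
have [C0 C00 HC0] := moment_bound j u1.
have [C1 C10 HC1] := moment_bound j.-1 u1.
have [C2 C20 HC2] := moment_bound j.+1 u1.
have [C3 C30 HC3] := moment_bound j v1.
pose C := C0 + (j%:R * C1 + C2 + `|x| * C3).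
have L0 t : 0 <= lorentz t := ltW (lorentz_gt0 t).
have h'0 : (\int[leb]_t (h' t)%:E = 0)%E.
  apply: (@integral_derive_setT R (fun t => t ^+ j * gauss1 t * u t) h' C).
  - move=> t; have d := @is_derive_moment j u (fun t => x * v t) t (du t).
    by apply: (is_derive_eq d); rewrite /h'; ring.
  - move=> t; rewrite /h'; apply: cvgD; first apply: cvgB.
    + by apply: cvgMr; exact: continuous_moment.
    + exact: continuous_moment.
    + by apply: cvgMr; exact: continuous_moment.
  - move=> t; rewrite (le_trans (HC0 t))// ler_wpM2r// /C lerDl.
    by rewrite !addr_ge0 ?mulr_ge0.
  - move=> t; rewrite (@le_trans _ _ ((j%:R * C1 + C2 + `|x| * C3) * lorentz t))//; last first.
      by rewrite ler_wpM2r// /C lerDr.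
    rewrite /h' 2!mulrDl (le_trans (ler_normD _ _))// lerD//.
      rewrite (le_trans (ler_normB _ _))// lerD//.
      by rewrite normrM (ger0_norm (ler0n R j)) -[leRHS]mulrA ler_wpM2l.
    by rewrite normrM -[leRHS]mulrA ler_wpM2l.
have I1 := integrable_moment j.-1 cu u1.
have I2 := integrable_moment j.+1 cu u1.
have I3 := integrable_moment j cv v1.
have iZ (c : R) w : leb.-integrable setT (EFin \o w) ->
    leb.-integrable setT (EFin \o (fun t => c * w t)).
  by move=> iw; exact: (@integrableZl _ _ _ leb setT measurableT c _ iw).
rewrite -(RintegralZl (mu := leb) j%:R measurableT I1).
rewrite -(RintegralZl (mu := leb) x measurableT I3).
rewrite -RintegralB//; last exact: iZ.
rewrite -RintegralD//; last 2 first.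
- exact: (@integrableB _ _ _ leb setT measurableT _ _ (iZ j%:R _ I1) I2).
- exact: iZ.
by rewrite /Rintegral h'0.
Qed.

Lemma is_derive_sinM x t : is_derive t (1 : R) (fun t => sin (x * t)) (x * cos (x * t)).
Proof.
by apply: is_derive_eq; rewrite /GRing.scale/= ?mulr0 ?add0r ?addr0 mulr1 mulrC.
Qed.

Lemma is_derive_cosM x t : is_derive t (1 : R) (fun t => cos (x * t)) (x * - sin (x * t)).
Proof.
by apply: is_derive_eq; rewrite /GRing.scale/= ?mulr0 ?add0r ?addr0 mulr1 mulrC.
Qed.

Lemma sinmom_rec j x : j%:R * sinmom j.-1 x - sinmom j.+1 x + x * cosmom j x = 0.
Proof.
apply: (@moment_recurrence j (fun t => sin (x * t)) (fun t => cos (x * t)) x).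
- by move=> t; exact: is_derive_sinM.
- exact: continuous_cosM.
- by move=> t; exact: sin_norm_le1.
- by move=> t; exact: cos_norm_le1.
Qed.

Lemma cosmom_rec j x : j%:R * cosmom j.-1 x - cosmom j.+1 x - x * sinmom j x = 0.
Proof.
have /= := @moment_recurrence j (fun t => cos (x * t)) (fun t => - sin (x * t)) x.
rewrite -/(cosmom _ _) -/(cosmom _ _).
rewrite (_ : (\int[leb]_t (t ^+ j * gauss1 t * - sin (x * t))) = - sinmom j x); last first.
  under eq_Rintegral do rewrite mulrN -mulN1r.
  rewrite RintegralZl ?mulN1r//; apply: integrable_moment.
    exact: continuous_sinM.
  by move=> t; exact: sin_norm_le1.
rewrite mulrN; apply.
- by move=> t; exact: is_derive_cosM.
- by move=> t; apply: cvgN; exact: continuous_sinM.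
- by move=> t; exact: cos_norm_le1.
- by move=> t; rewrite normrN; exact: sin_norm_le1.
Qed.

(** The factor is the fourth Hermite polynomial. *)
Lemma cosmom4E x : cosmom 4 x = (3 - 6 * x ^+ 2 + x ^+ 4) * cosmom 0 x.
Proof.
have := sinmom_rec 0 x; have := cosmom_rec 1 x.
have := sinmom_rec 2 x; have := cosmom_rec 3 x => /=.
move=> H3 H2 H1 H0.
have E1 : sinmom 1 x = x * cosmom 0 x by lra.
have E2 : cosmom 2 x = cosmom 0 x - x * sinmom 1 x by lra.
have E3 : sinmom 3 x = 2 * sinmom 1 x + x * cosmom 2 x by lra.
have -> : cosmom 4 x = 3 * cosmom 2 x - x * sinmom 3 x by lra.
by rewrite E3 E2 E1; ring.
Qed.

Lemma is_derive_cosmom0 x : is_derive x (1 : R) (cosmom 0) (- sinmom 1 x).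
Proof.
pose f x t := t ^+ 0 * gauss1 t * cos (x * t).
have d1 y t : is_derive y (1 : R) (f ^~ t) (- (t ^+ 1 * gauss1 t * sin (y * t))).
  rewrite /f; apply: is_derive_eq.
  by rewrite /GRing.scale/= ?mulr0 ?add0r ?addr0; ring.
have p1 y t : partial1of2 f y t = - (t ^+ 1 * gauss1 t * sin (y * t)).
  by rewrite partial1of2E; have [_] := d1 y t.
have xI : `]x - 1, x + 1[%classic x by rewrite /= in_itv/= ltrBlDr ltrDl ltr01.
have [C C0 HC] := gauss1_moment_bound 1.
have := @cvg_differentiation_under_integral R _ _ leb f setT measurableT x
  (x - 1) (x + 1) xI _ _ (fun t => C * lorentz t) _ _ _.
have -> : \int[leb]_y partial1of2 f x y = - sinmom 1 x.
  under eq_Rintegral do rewrite p1 -mulN1r.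
  rewrite RintegralZl ?mulN1r//; apply: integrable_moment.
    exact: continuous_sinM.
  by move=> t; exact: sin_norm_le1.
move=> H; have {}H : h^-1 *: (cosmom 0 (h + x) - cosmom 0 x) @[h --> 0^'] --> - sinmom 1 x.
  apply: H.
  - move=> y _; apply: integrable_moment; first exact: continuous_cosM.
    by move=> t; exact: cos_norm_le1.
  - by move=> y t _ _; have [] := d1 y t.
  - by move=> t; rewrite mulr_ge0// ltW// lorentz_gt0.
  - exact: integrable_lorentz.
  - move=> y t _ _; rewrite p1 normrN !normrM normrX.
    rewrite (ger0_norm (ltW (gauss1_gt0 t))) (le_trans _ (HC t))//.
    by rewrite ler_piMr ?sin_norm_le1// mulr_ge0 ?exprn_ge0// ltW// gauss1_gt0.
have {}H : h^-1 *: (cosmom 0 (h *: (1 : R) + x) - cosmom 0 x) @[h --> 0^'] --> - sinmom 1 x.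
  by under eq_fun do rewrite /GRing.scale/= mulr1.
by apply: DeriveDef; [apply/cvg_ex; exists (- sinmom 1 x)|exact/cvg_lim].
Qed.

(** By the recurrence, [cosmom 0] solves the differential equation
    [f' x = - x * f x] of [gauss1]. *)
Lemma cosmom0E x : cosmom 0 x = cosmom 0 0 * gauss1 x.
Proof.
pose h y := cosmom 0 y * expR (y ^+ 2 / 2).
have dh y : is_derive y (1 : R) h 0.
  have d0 := is_derive_cosmom0 y.
  have E1 : sinmom 1 y = y * cosmom 0 y by have := sinmom_rec 0 y => /=; lra.
  rewrite /h; apply: is_derive_eq.
  by rewrite /GRing.scale/= E1 ?expr1; field.
have := is_derive_0_is_cst x 0 dh; rewrite /h expr0n/= mul0r expR0 mulr1 => <-.
by rewrite /gauss1 -mulrA -expRD subrr expR0 mulr1.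
Qed.

Lemma cosmom00_gt0 : 0 < cosmom 0 0.
Proof.
have i0 := @integrable_moment 0 (fun t => cos (0 * t)) (@continuous_cosM 0)
  (fun t => cos_norm_le1 _).
rewrite -lte_fin /cosmom /Rintegral fineK; last exact: integrable_fin_num.
apply: (@lt_le_trans _ _ (\int[leb]_x (gauss_fun x)%:E)%E).
  by rewrite integralT_gauss lte_fin sqrtr_gt0 pi_gt0.
apply: ge0_le_integral => //.
- by move=> x _; rewrite lee_fin gauss_fun_ge0.
- by apply/measurable_EFinP; exact: measurable_gauss_fun.
- by have := measurable_int _ i0.
- move=> x _; rewrite lee_fin expr0 mul1r mul0r cos0 mulr1 /gauss_fun /gauss1.
  by rewrite ler_expR lerN2 ler_pdivrMr// ler_peMr ?sqr_ge0// ler1n.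
Qed.

End GaussianFourier.

(** * Products over the coordinates *)

Section TensorProducts.
Variable R : realType.
Local Notation leb := (@lebesgue_measure R).
Local Notation lebn n := (lebesgue_Rn R n).

Definition row_tail n (x : 'rV[R]_n.+1) : 'rV[R]_n := \row_j x ord0 (lift ord0 j).

Lemma measurable_row_tail n :
  measurable_fun setT (@row_tail n : borelRn R n.+1 -> borelRn R n).
Proof.
apply: measurable_fun_borelRn => j; under eq_fun do rewrite mxE.
exact: measurable_coord.
Qed.

Lemma row_tail_cons n a (v : 'rV[R]_n) : row_tail (Rn_cons (a, v : borelRn R n)) = v.
Proof. by apply/rowP => j; rewrite mxE Rn_consS. Qed.

Lemma dotp_recl n (x y : 'rV[R]_n.+1) :
  dotp x y = x ord0 ord0 * y ord0 ord0 + dotp (row_tail x) (row_tail y).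
Proof.
by rewrite /dotp big_ord_recl; congr (_ + _); apply: eq_bigr => i _; rewrite !mxE.
Qed.

Lemma measurable_tensor n (f : R -> R) (g : 'rV[R]_n -> R) :
  measurable_fun setT f -> measurable_fun setT (g : borelRn R n -> R) ->
  measurable_fun setT (fun x : borelRn R n.+1 =>
    f ((x : 'rV[R]_n.+1) ord0 ord0) * g (row_tail x)).
Proof.
move=> mf mg; apply: measurable_funM.
  exact: (measurableT_comp mf (measurable_coord _)).
exact: (measurableT_comp mg (@measurable_row_tail n)).
Qed.

Lemma integrable_tensor n (f : R -> R) (g : 'rV[R]_n -> R) :
  leb.-integrable setT (EFin \o f) ->
  (lebn n).-integrable setT (EFin \o (g : borelRn R n -> R)) ->
  (lebn n.+1).-integrable setT (fun x : borelRn R n.+1 =>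
    (f ((x : 'rV[R]_n.+1) ord0 ord0) * g (row_tail x))%:E).
Proof.
move=> /integrableP[/measurable_EFinP mf foo] /integrableP[/measurable_EFinP mg goo].
apply/integrableP; split.
  by apply/measurable_EFinP; exact: measurable_tensor.
under eq_integral do rewrite /= normrM.
have mnf : measurable_fun setT (fun t => `|f t|) by exact: measurableT_comp.
have mng : measurable_fun setT ((fun v => `|g v|) : borelRn R n -> R).
  exact: measurableT_comp.
rewrite (ge0_integral_Rn_tensor mnf mng)//.
by rewrite lte_mul_pinfty// ?ge0_fin_numE//; exact: integral_ge0.
Qed.

Lemma Rintegral_tensor n (f : R -> R) (g : 'rV[R]_n -> R) :
  leb.-integrable setT (EFin \o f) ->
  (lebn n).-integrable setT (EFin \o (g : borelRn R n -> R)) ->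
  \int[lebn n.+1]_x (f ((x : 'rV[R]_n.+1) ord0 ord0) * g (row_tail x)) =
  (\int[leb]_t f t) * (\int[lebn n]_v g v).
Proof.
move=> intf ig; rewrite /Rintegral integral_Rn_cons; last exact: integrable_tensor.
rewrite -fineM; last 2 first.
- exact: integrable_fin_num.
- exact: integrable_fin_num.
congr fine; rewrite -(fineK (integrable_fin_num _ ig))//.
rewrite -(integralZr measurableT intf).
apply: eq_integral => t _; rewrite fineK; last exact: integrable_fin_num.
rewrite -(integralZl measurableT ig).
apply: eq_integral => v _; rewrite Rn_cons0 row_tail_cons//.
Qed.

Definition lorentzn n (x : 'rV[R]_n) : R := \prod_(i < n) lorentz (x ord0 i).

Lemma lorentzn_recl n (x : 'rV[R]_n.+1) :
  lorentzn x = lorentz (x ord0 ord0) * lorentzn (row_tail x).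
Proof.
by rewrite /lorentzn big_ord_recl; congr (_ * _); apply: eq_bigr => i _; rewrite mxE.
Qed.

Lemma lorentzn_gt0 n (x : 'rV[R]_n) : 0 < lorentzn x.
Proof. by apply: prodr_gt0 => i _; exact: lorentz_gt0. Qed.

Lemma lorentzn_le1 n (x : 'rV[R]_n) : lorentzn x <= 1.
Proof.
by apply: prodr_ile1 => i _; rewrite lorentz_le1 andbT ltW// lorentz_gt0.
Qed.

Lemma measurable_lorentzn n : measurable_fun setT (@lorentzn n : borelRn R n -> R).
Proof.
apply: measurable_prod => i _.
exact: (measurableT_comp (@measurable_lorentz R) (measurable_coord i)).
Qed.

Lemma integral_Rn0 (F : 'rV[R]_0 -> \bar R) : measurable_fun setT (F : borelRn R 0 -> \bar R) ->
  (\int[lebn 0]_x F x = F 0%R)%E.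
Proof. by move=> mF /=; rewrite integral_dirac// diracT mul1e. Qed.

Lemma integral_lorentzn n : (\int[lebn n]_x (lorentzn x)%:E < +oo)%E.
Proof.
elim: n => [|n IH].
  rewrite integral_Rn0 ?ltry//; apply/measurable_EFinP; exact: measurable_lorentzn.
under eq_integral do rewrite lorentzn_recl.
rewrite ge0_integral_Rn_tensor.
- rewrite lte_mul_pinfty// ?ge0_fin_numE ?integral_lorentz//;
    by apply: integral_ge0 => x _; rewrite lee_fin ltW// lorentz_gt0.
- exact: measurable_lorentz.
- exact: measurable_lorentzn.
- by move=> x; exact: ltW (lorentz_gt0 x).
- by move=> x; exact: ltW (lorentzn_gt0 x).
Qed.

Lemma integrable_lorentzn n (C : R) :
  (lebn n).-integrable setT (EFin \o (fun x : borelRn R n => C * lorentzn x)).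
Proof.
have i1 : (lebn n).-integrable setT (EFin \o (@lorentzn n : borelRn R n -> R)).
  apply/integrableP; split; first by apply/measurable_EFinP; exact: measurable_lorentzn.
  under eq_integral do rewrite /= ger0_norm ?(ltW (lorentzn_gt0 _))//.
  exact: integral_lorentzn.
exact: (@integrableZl _ _ _ (lebn n) setT measurableT C _ i1).
Qed.

Lemma integrable_le_lorentzn n (C : R) (f : 'rV[R]_n -> R) :
  measurable_fun setT (f : borelRn R n -> R) ->
  (forall x, `|f x| <= C * lorentzn x) ->
  (lebn n).-integrable setT (EFin \o (f : borelRn R n -> R)).
Proof.
move=> mf fC; apply: (le_integrable measurableT _ _ (integrable_lorentzn n C)).
  exact/measurable_EFinP.
by move=> x _; rewrite lee_fin (le_trans (fC x))// ler_norm.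
Qed.

End TensorProducts.

Section GaussianFourierRn.
Variable R : realType.
Local Notation leb := (@lebesgue_measure R).
Local Notation lebn n := (lebesgue_Rn R n).

Definition gaussn n (x : 'rV[R]_n) : R := expR (- (dotp x x / 2)).

Lemma gaussn_gt0 n (x : 'rV[R]_n) : 0 < gaussn x. Proof. exact: expR_gt0. Qed.

Lemma gaussn_recl n (x : 'rV[R]_n.+1) :
  gaussn x = gauss1 (x ord0 ord0) * gaussn (row_tail x).
Proof. by rewrite /gaussn /gauss1 -expRD dotp_recl; congr expR; field. Qed.

Lemma measurable_gaussn n : measurable_fun setT (@gaussn n : borelRn R n -> R).
Proof.
apply: measurableT_comp => //; apply: measurableT_comp => //.
by apply: measurable_funM => //; apply: measurable_dotp; exact: measurable_id.
Qed.

Lemma gaussn_bound n : exists2 C, 0 <= C & forall x : 'rV[R]_n, gaussn x <= C * lorentzn x.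
Proof.
elim: n => [|n [C C0 HC]].
  exists 1 => // x; rewrite /gaussn /lorentzn /dotp !big_ord0 mul0r oppr0 expR0.
  by rewrite mulr1.
have [D D0 HD] := gauss1_moment_bound R 0.
exists (D * C) => [|x]; first exact: mulr_ge0.
rewrite gaussn_recl lorentzn_recl [leRHS]mulrACA; apply: ler_pM => //.
- exact: ltW (gauss1_gt0 _).
- exact: ltW (gaussn_gt0 _).
by have := HD (x ord0 ord0); rewrite expr0 mul1r.
Qed.

Lemma measurable_cos_dotp n (x : 'rV[R]_n) :
  measurable_fun setT ((fun y => cos (dotp x y)) : borelRn R n -> R).
Proof.
apply: (measurableT_comp (f := @cos R)); first exact: continuous_measurable_fun (@continuous_cos R).
apply: (@measurable_dotp R n _ _ (cst (x : borelRn R n)) id).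
  exact: measurable_cst.
exact: measurable_id.
Qed.

Lemma measurable_sin_dotp n (x : 'rV[R]_n) :
  measurable_fun setT ((fun y => sin (dotp x y)) : borelRn R n -> R).
Proof.
apply: (measurableT_comp (f := @sin R)); first exact: continuous_measurable_fun (@continuous_sin R).
apply: (@measurable_dotp R n _ _ (cst (x : borelRn R n)) id).
  exact: measurable_cst.
exact: measurable_id.
Qed.

Lemma integrable_gaussn_cos n (x : 'rV[R]_n) : (lebn n).-integrable setT
  (EFin \o ((fun y => gaussn y * cos (dotp x y)) : borelRn R n -> R)).
Proof.
have [C C0 HC] := gaussn_bound n; apply: (@integrable_le_lorentzn R n C).
  apply: measurable_funM; [exact: measurable_gaussn|exact: measurable_cos_dotp].
move=> y; rewrite normrM (ger0_norm (ltW (gaussn_gt0 y))) (le_trans _ (HC y))//.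
by rewrite ler_piMr ?cos_norm_le1// ltW// gaussn_gt0.
Qed.

Lemma integrable_gaussn_sin n (x : 'rV[R]_n) : (lebn n).-integrable setT
  (EFin \o ((fun y => gaussn y * sin (dotp x y)) : borelRn R n -> R)).
Proof.
have [C C0 HC] := gaussn_bound n; apply: (@integrable_le_lorentzn R n C).
  apply: measurable_funM; [exact: measurable_gaussn|exact: measurable_sin_dotp].
move=> y; rewrite normrM (ger0_norm (ltW (gaussn_gt0 y))) (le_trans _ (HC y))//.
by rewrite ler_piMr ?sin_norm_le1// ltW// gaussn_gt0.
Qed.

(** The integrand is odd, and the Lebesgue measure is invariant under [-%R]. *)
Lemma sinmom0E x : sinmom 0 x = 0 :> R.
Proof.
suff : sinmom 0 x = - sinmom 0 x by lra.
rewrite [RHS](_ : _ = \int[leb]_t (- (t ^+ 0 * gauss1 t * sin (x * t)))); last first.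
  under eq_Rintegral do rewrite -mulN1r.
  rewrite RintegralZl ?mulN1r//; apply: integrable_moment.
    exact: continuous_sinM.
  by move=> t; exact: sin_norm_le1.
pose f t : R := t ^+ 0 * gauss1 t * sin (x * t).
have iF : leb.-integrable setT (EFin \o f).
  apply: integrable_moment; first exact: continuous_sinM.
  by move=> t; exact: sin_norm_le1.
have mN : measurable_fun setT (-%R : measurableTypeR R -> measurableTypeR R).
  exact: oppr_measurable.
have fN t : - f t = f (- t).
  by rewrite /f !expr0 gauss1N mulrN sinN mulrN.
congr fine; rewrite -/f.
have iN : leb.-integrable setT ((EFin \o f) \o -%R).
  rewrite (_ : _ \o _ = (fun t => - (EFin \o f) t)%E); first exact: integrableN.
  by apply/funext => t /=; rewrite -fN.
have := @integral_pushforward _ _ _ _ _ _ mN leb setT (EFin \o f) (measurable_int _ iF) iN measurableT.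
rewrite preimage_setT.
rewrite [LHS](@eq_measure_integral _ _ _ _ leb)//=; last first.
  by move=> A mA _; exact: lebesgue_measureN.
by move=> ->; apply: eq_integral => t _ /=; rewrite -fN.
Qed.

Lemma integral_gaussn_sin n (x : 'rV[R]_n) :
  \int[lebn n]_y (gaussn y * sin (dotp x y)) = 0.
Proof.
elim: n x => [|n IH] x.
  rewrite /Rintegral integral_Rn0.
    by rewrite /dotp !big_ord0 sin0 mulr0.
  by apply: measurable_int (integrable_gaussn_sin x).
pose f1 t : R := t ^+ 0 * gauss1 t * sin (x ord0 ord0 * t).
pose f2 t : R := t ^+ 0 * gauss1 t * cos (x ord0 ord0 * t).
pose g1 y := gaussn y * cos (dotp (row_tail x) y).
pose g2 y := gaussn y * sin (dotp (row_tail x) y).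
have if1 : leb.-integrable setT (EFin \o f1).
  apply: integrable_moment; first exact: continuous_sinM.
  by move=> t; exact: sin_norm_le1.
have if2 : leb.-integrable setT (EFin \o f2).
  apply: integrable_moment; first exact: continuous_cosM.
  by move=> t; exact: cos_norm_le1.
have ig1 := integrable_gaussn_cos (row_tail x).
have ig2 := integrable_gaussn_sin (row_tail x).
transitivity (\int[lebn n.+1]_y
   (f1 ((y : 'rV[R]_n.+1) ord0 ord0) * g1 (row_tail y) +
    f2 ((y : 'rV[R]_n.+1) ord0 ord0) * g2 (row_tail y))).
  apply: eq_Rintegral => y _; rewrite gaussn_recl dotp_recl sinD /f1 /f2 /g1 /g2.
  by rewrite !expr0; ring.
rewrite RintegralD//; [|exact: integrable_tensor if1 ig1|exact: integrable_tensor if2 ig2].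
rewrite (Rintegral_tensor if1 ig1) (Rintegral_tensor if2 ig2).
by rewrite IH mulr0 addr0 -/(sinmom 0 _) sinmom0E mul0r.
Qed.

(** The addition formula of the cosine separates the head coordinate; the product
    of sines contributes nothing by [integral_gaussn_sin]. *)
Lemma Rintegral_gaussn_cos_moment n j (x : 'rV[R]_n.+1) :
  \int[lebn n.+1]_y ((y : 'rV[R]_n.+1) ord0 ord0 ^+ j * gaussn y * cos (dotp x y)) =
  cosmom j (x ord0 ord0) * \int[lebn n]_y (gaussn y * cos (dotp (row_tail x) y)).
Proof.
pose f1 t : R := t ^+ j * gauss1 t * cos (x ord0 ord0 * t).
pose f2 t : R := t ^+ j * gauss1 t * sin (x ord0 ord0 * t).
pose g1 y := gaussn y * cos (dotp (row_tail x) y).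
pose g2 y := gaussn y * sin (dotp (row_tail x) y).
have if1 : leb.-integrable setT (EFin \o f1).
  apply: integrable_moment; first exact: continuous_cosM.
  by move=> t; exact: cos_norm_le1.
have if2 : leb.-integrable setT (EFin \o f2).
  apply: integrable_moment; first exact: continuous_sinM.
  by move=> t; exact: sin_norm_le1.
have ig1 := integrable_gaussn_cos (row_tail x).
have ig2 := integrable_gaussn_sin (row_tail x).
transitivity (\int[lebn n.+1]_y
   (f1 ((y : 'rV[R]_n.+1) ord0 ord0) * g1 (row_tail y) -
    f2 ((y : 'rV[R]_n.+1) ord0 ord0) * g2 (row_tail y))).
  apply: eq_Rintegral => y _; rewrite gaussn_recl dotp_recl cosD /f1 /f2 /g1 /g2.
  by ring.
rewrite RintegralB//; [|exact: integrable_tensor if1 ig1|exact: integrable_tensor if2 ig2].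
rewrite (Rintegral_tensor if1 ig1) (Rintegral_tensor if2 ig2).
by rewrite (integral_gaussn_sin (row_tail x)) mulr0 subr0.
Qed.

Lemma integral_gaussn_cos n (x : 'rV[R]_n) :
  \int[lebn n]_y (gaussn y * cos (dotp x y)) = cosmom 0 0 ^+ n * gaussn x.
Proof.
elim: n x => [|n IH] x.
  rewrite /Rintegral integral_Rn0.
    by rewrite /gaussn /dotp !big_ord0 cos0 expr0 mulrC.
  by apply: measurable_int (integrable_gaussn_cos x).
have := Rintegral_gaussn_cos_moment 0 x; under eq_Rintegral do rewrite expr0 mul1r.
by move=> ->; rewrite IH cosmom0E gaussn_recl exprS; ring.
Qed.

End GaussianFourierRn.

(** * Gaussian moments on the half-line *)

Section HalfLineMoments.
Variable R : realType.
Local Notation leb := (@lebesgue_measure R).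
Local Notation lebn n := (lebesgue_Rn R n).

(** A weight on the whole line, so that Fubini's theorem applies to [R] times
    [R^n]. *)
Definition posX (p : nat) (s : R) : R := if 0 < s then s ^+ p else 0.

Lemma posX_ge0 p s : 0 <= posX p s.
Proof. by rewrite /posX; case: ifPn => // s0; rewrite exprn_ge0// ltW. Qed.

Lemma measurable_posX p : measurable_fun setT (posX p).
Proof.
rewrite (_ : posX p = ((fun s => s ^+ p) : R -> R) \_ (`]0, +oo[%classic : set R)).
  apply/(measurable_restrictT _ _).1; first exact: measurable_itv.
  by apply: measurable_funTS; exact: exprn_measurable.
by apply/funext => s; rewrite patchE /posX mem_setE in_itv/= andbT.
Qed.

Lemma integral_posX p (F : R -> R) :
  (\int[leb]_(s in `]0%R, +oo[) (s ^+ p * F s)%:E =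
   \int[leb]_s (posX p s * F s)%:E)%E.
Proof.
rewrite integral_mkcond; apply: eq_integral => s _.
by rewrite patchE /posX mem_setE in_itv/= andbT; case: ifPn => //; rewrite mul0r.
Qed.

Definition halfmom (p : nat) : R := \int[leb]_(s in `[0%R, +oo[) (s ^+ p * gauss1 s).

Lemma halfmom_integral p :
  (\int[leb]_(s in `[0%R, +oo[) (s ^+ p * gauss1 s)%:E = (halfmom p)%:E)%E.
Proof.
rewrite /halfmom /Rintegral fineK//; apply: integrable_fin_num => //.
apply: (integrableS measurableT) => //.
have := @integrable_moment R p (fun t => cos (0 * t)) (@continuous_cosM R 0)
  (fun t => cos_norm_le1 _).
by apply: eq_integrable => // t _ /=; rewrite mul0r cos0 mulr1.
Qed.

Lemma continuous_expgauss p : continuous (fun t : R => t ^+ p * gauss1 t).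
Proof.
move=> t; apply: cvgM; last exact: continuous_gauss1.
exact: exprn_continuous.
Qed.

Lemma halfmom_gt0 p : 0 < halfmom p.
Proof.
rewrite -lte_fin -halfmom_integral; pose m : R := expR (- 2).
have m0 : (0 < \int[leb]_(s in `[1%R, 2%R]) (cst m%:E s))%E.
  rewrite integral_cst//= lebesgue_measure_itv/= lte_fin ltr1n -EFinD -EFinM lte_fin.
  by rewrite mulr_gt0 ?expR_gt0// -[1]/(1%:R) subr_gt0 ltr1n.
apply: (lt_le_trans m0).
have mf : measurable_fun setT (fun s : R => (s ^+ p * gauss1 s)%:E).
  apply/measurable_EFinP; apply: continuous_measurable_fun.
  exact: (@continuous_expgauss p).
apply: (@le_trans _ _ (\int[leb]_(s in `[1%R, 2%R]) (s ^+ p * gauss1 s)%:E)%E).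
  apply: ge0_le_integral => //.
  - by move=> s _; rewrite lee_fin expR_ge0.
  - exact: measurable_funTS.
  - move=> s /=; rewrite in_itv/= lee_fin => /andP[s1 s2].
    rewrite -[leLHS]mul1r ler_pM ?expR_ge0// ?exprn_ege1//.
    rewrite /m /gauss1 ler_expR lerN2 ler_pdivrMr//.
    by rewrite (@le_trans _ _ (2 * 2))// expr2 ler_pM// (le_trans _ s1).
apply: ge0_subset_integral => //.
- exact: measurable_funTS.
- by move=> s /=; rewrite in_itv/= andbT => s0; rewrite lee_fin mulr_ge0 ?exprn_ge0// expR_ge0.
- move=> s /=; rewrite !in_itv/= andbT => /andP[s1 _]; exact: le_trans s1.
Qed.

(** The integral over the half-line of the derivative of [t ^+ p.+1 * gauss1 t],
    a function that vanishes at zero. *)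
Lemma halfmomSS p : halfmom p.+2 = p.+1%:R * halfmom p.
Proof.
pose h (t : R) := t ^+ p.+1 * gauss1 t.
pose h' (t : R) := p.+1%:R * (t ^+ p * gauss1 t) - t ^+ p.+2 * gauss1 t.
have b j : exists2 C, 0 <= C & forall t : R, `|t ^+ j * gauss1 t| <= C * lorentz t.
  have [C C0 HC] := gauss1_moment_bound R j; exists C => // t.
  by rewrite normrM normrX (ger0_norm (ltW (gauss1_gt0 t))).
have L0 t : 0 <= lorentz t :> R := ltW (lorentz_gt0 t).
have [C0 C00 H0] := b p.+1; have [C1 C10 H1] := b p; have [C2 C20 H2] := b p.+2.
have : (\int[leb]_(t in `[0%R, +oo[) (h' t)%:E = (- h 0)%:E)%E.
  apply: (@integral_derive_itvcy R h h' (C0 + (p.+1%:R * C1 + C2))).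
  - move=> t; have d := is_deriveM (is_derive_exprn p.+1 t) (is_derive_gauss1 t).
    apply: (is_derive_eq d).
    by rewrite /GRing.scale/= /h' !exprS; ring.
  - move=> t; apply: cvgB; last exact: (@continuous_expgauss p.+2).
    by apply: cvgMr; exact: (@continuous_expgauss p).
  - move=> t; rewrite (le_trans (H0 t))// ler_wpM2r// lerDl.
    by rewrite addr_ge0 ?mulr_ge0.
  - move=> t; rewrite (@le_trans _ _ ((p.+1%:R * C1 + C2) * lorentz t))//; last first.
      by rewrite ler_wpM2r// lerDr.
    rewrite mulrDl (le_trans (ler_normB _ _))// lerD//.
    by rewrite normrM (ger0_norm (ler0n R _)) -[leRHS]mulrA ler_wpM2l.
rewrite /h expr0n/= mul0r oppr0.
have i j : leb.-integrable `[0, +oo[ (EFin \o (fun t : R => t ^+ j * gauss1 t)).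
  apply: (integrableS measurableT) => //.
  have := @integrable_moment R j (fun t => cos (0 * t)) (@continuous_cosM R 0)
    (fun t => cos_norm_le1 _).
  by apply: eq_integrable => // t _ /=; rewrite mul0r cos0 mulr1.
move=> E; have : \int[leb]_(t in `[0, +oo[) h' t = 0 by rewrite /Rintegral E.
rewrite RintegralB//; last first.
  exact: (@integrableZl _ _ _ leb _ _ p.+1%:R _ (i p)).
rewrite RintegralZl//; first by rewrite /halfmom => /eqP; rewrite subr_eq0 => /eqP <-.
Qed.

(** The substitution of [s / r] for [s]. *)
Lemma integral_posX_gauss1 p (r : R) : 0 < r ->
  (\int[leb]_s (posX p s * gauss1 (s * r))%:E = (halfmom p / r ^+ p.+1)%:E)%E.
Proof.
move=> r0.
have E : (\int[leb]_s (posX p s * gauss1 s)%:E = (halfmom p)%:E)%E.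
  rewrite -halfmom_integral -integral_itv_obnd_cbnd ?integral_posX//.
  apply/measurable_EFinP/measurable_funTS; apply: continuous_measurable_fun.
  exact: (@continuous_expgauss p).
have pc s : posX p (r * s) = r ^+ p * posX p s.
  by rewrite /posX pmulr_rgt0//; case: ifPn => _; rewrite ?mulr0// exprMn.
have mg : measurable_fun setT (fun s : R => gauss1 (s * r)).
  apply: (measurableT_comp (f := @gauss1 R)); last exact: measurable_funM.
  exact: continuous_measurable_fun (@continuous_gauss1 R).
set X := (X in X = _).
have : ((halfmom p)%:E = (r ^+ p.+1)%:E * X)%E.
  rewrite -E (@ge0_integral_affine R r 0 (fun s => (posX p s * gauss1 s)%:E) r0); last 2 first.
  - apply/measurable_EFinP/measurable_funM; first exact: measurable_posX.
    exact: continuous_measurable_fun (@continuous_gauss1 R).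
  - by move=> s; rewrite lee_fin mulr_ge0 ?posX_ge0// expR_ge0.
  rewrite exprS EFinM -muleA; congr (_ * _)%E.
  rewrite /X -ge0_integralZl//; last 3 first.
  - by apply/measurable_EFinP/measurable_funM; first exact: measurable_posX.
  - by move=> s _; rewrite lee_fin mulr_ge0 ?posX_ge0// expR_ge0.
  - by rewrite lee_fin exprn_ge0// ltW.
  by apply: eq_integral => s _; rewrite addr0 pc -mulrA (mulrC s) EFinM.
move=> E1.
rewrite [in RHS]mulrC EFinM E1 muleA -EFinM mulVf ?mul1e//.
by rewrite expf_neq0// gt_eqF.
Qed.

End HalfLineMoments.

(** * The weight and its transform along rays *)

Section Kernel.
Variable R : realType.
Local Notation leb := (@lebesgue_measure R).
Local Notation lebn n := (lebesgue_Rn R n).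
Variables (p n : nat).
Implicit Types x y : 'rV[R]_n.+1.

(** The ratio of the two coefficients is what makes the integral of the transform
    along a ray a perfect square, see [integral_posX_gauss_weight_hat]. *)
Definition gauss_weight y : R :=
  (6 * p%:R + p.+3%:R * y ord0 ord0 ^+ 4) * gaussn y.

Definition gauss_weight_hat x : R := cosmom 0 0 ^+ n.+1 *
  ((9 * p.+1%:R - 6 * p.+3%:R * x ord0 ord0 ^+ 2 + p.+3%:R * x ord0 ord0 ^+ 4) * gaussn x).

(** The [p.+1]-th power of the radial function of [quartic_body]. *)
Definition cone_gauge x : R :=
  (p.+3%:R * x ord0 ord0 ^+ 2 - 3 * dotp x x) ^+ 2 / enorm x ^+ (p + 5).

Lemma gauss_weight_ge0 y : 0 <= gauss_weight y.
Proof.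
apply: mulr_ge0; last exact: expR_ge0.
by apply: addr_ge0; apply: mulr_ge0 => //; exact: exprn_even_ge0.
Qed.

Lemma measurable_coord_gaussn j :
  measurable_fun setT ((fun y => y ord0 ord0 ^+ j * gaussn y) : borelRn R n.+1 -> R).
Proof.
apply: measurable_funM; last exact: measurable_gaussn.
by apply: measurable_funX; exact: measurable_coord.
Qed.

Lemma measurable_gauss_weight :
  measurable_fun setT (gauss_weight : borelRn R n.+1 -> R).
Proof.
apply: measurable_funM; last exact: measurable_gaussn.
apply: measurable_funD => //; apply: measurable_funM => //.
by apply: measurable_funX; exact: measurable_coord.
Qed.

Lemma measurable_gauss_weight_hat :
  measurable_fun setT (gauss_weight_hat : borelRn R n.+1 -> R).
Proof.
apply: measurable_funM => //; apply: measurable_funM; last exact: measurable_gaussn.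
apply: measurable_funD; last first.
  apply: measurable_funM => //.
  by apply: measurable_funX; exact: measurable_coord.
apply: measurable_funB => //; apply: measurable_funM => //.
by apply: measurable_funX; exact: measurable_coord.
Qed.

Lemma coord_gaussn_bound j : exists2 C, 0 <= C &
  forall y, `|y ord0 ord0| ^+ j * gaussn y <= C * lorentzn y.
Proof.
have [C C0 HC] := gauss1_moment_bound R j; have [D D0 HD] := gaussn_bound R n.
exists (C * D) => [|y]; first exact: mulr_ge0.
rewrite gaussn_recl lorentzn_recl [leRHS]mulrACA [leLHS]mulrA; apply: ler_pM; last 2 first.
- exact: HC.
- exact: HD.
- by rewrite mulr_ge0 ?exprn_ge0// expR_ge0.
- exact: ltW (gaussn_gt0 _).
Qed.

Lemma gauss_weight_bound : exists2 C, 0 <= C &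
  forall y, `|gauss_weight y| <= C * lorentzn y.
Proof.
have [C C0 HC] := coord_gaussn_bound 0; have [D D0 HD] := coord_gaussn_bound 4.
exists (6 * p%:R * C + p.+3%:R * D) => [|y]; first by rewrite addr_ge0 ?mulr_ge0.
rewrite ger0_norm ?gauss_weight_ge0// /gauss_weight mulrDl [leRHS]mulrDl lerD//.
  by rewrite -[leRHS]mulrA ler_wpM2l ?mulr_ge0//; have := HC y; rewrite expr0 mul1r.
rewrite -[leRHS]mulrA -mulrA ler_wpM2l//; have := HD y.
by rewrite -normrX ger0_norm// exprn_even_ge0.
Qed.

Lemma gauss_weight_hat_bound : exists2 C, 0 <= C &
  forall x, `|gauss_weight_hat x| <= C * lorentzn x.
Proof.
have [C C0 HC] := coord_gaussn_bound 0; have [D D0 HD] := coord_gaussn_bound 2.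
have [E E0 HE] := coord_gaussn_bound 4.
have c0 : 0 <= cosmom 0 0 ^+ n.+1 :> R by rewrite exprn_ge0// ltW// cosmom00_gt0.
exists (cosmom 0 0 ^+ n.+1 * (9 * p.+1%:R * C + 6 * p.+3%:R * D + p.+3%:R * E)) => [|x].
  by rewrite mulr_ge0// !addr_ge0 ?mulr_ge0.
rewrite /gauss_weight_hat normrM (ger0_norm c0) -[leRHS]mulrA ler_wpM2l//.
have G0 := ltW (gaussn_gt0 x); rewrite normrM (ger0_norm G0).
rewrite (@le_trans _ _ ((9 * p.+1%:R + 6 * p.+3%:R * `|x ord0 ord0| ^+ 2 +
   p.+3%:R * `|x ord0 ord0| ^+ 4) * gaussn x))//.
  rewrite ler_wpM2r// (le_trans (ler_normD _ _))// lerD//.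
    rewrite (le_trans (ler_normB _ _))// lerD//; first by rewrite ger0_norm// mulr_ge0.
    by rewrite normrM normrX (ger0_norm (mulr_ge0 _ _)).
  by rewrite normrM normrX (ger0_norm (ler0n R _)).
rewrite 2!mulrDl [leRHS]mulrDl; apply: lerD; first rewrite [leRHS]mulrDl; first apply: lerD.
- by rewrite -[leRHS]mulrA ler_wpM2l ?mulr_ge0//; have := HC x; rewrite expr0 mul1r.
- by rewrite -[leRHS]mulrA -mulrA ler_wpM2l ?mulr_ge0//; have := HD x.
- by rewrite -[leRHS]mulrA -mulrA ler_wpM2l//; have := HE x.
Qed.

Lemma integrable_gauss_weight_cos x : (lebn n.+1).-integrable setT
  (EFin \o ((fun y => gauss_weight y * cos (dotp x y)) : borelRn R n.+1 -> R)).
Proof.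
have [C C0 HC] := gauss_weight_bound; apply: (@integrable_le_lorentzn R n.+1 C).
  apply: measurable_funM; [exact: measurable_gauss_weight|exact: measurable_cos_dotp].
move=> y; rewrite normrM (le_trans _ (HC y))//.
by rewrite ler_piMr ?cos_norm_le1.
Qed.

Lemma integrable_coord_gaussn_cos j x : (lebn n.+1).-integrable setT
  (EFin \o ((fun y => y ord0 ord0 ^+ j * gaussn y * cos (dotp x y)) : borelRn R n.+1 -> R)).
Proof.
have [C C0 HC] := coord_gaussn_bound j; apply: (@integrable_le_lorentzn R n.+1 C).
  apply: measurable_funM; [exact: measurable_coord_gaussn|exact: measurable_cos_dotp].
move=> y; rewrite normrM (le_trans _ (HC y))// normrM normrX.
rewrite (ger0_norm (ltW (gaussn_gt0 y))) ler_piMr ?cos_norm_le1//.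
by rewrite mulr_ge0 ?exprn_ge0// expR_ge0.
Qed.

Lemma integral_gauss_weight_cos x :
  \int[lebn n.+1]_y (gauss_weight y * cos (dotp x y)) = gauss_weight_hat x.
Proof.
have I0 := integrable_coord_gaussn_cos 0 x; have I4 := integrable_coord_gaussn_cos 4 x.
transitivity (\int[lebn n.+1]_y
  ((6 * p%:R) * ((y : 'rV[R]_n.+1) ord0 ord0 ^+ 0 * gaussn y * cos (dotp x y)) +
   p.+3%:R * ((y : 'rV[R]_n.+1) ord0 ord0 ^+ 4 * gaussn y * cos (dotp x y)))).
  by apply: eq_Rintegral => y _; rewrite /gauss_weight; ring.
rewrite RintegralD//; last 2 first.
- exact: (@integrableZl _ _ _ (lebn n.+1) _ measurableT (6 * p%:R) _ I0).
- exact: (@integrableZl _ _ _ (lebn n.+1) _ measurableT p.+3%:R _ I4).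
rewrite (RintegralZl _ measurableT I0) (RintegralZl _ measurableT I4).
rewrite !Rintegral_gaussn_cos_moment integral_gaussn_cos cosmom4E (cosmom0E (x _ _)).
rewrite /gauss_weight_hat gaussn_recl (exprS _ n).
set c := cosmom 0 0; set t := x _ _; set g := gauss1 t; set d := gaussn _.
set cn := c ^+ n; rewrite (_ : p.+3 = p + 3)%N ?addn3// -(addn1 p) !natrD.
ring.
Qed.

Lemma dotpZ m (s : R) (x : 'rV[R]_m) : dotp (s *: x) (s *: x) = s ^+ 2 * dotp x x.
Proof.
rewrite /dotp mulr_sumr; apply: eq_bigr => i _; rewrite !mxE; ring.
Qed.

Lemma dotp_ge0 m (x : 'rV[R]_m) : 0 <= dotp x x.
Proof. by apply: sumr_ge0 => i _; rewrite -expr2 sqr_ge0. Qed.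

Lemma enorm_sqr m (x : 'rV[R]_m) : enorm x ^+ 2 = dotp x x.
Proof. by rewrite sqr_sqrtr// dotp_ge0. Qed.

Lemma enorm_ge0 m (x : 'rV[R]_m) : 0 <= enorm x. Proof. exact: sqrtr_ge0. Qed.

Lemma enorm_eq0 m (x : 'rV[R]_m) : (enorm x == 0) = (x == 0).
Proof.
rewrite /enorm sqrtr_eq0; apply/idP/eqP => [|->].
  move=> d0; have /eqP : dotp x x = 0 by apply/eqP; rewrite eq_le d0 dotp_ge0.
  rewrite psumr_eq0 => [/allP h|i _]; last by rewrite -expr2 sqr_ge0.
  apply/rowP => i; rewrite mxE; have := h i; rewrite mem_index_enum => /(_ isT)/=.
  by rewrite -expr2 sqrf_eq0 => /eqP.
by rewrite /dotp big1// => i _; rewrite mxE mul0r.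
Qed.

Lemma enorm_gt0 m (x : 'rV[R]_m) : (0 < enorm x) = (x != 0).
Proof. by rewrite lt_def enorm_eq0 enorm_ge0 andbT. Qed.

Lemma gaussnZ (s : R) x : gaussn (s *: x) = gauss1 (s * enorm x).
Proof. by rewrite /gaussn /gauss1 dotpZ exprMn enorm_sqr. Qed.

(** By [halfmomSS] the moments of orders [p + 2] and [p + 4] are [p + 1] and
    [(p + 1) * (p + 3)] times the moment of order [p]. With
    [u = x_0 ^+ 2 / dotp x x] the polynomial becomes
    [(p + 1) * (9 - 6 * (p + 3) * u + (p + 3) ^+ 2 * u ^+ 2)], a square. *)
Lemma integral_posX_gauss_weight_hat x : x != 0 ->
  leb.-integrable setT (EFin \o (fun s => posX p s * gauss_weight_hat (s *: x))) /\
  (\int[leb]_s (posX p s * gauss_weight_hat (s *: x))%:E =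
   (cosmom 0 0 ^+ n.+1 * p.+1%:R * halfmom R p * cone_gauge x)%:E)%E.
Proof.
rewrite -enorm_gt0 => r0; set r := enorm x in r0 *; set a := x ord0 ord0.
have i j : leb.-integrable setT (EFin \o (fun s => posX j s * gauss1 (s * r))).
  apply/integrableP; split.
    apply/measurable_EFinP/measurable_funM; first exact: measurable_posX.
    apply: (measurableT_comp (f := @gauss1 R)); last exact: measurable_funM.
    exact: continuous_measurable_fun (@continuous_gauss1 R).
  under eq_integral do rewrite /= ger0_norm ?mulr_ge0 ?posX_ge0 ?expR_ge0//.
  by rewrite integral_posX_gauss1// ltry.
pose c : R := cosmom 0 0 ^+ n.+1.
pose A0 : R := c * (9 * p.+1%:R).
pose A2 : R := c * (6 * p.+3%:R * a ^+ 2).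
pose A4 : R := c * (p.+3%:R * a ^+ 4).
have iZ (C : R) j : leb.-integrable setT (EFin \o (fun s => C * (posX j s * gauss1 (s * r)))).
  exact: (@integrableZl _ _ _ leb _ measurableT C _ (i j)).
have R1 j : \int[leb]_s (posX j s * gauss1 (s * r)) = halfmom R j / r ^+ j.+1.
  by rewrite /Rintegral integral_posX_gauss1.
have E s : posX p s * gauss_weight_hat (s *: x) =
   A0 * (posX p s * gauss1 (s * r)) - A2 * (posX p.+2 s * gauss1 (s * r))
   + A4 * (posX p.+4 s * gauss1 (s * r)).
  rewrite /gauss_weight_hat gaussnZ !mxE -/a -/r /A0 /A2 /A4 -/c /posX.
  by case: ifPn => _; rewrite ?exprS; ring.
have i2 : leb.-integrable setT (EFin \o (fun s =>
   A0 * (posX p s * gauss1 (s * r)) - A2 * (posX p.+2 s * gauss1 (s * r)))).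
  exact: (@integrableB _ _ _ leb setT measurableT _ _ (iZ _ _) (iZ _ _)).
have i3 : leb.-integrable setT (EFin \o (fun s =>
   A0 * (posX p s * gauss1 (s * r)) - A2 * (posX p.+2 s * gauss1 (s * r))
   + A4 * (posX p.+4 s * gauss1 (s * r)))).
  exact: (@integrableD _ _ _ leb setT measurableT _ _ i2 (iZ _ _)).
split; first by apply: eq_integrable i3 => // s _ /=; rewrite E.
under eq_integral do rewrite E.
rewrite -[LHS]fineK; last exact: integrable_fin_num i3.
congr (_%:E); rewrite -/(Rintegral leb setT _) RintegralD// RintegralB//.
rewrite (RintegralZl A0 measurableT (i p)) (RintegralZl A2 measurableT (i p.+2)).
rewrite (RintegralZl A4 measurableT (i p.+4)) !R1 !halfmomSS /cone_gauge.
rewrite -enorm_sqr -/r -/a /A0 /A2 /A4 -/c !addnS addn0.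
have rn0 : r != 0 by rewrite gt_eqF.
have rp0 : r ^+ p != 0 by rewrite expf_neq0.
by rewrite !exprS; field; rewrite rn0 rp0.
Qed.

End Kernel.

(** * Decay of the Fourier transform of a test function *)

Section RowTopology.
Variable R : realType.

Lemma continuous_row (T : topologicalType) n (F : T -> 'rV[R]_n) :
  (forall j, continuous (fun t => F t ord0 j)) -> continuous F.
Proof.
move=> cF t; apply/cvg_ballP => e e0.
have H : forall j : 'I_n, \forall s \near t, ball (F t ord0 j) e (F s ord0 j).
  by move=> j; move/cvg_ballP : (cF j t); apply.
near=> s; split=> // i j; rewrite (ord1 i).
by move: j; near: s; exact: filter_forall.
Unshelve. all: by end_near. Qed.

Lemma continuous_mul (T : topologicalType) (a b : T -> R) :
  continuous a -> continuous b -> continuous (fun t => a t * b t).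
Proof. by move=> ca cb t; apply: cvgM; [exact: ca|exact: cb]. Qed.

Lemma continuous_add (T : topologicalType) (a b : T -> R) :
  continuous a -> continuous b -> continuous (fun t => a t + b t).
Proof. by move=> ca cb t; apply: cvgD; [exact: ca|exact: cb]. Qed.

Lemma continuous_dotp n (T : topologicalType) (f g : T -> 'rV[R]_n) :
  continuous f -> continuous g -> continuous (fun t => dotp (f t) (g t)).
Proof.
move=> cf cg t; rewrite /dotp; elim: (index_enum _) => [|i r IH].
  by under eq_fun do rewrite big_nil; exact: cvg_cst.
under eq_fun do rewrite big_cons.
apply: cvgD; last exact: IH.
apply: cvgM.
  exact: (@continuous_comp _ _ _ f (fun v : 'rV[R]_n => v ord0 i) t (cf t)
    (@coord_continuous _ _ _ _ _ _)).
exact: (@continuous_comp _ _ _ g (fun v : 'rV[R]_n => v ord0 i) t (cg t)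
  (@coord_continuous _ _ _ _ _ _)).
Qed.

(** The two difference quotients are the same function of [h]; this transfers
    directional derivatives between a function and its restriction to a line or
    a hyperplane. *)
Lemma is_derive_slice (V W : normedModType R) (F : V -> R) (G : W -> R) y u z w d :
  (forall h : R, F (h *: u + y) = G (h *: w + z)) -> is_derive z w G d ->
  is_derive y u F d.
Proof.
move=> FG [dG Gd].
have F0 : F y = G z by have := FG 0; rewrite !scale0r !add0r.
have E : (fun h : R => h^-1 *: ((F \o shift y) (h *: u) - F y)) =
         (fun h : R => h^-1 *: ((G \o shift z) (h *: w) - G z)).
  by apply/funext => h; rewrite /= FG F0.
apply: DeriveDef; first by rewrite /derivable E; exact: dG.
by rewrite /derive E; exact: Gd.
Qed.

Lemma Rn_cons_shift_head n (h a : R) (v : 'rV[R]_n) :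
  (Rn_cons (h *: (1 : R) + a, v : borelRn R n) : 'rV[R]_n.+1) =
  h *: delta_mx ord0 ord0 + Rn_cons (a, v : borelRn R n).
Proof.
apply/rowP => j; case: (unliftP ord0 j) => [i ->|->].
  have E (x y : 'rV[R]_n.+1) k : (x + y) ord0 k = x ord0 k + y ord0 k by rewrite mxE.
  by rewrite Rn_consS E Rn_consS !mxE mulr0 add0r.
have E (x y : 'rV[R]_n.+1) k : (x + y) ord0 k = x ord0 k + y ord0 k by rewrite mxE.
by rewrite Rn_cons0 E Rn_cons0 !mxE.
Qed.

Lemma Rn_cons_shift_tail n (h a : R) (v : 'rV[R]_n) (i : 'I_n) :
  (Rn_cons (a, (h *: delta_mx ord0 i + v) : borelRn R n) : 'rV[R]_n.+1) =
  h *: delta_mx ord0 (lift ord0 i) + Rn_cons (a, v : borelRn R n).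
Proof.
have E m (x y : 'rV[R]_m) k : (x + y) ord0 k = x ord0 k + y ord0 k by rewrite mxE.
apply/rowP => j; case: (unliftP ord0 j) => [l ->|->].
  rewrite Rn_consS !E Rn_consS; congr (_ + _); rewrite !mxE eqxx/=.
  by rewrite (inj_eq lift_inj).
by rewrite Rn_cons0 E Rn_cons0 !mxE/= mulr0 add0r.
Qed.

Lemma continuous_Rn_cons_head n (v : 'rV[R]_n) :
  continuous ((fun a => Rn_cons (a, v : borelRn R n)) : R -> 'rV[R]_n.+1).
Proof.
apply: continuous_row => j; case: (unliftP ord0 j) => [i ->|->].
  rewrite (_ : (fun _ => _) = cst (v ord0 i)); first exact: cst_continuous.
  by apply/funext => t; rewrite Rn_consS.
rewrite (_ : (fun _ => _) = id); first by move=> t; exact: cvg_id.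
by apply/funext => t; rewrite Rn_cons0.
Qed.

Lemma continuous_Rn_cons_tail n (a : R) :
  continuous ((fun v => Rn_cons (a, v : borelRn R n)) : 'rV[R]_n -> 'rV[R]_n.+1).
Proof.
apply: continuous_row => j; case: (unliftP ord0 j) => [i ->|->].
  rewrite (_ : (fun _ => _) = (fun v : 'rV[R]_n => v ord0 i)).
    exact: coord_continuous.
  by apply/funext => t; rewrite Rn_consS.
rewrite (_ : (fun _ => _) = cst a); first exact: cst_continuous.
by apply/funext => t; rewrite Rn_cons0.
Qed.

End RowTopology.

Section PartialIntegration.
Variable R : realType.
Local Notation leb := (@lebesgue_measure R).
Local Notation lebn n := (lebesgue_Rn R n).

(** The integral over the coordinate [i] alone is already zero. *)
Lemma integral_partial_derive n (i : 'I_n) (G G' : 'rV[R]_n -> R) (C : R) :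
  (forall x, is_derive x (delta_mx ord0 i) G (G' x)) -> continuous G' ->
  (forall x, `|G x| <= C * lorentzn x) -> (forall x, `|G' x| <= C * lorentzn x) ->
  (\int[lebn n]_x (G' x)%:E = 0)%E.
Proof.
elim: n i G G' C => [[]//|n IH] i G G' C dG cG' GC G'C.
have iG' : (lebn n.+1).-integrable setT (EFin \o (G' : borelRn R n.+1 -> R)).
  by apply: integrable_le_lorentzn G'C; exact: continuous_measurable_Rn.
have B (H : 'rV[R]_n.+1 -> R) : (forall x, `|H x| <= C * lorentzn x) ->
    forall a (v : 'rV[R]_n), `|H (Rn_cons (a, v : borelRn R n))| <= C * lorentz a * lorentzn v.
  by move=> HC a v; rewrite (le_trans (HC _))// lorentzn_recl Rn_cons0 row_tail_cons mulrA.
case: (unliftP ord0 i) dG => [j ->|->] dG.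
  rewrite (integral_Rn_cons iG'); apply: integral0_eq => a _.
  apply: (IH j (fun v => G (Rn_cons (a, v : borelRn R n))) _ (C * lorentz a)).
  - move=> v; apply: is_derive_slice (dG (Rn_cons (a, v : borelRn R n))) => h.
    by rewrite Rn_cons_shift_tail.
  - move=> v; apply: (continuous_comp (f := fun v => Rn_cons (a, v : borelRn R n))
      (g := G')); [exact: continuous_Rn_cons_tail|exact: cG'].
  - by move=> v; exact: B.
  - by move=> v; exact: B.
rewrite (integral_Rn_consC iG'); apply: integral0_eq => v _.
apply: (@integral_derive_setT R (fun a => G (Rn_cons (a, v : borelRn R n))) _
  (C * lorentzn v)).
- move=> a; apply: is_derive_slice (dG (Rn_cons (a, v : borelRn R n))) => h.
  by rewrite Rn_cons_shift_head.
- move=> a; apply: (continuous_comp (f := fun a => Rn_cons (a, v : borelRn R n) : 'rV[R]_n.+1)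
    (g := G')); [exact: continuous_Rn_cons_head|exact: cG'].
- by move=> a; rewrite mulrAC; exact: B.
- by move=> a; rewrite mulrAC; exact: B.
Qed.

End PartialIntegration.

Section Schwartz.
Variable R : realType.
Local Notation lebn n := (lebesgue_Rn R n).
Variable n : nat.
Implicit Types (f : 'rV[R]_n -> R) (x y : 'rV[R]_n).

Definition schwartz f := smooth f /\ rapidly_decreasing f.

Lemma schwartz_pderiv f i : schwartz f -> schwartz (pderiv [:: i] f).
Proof.
have E s : pderiv s (pderiv [:: i] f) = pderiv (s ++ [:: i]) f.
  by rewrite /pderiv foldr_cat.
by case=> sf rf; split=> [s x|s m]; rewrite E; [exact: sf|exact: rf].
Qed.

Lemma schwartz_continuous f : schwartz f -> continuous f.
Proof. by move=> [sf _] x; apply: differentiable_continuous; exact: (sf [::]). Qed.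

Lemma schwartz_is_derive f i x : schwartz f ->
  is_derive x (delta_mx ord0 i) f (pderiv [:: i] f x).
Proof.
move=> [sf _]; apply: DeriveDef => //; apply: diff_derivable.
exact: (sf [::]).
Qed.

Lemma prod_oneDsqr_le x :
  \prod_(i < n) (1 + x ord0 i ^+ 2) <= 2 ^+ n * (1 + dotp x x ^+ n).
Proof.
have d0 := dotp_ge0 x.
apply: (@le_trans _ _ (\prod_(i < n) (1 + dotp x x))).
  apply: ler_prod => i _; rewrite addr_ge0 ?sqr_ge0//= lerD2l.
  rewrite /dotp (bigD1 i)//= -expr2 lerDl; apply: sumr_ge0 => j _.
  by rewrite -expr2 sqr_ge0.
rewrite prodr_const card_ord.
have [d1|/ltW d1] := lerP (dotp x x) 1.
  rewrite (@le_trans _ _ (2 ^+ n))//.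
    by rewrite lerXn2r ?nnegrE// ?addr_ge0// -[2]/(1 + 1) lerD2l.
  by rewrite ler_peMr ?exprn_ge0// lerDl exprn_ge0.
rewrite (@le_trans _ _ ((2 * dotp x x) ^+ n))//.
  rewrite lerXn2r ?nnegrE ?addr_ge0 ?mulr_ge0//.
  by rewrite mulr_natl mulr2n lerD2r.
by rewrite exprMn ler_wpM2l ?exprn_ge0// lerDr.
Qed.

Lemma schwartz_bound f : schwartz f ->
  exists2 C, 0 <= C & forall x, `|f x| <= C * lorentzn x.
Proof.
move=> [_ rf]; have [C0 H0] := rf [::] 0%N; have [C1 H1] := rf [::] (2 * n)%N.
have P x : 0 < \prod_(i < n) (1 + x ord0 i ^+ 2).
  by apply: prodr_gt0 => i _; rewrite ltr_wpDr// sqr_ge0.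
exists (2 ^+ n * (C0 + C1)) => [|x].
  rewrite mulr_ge0 ?exprn_ge0// addr_ge0//.
    by apply: le_trans (H0 0); rewrite mulr_ge0 ?exprn_ge0 ?enorm_ge0.
  by apply: le_trans (H1 0); rewrite mulr_ge0 ?exprn_ge0 ?enorm_ge0.
have -> : lorentzn x = (\prod_(i < n) (1 + x ord0 i ^+ 2))^-1.
  by rewrite /lorentzn prodfV.
rewrite ler_pdivlMr//; apply: le_trans (ler_wpM2l (normr_ge0 _) (prod_oneDsqr_le x)) _.
rewrite mulrCA ler_wpM2l ?exprn_ge0// mulrDr mulr1 lerD//.
  by have := H0 x; rewrite expr0 mul1r.
by rewrite mulrC -enorm_sqr -exprM; exact: H1.
Qed.

Definition cosint f y : R := \int[lebn n]_x (f x * cos (dotp y x)).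
Definition sinint f y : R := \int[lebn n]_x (f x * sin (dotp y x)).

Lemma is_derive_dotp (u u' : R -> R) y i x :
  (forall t, is_derive t (1 : R) u (u' t)) ->
  is_derive x (delta_mx ord0 i) (fun x => u (dotp y x)) (y ord0 i * u' (dotp y x)).
Proof.
move=> du; apply: (@is_derive_slice R _ _ _ (fun t : R => u (y ord0 i * t + dotp y x)) x
   (delta_mx ord0 i) 0 1).
  move=> h; congr u; rewrite /GRing.scale/= mulr1 addr0.
  rewrite /dotp (bigD1 i)//= [in RHS](bigD1 i)//= !mxE !eqxx/= mulr1 mulrDr -addrA.
  congr (_ + (_ + _)); apply: eq_bigr => j ji.
  by rewrite !mxE (negbTE ji) mulr0 add0r.
have d1 : is_derive (0 : R) (1 : R) (fun t : R => y ord0 i * t + dotp y x) (y ord0 i).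
  by apply: is_derive_eq; rewrite /GRing.scale/= ?mulr0 ?add0r ?addr0 ?mulr1.
have d2 := du (y ord0 i * 0 + dotp y x).
have := @is_derive1_comp R u (fun t : R => y ord0 i * t + dotp y x) 0 _ _ d2 d1.
by rewrite mulr0 add0r mulrC.
Qed.

Lemma integrable_schwartz_dotp f (u : R -> R) y : schwartz f -> continuous u ->
  (forall t, `|u t| <= 1) ->
  (lebn n).-integrable setT (EFin \o ((fun x => f x * u (dotp y x)) : borelRn R n -> R)).
Proof.
move=> sf cu u1; have [C C0 HC] := schwartz_bound sf.
apply: (@integrable_le_lorentzn R n C).
  apply: measurable_funM.
    exact: continuous_measurable_Rn (schwartz_continuous sf).
  apply: (measurableT_comp (f := u)); first exact: continuous_measurable_fun cu.
  apply: (@measurable_dotp R n _ _ (cst (y : borelRn R n)) id).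
    exact: measurable_cst.
  exact: measurable_id.
by move=> x; rewrite normrM (le_trans _ (HC x))// ler_piMr.
Qed.

(** No boundary term: the derivative of [f x * u (dotp y x)] has integral zero. *)
Lemma partial_integration f i (u u' : R -> R) y : schwartz f ->
  (forall t, is_derive t (1 : R) u (u' t)) -> continuous u' ->
  (forall t, `|u t| <= 1) -> (forall t, `|u' t| <= 1) ->
  (\int[lebn n]_x (pderiv [:: i] f x * u (dotp y x))) =
  - (y ord0 i * \int[lebn n]_x (f x * u' (dotp y x))).
Proof.
move=> sf du cu' u1 u'1; have cu := is_derive_continuous du.
have sdf := schwartz_pderiv i sf.
have [C C0 HC] := schwartz_bound sf; have [D D0 HD] := schwartz_bound sdf.
pose G x := f x * u (dotp y x).
pose G' x := pderiv [:: i] f x * u (dotp y x) + y ord0 i * (f x * u' (dotp y x)).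
have L0 x := ltW (lorentzn_gt0 x).
have cdot : continuous (fun x => dotp y x).
  apply: (@continuous_dotp R n _ (cst y) id); first exact: cst_continuous.
  by move=> x; exact: cvg_id.
have I1 := integrable_schwartz_dotp y sdf cu u1.
have I2 := integrable_schwartz_dotp y sf cu' u'1.
have I3 : (lebn n).-integrable setT (EFin \o
   ((fun x => y ord0 i * (f x * u' (dotp y x))) : borelRn R n -> R)).
  exact: (@integrableZl _ _ _ (lebn n) _ measurableT (y ord0 i) _ I2).
have : (\int[lebn n]_x (G' x)%:E = 0)%E.
  apply: (@integral_partial_derive R n i G G' (C + (D + `|y ord0 i| * C))).
  - move=> x; have d := is_deriveM (schwartz_is_derive i x sf) (is_derive_dotp y i x du).
    apply: (is_derive_eq d); rewrite /G'; move: (pderiv _ _ _) => q.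
    by rewrite /GRing.scale/=; ring.
  - have cud : continuous (fun x => u (dotp y x)).
      by move=> x; exact: (continuous_comp (cdot x) (cu _)).
    have cu'd : continuous (fun x => u' (dotp y x)).
      by move=> x; exact: (continuous_comp (cdot x) (cu' _)).
    have c1 := continuous_mul (schwartz_continuous sdf) cud.
    have c2 := continuous_mul (schwartz_continuous sf) cu'd.
    have cy : continuous (fun _ : 'rV[R]_n => y ord0 i) by exact: cst_continuous.
    exact: (continuous_add c1 (continuous_mul cy c2)).
  - move=> x; rewrite /G normrM (@le_trans _ _ `|f x|) ?ler_piMr//.
    rewrite (le_trans (HC x))// ler_wpM2r// lerDl.
    by rewrite addr_ge0// mulr_ge0.
  - move=> x; rewrite (@le_trans _ _ ((D + `|y ord0 i| * C) * lorentzn x))//; last first.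
      by rewrite ler_wpM2r// lerDr.
    rewrite mulrDl (le_trans (ler_normD _ _))// lerD//.
      by rewrite normrM (le_trans _ (HD x))// ler_piMr.
    rewrite normrM -[leRHS]mulrA ler_wpM2l// normrM (le_trans _ (HC x))//.
    by rewrite ler_piMr.
move=> E; apply/eqP; rewrite -addr_eq0; apply/eqP.
rewrite -(RintegralZl _ measurableT I2) -RintegralD//.
by rewrite /Rintegral E.
Qed.

Lemma cosint_pderiv f i y : schwartz f ->
  cosint (pderiv [:: i] f) y = y ord0 i * sinint f y.
Proof.
move=> sf; rewrite /cosint (@partial_integration f i (@cos R) (fun t => - sin t) y sf)//.
- rewrite -mulrN; congr (_ * _); rewrite /sinint -mulN1r -RintegralZl//.
    by apply: eq_Rintegral => x _; ring.
  apply: (@integrable_schwartz_dotp f (fun t => - sin t) y sf).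
    by move=> t; apply: cvgN; exact: continuous_sin.
  by move=> t; rewrite normrN; exact: sin_norm_le1.
- by move=> t; apply: cvgN; exact: continuous_sin.
- exact: cos_norm_le1.
- by move=> t; rewrite normrN; exact: sin_norm_le1.
Qed.

Lemma sinint_pderiv f i y : schwartz f ->
  sinint (pderiv [:: i] f) y = - (y ord0 i * cosint f y).
Proof.
move=> sf; rewrite /sinint (@partial_integration f i (@sin R) (@cos R) y sf)//.
- exact: continuous_cos.
- exact: sin_norm_le1.
- exact: cos_norm_le1.
Qed.

(** Each factor [1 + y_i ^+ 2] costs two partial derivatives of [f] along [i]. *)
Lemma cosint_decay_seq (s : seq 'I_n) f : schwartz f ->
  exists M, forall y, \prod_(i <- s) (1 + y ord0 i ^+ 2) * `|cosint f y| <= M.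
Proof.
elim: s f => [|i s IH] f sf.
  exists (\int[lebn n]_x `|f x|) => y; rewrite big_nil mul1r /cosint.
  have I1 := integrable_schwartz_dotp y sf (@continuous_cos R) (@cos_norm_le1 R).
  apply: (le_trans (le_normr_Rintegral measurableT I1)).
  have If : (lebn n).-integrable setT (EFin \o (f : borelRn R n -> R)).
    have [C C0 HC] := schwartz_bound sf; apply: integrable_le_lorentzn HC.
    exact: continuous_measurable_Rn (schwartz_continuous sf).
  apply: le_Rintegral => //.
  - exact: (@integrable_abse _ _ _ _ _ _ I1).
  - exact: (@integrable_abse _ _ _ _ _ _ If).
  - by move=> x _; rewrite normrM ler_piMr// cos_norm_le1.
have sd := schwartz_pderiv i sf; have sdd := schwartz_pderiv i sd.
have [M HM] := IH _ sf; have [N HN] := IH _ sdd.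
exists (M + N) => y; rewrite big_cons mulrAC mulrC.
apply: le_trans (lerD (HM y) (HN y)); rewrite -mulrDr ler_wpM2l//.
  by apply: prodr_ge0 => j _; rewrite addr_ge0// sqr_ge0.
rewrite (cosint_pderiv i y sd) (sinint_pderiv i y sf) mulrN normrN mulrA -expr2.
by rewrite mulrDl mul1r lerD2l normrM (ger0_norm (sqr_ge0 _)).
Qed.

Lemma cosint_bound f : schwartz f ->
  exists2 C, 0 <= C & forall y, `|cosint f y| <= C * lorentzn y.
Proof.
move=> sf; have [M HM] := cosint_decay_seq (index_enum 'I_n) sf.
have P y : 0 < \prod_(i < n) (1 + y ord0 i ^+ 2).
  by apply: prodr_gt0 => i _; rewrite ltr_wpDr// sqr_ge0.
exists M => [|y].
  by apply: le_trans (HM 0); rewrite mulr_ge0// ltW.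
have -> : lorentzn y = (\prod_(i < n) (1 + y ord0 i ^+ 2))^-1.
  by rewrite /lorentzn prodfV.
by rewrite ler_pdivlMr// mulrC.
Qed.

Lemma Re_fourier f y : complex.Re (fourier f y) = cosint f y.
Proof.
rewrite /fourier /Rn_cintegral/=; apply: eq_Rintegral => x _.
rewrite /cexpi/= cosN mul0r subr0; congr (_ * cos _).
by apply: eq_bigr => i _; rewrite mulrC.
Qed.

End Schwartz.

(** * Absolute convergence of the double integral *)

Section EIntegralScaling.
Variable R : realType.
Local Notation leb := (@lebesgue_measure R).
Local Open Scope ereal_scope.

Lemma gt0_muleBr (a : R) (x y : \bar R) : (0 < a)%R -> a%:E * (x - y) = a%:E * x - a%:E * y.
Proof.
move=> a0; case: x => [x||]; case: y => [y||] //=;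
  rewrite ?(gt0_muley, gt0_muleNy) ?lte_fin//= -?EFinM//=.
by rewrite -?EFinB -?EFinM mulrBr.
Qed.

(** A positive factor commutes with the difference of two extended integrals, even
    when both are infinite. *)
Lemma gt0_integralZl d (T : measurableType d) (mu : {measure set T -> \bar R})
    (a : R) (f : T -> \bar R) : (0 < a)%R -> measurable_fun setT f ->
  \int[mu]_x (a%:E * f x) = a%:E * \int[mu]_x f x.
Proof.
move=> a0 mf; rewrite [LHS]integralE [in RHS]integralE gt0_muleBr//.
congr (_ - _).
  rewrite -ge0_integralZl//; last 2 first.
  - exact: measurable_funepos.
  - by rewrite lee_fin ltW.
  apply: eq_integral => x _.
  by rewrite (ge0_funeposM _ (ltW a0)).
rewrite -ge0_integralZl//; last 2 first.
- exact: measurable_funeneg.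
- by rewrite lee_fin ltW.
by apply: eq_integral => x _; rewrite (ge0_funenegM _ (ltW a0)).
Qed.

Lemma integral_dilation (a : R) (F : R -> \bar R) : (0 < a)%R ->
  measurable_fun setT F ->
  \int[leb]_t F t = a%:E * \int[leb]_t F (a * t)%R.
Proof.
move=> a0 mF; rewrite [LHS]integralE [in RHS]integralE gt0_muleBr//.
have E G : measurable_fun setT G -> (forall t, 0 <= G t) ->
   \int[leb]_t G t = a%:E * \int[leb]_t G (a * t)%R.
  move=> mG G0; rewrite (@ge0_integral_affine R a 0 G a0 mG G0); congr (_ * _).
  by apply: eq_integral => t _; rewrite addr0.
rewrite (E _ (measurable_funepos mF))// (E _ (measurable_funeneg mF))//.
by congr (_ * _ - _ * _); apply: eq_integral => t _; rewrite ?funeposE ?funenegE.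
Qed.

End EIntegralScaling.

Section FubiniIdentity.
Variable R : realType.
Local Notation leb := (@lebesgue_measure R).
Local Notation lebn n := (lebesgue_Rn R n).

Lemma measurable_scale n :
  measurable_fun setT ((fun z => z.1 *: (z.2 : 'rV[R]_n)) :
    measurableTypeR R * borelRn R n -> borelRn R n).
Proof.
apply: measurable_fun_borelRn => j; under eq_fun do rewrite mxE.
apply: measurable_funM; first exact: measurable_fst.
exact: (measurableT_comp (measurable_coord j) measurable_snd).
Qed.

Definition lorentz_mass n : R := fine (\int[lebn n]_x (lorentzn x)%:E).

Lemma lorentz_massE n : (\int[lebn n]_x (lorentzn x)%:E = (lorentz_mass n)%:E)%E.
Proof.
rewrite fineK// ge0_fin_numE ?integral_lorentzn//.
by apply: integral_ge0 => x _; rewrite lee_fin ltW// lorentzn_gt0.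
Qed.

Lemma lorentz_mass_ge0 n : 0 <= lorentz_mass n.
Proof.
rewrite fine_ge0//; apply: integral_ge0 => x _; rewrite lee_fin.
exact: ltW (lorentzn_gt0 x).
Qed.

Lemma integral_lorentznZ n (K s : R) : 0 <= K -> 0 < s ->
  (\int[lebn n]_y (K * lorentzn (s *: (y : 'rV[R]_n)))%:E =
   (K * (lorentz_mass n / s ^+ n))%:E)%E.
Proof.
move=> K0 s0.
have mls : measurable_fun setT ((fun y => lorentzn (s *: (y : 'rV[R]_n))) : borelRn R n -> R).
  exact: (measurableT_comp (@measurable_lorentzn R n)
           (measurableT_comp (@measurable_scale n) (pair1_measurable s))).
have := @ge0_integral_Rn_affine R n s 0 (fun x => (lorentzn x)%:E) s0.
rewrite lorentz_massE => /(_ _ _) E.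
have {}E : ((lorentz_mass n)%:E = (s ^+ n)%:E * \int[lebn n]_y (lorentzn (s *: (y : 'rV[R]_n)))%:E)%E.
  rewrite E; last 2 first.
  - by apply/measurable_EFinP; exact: measurable_lorentzn.
  - by move=> x; rewrite lee_fin ltW// lorentzn_gt0.
  by congr (_ * _)%E; apply: eq_integral => y _; rewrite addr0.
under eq_integral do rewrite EFinM.
rewrite ge0_integralZl//; last 2 first.
- exact/measurable_EFinP.
- by move=> y _; rewrite lee_fin ltW// lorentzn_gt0.
rewrite (EFinM K); congr (_ * _)%E.
rewrite mulrC EFinM E muleA -EFinM mulVf ?mul1e//.
by rewrite expf_neq0// gt_eqF.
Qed.

(** For [s <= 1] the inner integral is bounded by means of [B]; for [1 <= s] the
    decay of [A (s *: y)] in [y] gains a factor [s ^- n], and [s ^+ p / s ^+ n] is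
    at most [s ^- 2]. *)
Lemma integrable_dilated_product p n (A B : 'rV[R]_n -> R) (C D : R) :
  (p.+2 <= n)%N -> 0 <= C -> 0 <= D ->
  measurable_fun setT (A : borelRn R n -> R) ->
  measurable_fun setT (B : borelRn R n -> R) ->
  (forall y, `|A y| <= C * lorentzn y) -> (forall y, `|B y| <= D * lorentzn y) ->
  (lebcons R n).-integrable setT
    (fun z => (posX p z.1 * A (z.1 *: (z.2 : 'rV[R]_n)) * B z.2)%:E).
Proof.
move=> pn C0 D0 mA mB AC BD; pose M := lorentz_mass n.
have M0 : 0 <= M := lorentz_mass_ge0 n.
have mF : measurable_fun setT (fun z : measurableTypeR R * borelRn R n =>
    (posX p z.1 * A (z.1 *: (z.2 : 'rV[R]_n)) * B z.2)%:E).
  apply/measurable_EFinP; apply: measurable_funM.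
    apply: measurable_funM.
      exact: (measurableT_comp (@measurable_posX R p) measurable_fst).
    exact: (measurableT_comp mA (@measurable_scale n)).
  exact: (measurableT_comp mB measurable_snd).
apply: ((@integrable12ltyP _ _ _ _ R leb (lebn n) _ mF).2).
have L0 (y : 'rV[R]_n) : 0 <= lorentzn y := ltW (lorentzn_gt0 y).
have A1 y : `|A y| <= C by rewrite (le_trans (AC y))// ler_piMr// lorentzn_le1.
have B1 y : `|B y| <= D by rewrite (le_trans (BD y))// ler_piMr// lorentzn_le1.
have bound s : (\int[lebn n]_y `|(posX p s * A (s *: (y : 'rV[R]_n)) * B y)%:E| <=
    (2 * (C * D * M) * lorentz s)%:E)%E.
  have mFs : measurable_fun setT (fun y : borelRn R n =>
      `|(posX p s * A (s *: (y : 'rV[R]_n)) * B y)%:E|%E).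
    apply: measurableT_comp => //.
    exact: (measurableT_comp mF (pair1_measurable s)).
  have CDM0 : 0 <= C * D * M by rewrite !mulr_ge0.
  have [s0|s0] := ltrP 0 s; last first.
    under eq_integral do rewrite /posX ltNge s0/= !mul0r normr0.
    by rewrite integral0 lee_fin !mulr_ge0// ltW// lorentz_gt0.
  have [s1|s1] := lerP s 1.
    apply: (@le_trans _ _ (\int[lebn n]_y (C * D * lorentzn (1 *: (y : 'rV[R]_n)))%:E)%E).
      apply: ge0_le_integral => //.
      - by apply/measurable_EFinP; apply: measurable_funM => //;
          under eq_fun do rewrite scale1r; exact: measurable_lorentzn.
      - move=> y _; rewrite scale1r lee_fin !normrM ger0_norm ?posX_ge0//.
        rewrite -(mulrA C) ler_pM ?mulr_ge0 ?posX_ge0//.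
        rewrite -[leRHS]mul1r ler_pM ?posX_ge0//.
        by rewrite /posX s0 exprn_ile1// ltW.
    rewrite integral_lorentznZ ?mulr_ge0// expr1n divr1 lee_fin -/M.
    rewrite (_ : 2 * _ * _ = C * D * M * (2 * lorentz s)); last by ring.
    rewrite ler_peMr//.
    rewrite /lorentz ler_pdivlMr ?mul1r; last by rewrite ltr_wpDr// sqr_ge0.
    by rewrite -[2]/(1 + 1) lerD2l exprn_ile1// ltW.
  apply: (@le_trans _ _ (\int[lebn n]_y (s ^+ p * C * D * lorentzn (s *: (y : 'rV[R]_n)))%:E)%E).
    apply: ge0_le_integral => //.
    - apply/measurable_EFinP; apply: measurable_funM => //.
      exact: (measurableT_comp (@measurable_lorentzn R n)
           (measurableT_comp (@measurable_scale n) (pair1_measurable s))).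
    - move=> y _; rewrite lee_fin !normrM ger0_norm ?posX_ge0// {1}/posX s0.
      rewrite (_ : _ * C * D * _ = s ^+ p * (C * lorentzn (s *: (y : 'rV[R]_n))) * D); last by ring.
      rewrite ler_pM ?mulr_ge0 ?exprn_ge0 ?(ltW s0)//.
      by rewrite ler_wpM2l ?exprn_ge0 ?(ltW s0).
  rewrite integral_lorentznZ ?mulr_ge0 ?exprn_ge0 ?(ltW s0)// lee_fin -/M.
  have -> : s ^+ p * C * D * (M / s ^+ n) = C * D * M * (s ^+ p / s ^+ n) by ring.
  rewrite (_ : 2 * _ * _ = C * D * M * (2 * lorentz s)); last by ring.
  rewrite ler_wpM2l//.
  have s20 : 0 < s ^+ 2 by rewrite exprn_gt0.
  apply: (@le_trans _ _ (s ^+ 2)^-1).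
    rewrite ler_pdivrMr ?exprn_gt0// mulrC ler_pdivlMr// -exprD.
    by rewrite ler_weXn2l ?(ltW s1)// addn2.
  rewrite /lorentz ler_pdivlMr; last by rewrite ltr_wpDr// sqr_ge0.
  rewrite mulrC ler_pdivrMr// -[2]/(1 + 1) mulrDl mul1r lerD2r.
  by rewrite exprn_ege1// ltW.
apply: (@le_lt_trans _ _ (\int[leb]_s (2 * (C * D * M) * lorentz s)%:E)%E).
  apply: ge0_le_integral => //.
  - by move=> s _; exact: integral_ge0.
  - exact: (@measurable_fun_fubini_tonelli_F _ _ _ _ R (lebn n) _
      (measurableT_comp (@abse_measurable R setT) mF) (fun=> abse_ge0 _)).
  - by apply/measurable_EFinP; apply: measurable_funM => //; exact: measurable_lorentz.
  - by move=> s _; exact: bound.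
exact: integrable_lty (integrable_lorentz _ measurableT).
Qed.

End FubiniIdentity.

(** * Exchanging the integrals *)

Section IntegralIdentity.
Variable R : realType.
Local Notation leb := (@lebesgue_measure R).
Local Notation lebn n := (lebesgue_Rn R n).

Lemma measurable_integral_param d1 d2 (T1 : measurableType d1) (T2 : measurableType d2)
    (m : {sigma_finite_measure set T2 -> \bar R}) (F : T1 * T2 -> \bar R) :
  measurable_fun setT F -> measurable_fun setT (fun x => \int[m]_y F (x, y))%E.
Proof.
move=> mF; rewrite (_ : (fun x => _) = (fun x =>
  \int[m]_y F^\+ (x, y) - \int[m]_y F^\- (x, y))%E); last first.
  apply/funext => x; rewrite [LHS]integralE.
  by congr (_ - _)%E; apply: eq_integral => y _; rewrite ?funeposE ?funenegE.
apply: emeasurable_funB.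
  exact: (@measurable_fun_fubini_tonelli_F _ _ _ _ R m _ (measurable_funepos mF)
     (funepos_ge0 _)).
exact: (@measurable_fun_fubini_tonelli_F _ _ _ _ R m _ (measurable_funeneg mF)
     (funeneg_ge0 _)).
Qed.

Lemma measurable_enorm n : measurable_fun setT (@enorm R n : borelRn R n -> R).
Proof.
apply: (measurableT_comp (f := @Num.sqrt R)); first exact: continuous_measurable_fun (@sqrt_continuous R).
by apply: measurable_dotp; exact: measurable_id.
Qed.

(** The inverse is a real power, which is a measurable function on the whole
    line. *)
Lemma measurable_enorm_invX n j :
  measurable_fun setT ((fun x => (enorm x ^+ j)^-1) : borelRn R n -> R).
Proof.
under eq_fun do rewrite -powR_invn ?enorm_ge0//.
exact: (measurableT_comp (measurable_powR (- j%:R)) (@measurable_enorm n)).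
Qed.

Lemma measurable_cone_gauge p n :
  measurable_fun setT (@cone_gauge R p n : borelRn R n.+1 -> R).
Proof.
apply: measurable_funM; last exact: measurable_enorm_invX.
apply: measurable_funX; apply: measurable_funB; apply: measurable_funM => //.
  by apply: measurable_funX; exact: measurable_coord.
by apply: measurable_dotp; exact: measurable_id.
Qed.

Lemma integrable_inner_integral d1 d2 (T1 : measurableType d1) (T2 : measurableType d2)
    (m1 : {sigma_finite_measure set T1 -> \bar R})
    (m2 : {sigma_finite_measure set T2 -> \bar R}) (F : T1 * T2 -> \bar R) :
  (m1 \x m2)%E.-integrable setT F ->
  m2.-integrable setT (fun y => \int[m1]_x F (x, y))%E.
Proof.
move=> iF; have mF := measurable_int _ iF.
have mG : measurable_fun setT (fun y => \int[m1]_x F (x, y))%E.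
  exact: (@measurable_integral_param _ _ T2 T1 m1 (fun z => F (z.2, z.1))
    (measurableT_comp mF (measurable_fun_pair measurable_snd measurable_fst))).
apply/integrableP; split => //.
apply: le_lt_trans ((@integrable21ltyP _ _ _ _ R m1 m2 F mF).1 iF).
apply: ge0_le_integral => //.
- exact: measurableT_comp.
- exact: (@measurable_fun_fubini_tonelli_G _ _ _ _ R m1 _
    (measurableT_comp (@abse_measurable R setT) mF) (fun=> abse_ge0 _)).
- move=> y _; apply: le_abse_integral => //.
  exact: (measurableT_comp mF (pair2_measurable y)).
Qed.

Lemma integral_cst_mul d (T : measurableType d) (m : {measure set T -> \bar R})
    (c : R) (h : T -> R) : m.-integrable setT (EFin \o h) ->
  (\int[m]_x (c * h x)%:E = (c * \int[m]_x h x)%:E)%E.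
Proof.
move=> ih; rewrite -[LHS]fineK.
  by rewrite -/(Rintegral m setT (fun x => c * h x)) RintegralZl.
apply: integrable_fin_num => //.
exact: (@integrableZl _ _ _ m setT measurableT c _ ih).
Qed.

Lemma measurable_cosint n (f : 'rV[R]_n -> R) :
  measurable_fun setT (f : borelRn R n -> R) ->
  measurable_fun setT (cosint f : borelRn R n -> R).
Proof.
move=> mf; apply: (measurableT_comp (f := fine)); first exact: fine_measurable.
apply: (@measurable_integral_param _ _ (borelRn R n) (borelRn R n) (lebn n)
  (fun z => (f z.2 * cos (dotp (z.1 : 'rV[R]_n) z.2))%:E)).
apply/measurable_EFinP; apply: measurable_funM.
  exact: (measurableT_comp mf measurable_snd).
apply: (measurableT_comp (f := @cos R)); first exact: continuous_measurable_fun (@continuous_cos R).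
by apply: measurable_dotp; [exact: measurable_fst|exact: measurable_snd].
Qed.

Lemma integrable_lorentzn_product n (F : borelRn R n * borelRn R n -> \bar R) (K : R) :
  measurable_fun setT F ->
  (forall z, `|F z| <= (K * (lorentzn (z.1 : 'rV[R]_n) * lorentzn (z.2 : 'rV[R]_n)))%:E)%E ->
  (lebn n \x lebn n)%E.-integrable setT F.
Proof.
move=> mF FK; have ml := @measurable_lorentzn R n.
have i1 := @integrable_lorentzn R n 1.
have mK : measurable_fun setT (fun z : borelRn R n * borelRn R n =>
    (K * (lorentzn (z.1 : 'rV[R]_n) * lorentzn (z.2 : 'rV[R]_n)))%:E).
  apply/measurable_EFinP; apply: measurable_funM => //; apply: measurable_funM.
    exact: (measurableT_comp ml measurable_fst).
  exact: (measurableT_comp ml measurable_snd).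
apply: (@le_integrable _ _ _ (lebn n \x lebn n)%E setT measurableT _ _ mF _); last first.
- apply: ((@integrable12ltyP _ _ _ _ R (lebn n) (lebn n) _ mK).2) => /=.
  rewrite (eq_integral (fun x : borelRn R n =>
    (`|K| * lorentz_mass R n * lorentzn (x : 'rV[R]_n))%:E)); last first.
    move=> x _; rewrite (eq_integral (fun y : borelRn R n =>
      (`|K| * lorentzn (x : 'rV[R]_n) * (1 * lorentzn (y : 'rV[R]_n)))%:E)); last first.
      move=> y _; rewrite !normrM !(ger0_norm (ltW (lorentzn_gt0 _))).
      by congr EFin; ring.
    rewrite (integral_cst_mul _ i1); congr EFin; rewrite mulrAC; congr (_ * _ * _).
    by congr fine; apply: eq_integral => y _; rewrite mul1r.
  exact: integrable_lty (integrable_lorentzn n _).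
- by move=> z _; rewrite (le_trans (FK z))// lee_fin ler_norm.
Qed.

Lemma measurable_coord_eq0 n (j : 'I_n) :
  measurable [set x : borelRn R n | (x : 'rV[R]_n) ord0 j = 0].
Proof.
rewrite -[X in measurable X]setTI.
exact: (@measurable_coord R n j measurableT _ (measurable_set1 (0 : R))).
Qed.

Lemma measurable_origin n : measurable ([set (0 : 'rV[R]_n)] : set (borelRn R n)).
Proof.
rewrite (_ : [set 0] = \bigcap_(j in [set: 'I_n])
    [set x : borelRn R n | (x : 'rV[R]_n) ord0 j = 0]).
  by apply: fin_bigcap_measurable => // j _; exact: measurable_coord_eq0.
apply/seteqP; split => [x -> j _ /=|x h]; first by rewrite mxE.
by apply/rowP => j; rewrite mxE; exact: h.
Qed.

(** The origin lies on the hyperplane [x_0 = 0]. *)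
Lemma lebesgue_Rn_set0 n : lebn n.+1 [set (0 : 'rV[R]_n.+1)] = 0%E.
Proof.
pose A : set (borelRn R n.+1) := [set x | (x : 'rV[R]_n.+1) ord0 ord0 = 0].
have mA : measurable A by exact: measurable_coord_eq0.
have m0 := @measurable_origin n.+1.
apply/eqP; rewrite -measure_le0; apply: (@le_trans _ _ (lebn n.+1 A)).
  by apply: le_measure; rewrite ?inE// => x /= ->; rewrite /A/= mxE.
rewrite (_ : lebn n.+1 A = \int[lebn n.+1]_x (\1_A x)%:E)%E; last first.
  by rewrite integral_indic// setIT.
rewrite (eq_integral (fun x : borelRn R n.+1 =>
  (\1_[set (0 : R)] ((x : 'rV[R]_n.+1) ord0 ord0) * cst 1 (row_tail (x : 'rV[R]_n.+1)))%:E)).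
  rewrite ge0_integral_Rn_tensor//.
  by rewrite integral_indic//= setIT lebesgue_measure_set1 mul0e.
by move=> x _; rewrite /= mulr1 !indicE /A; congr (_%:R%:E); apply/idP/idP; rewrite !inE.
Qed.

Lemma ae_neq0 n (F G : 'rV[R]_n.+1 -> \bar R) : (forall x, x != 0 -> F x = G x) ->
  ae_eq (lebn n.+1) setT (F : borelRn R n.+1 -> \bar R) G.
Proof.
move=> FG; exists [set 0]; split; [|exact: lebesgue_Rn_set0|].
  exact: measurable_origin.
move=> x /= H; apply/eqP/negPn/negP => x0; apply: H => _; exact: FG.
Qed.

Variables (p n : nat) (pn : (p < n)%N) (p0 : (0 < p)%N).
Variable f : 'rV[R]_n.+1 -> R.
Hypothesis sf : schwartz f.

Let mf : measurable_fun setT (f : borelRn R n.+1 -> R).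
Proof. exact: continuous_measurable_Rn (schwartz_continuous sf). Qed.
Let v := @gauss_weight R p n.
Let vh := @gauss_weight_hat R p n.

(** Extended real-valued: for a fixed direction the decay in [lorentzn] does not
    bound this integral, which is shown to be finite almost everywhere only. *)
Definition radial_cosint (y : 'rV[R]_n.+1) : \bar R :=
  (\int[leb]_s (posX p s * cosint f (s *: y))%:E)%E.

Definition kernel_constant : R := cosmom 0 0 ^+ n.+1 * p.+1%:R * halfmom R p.

Lemma kernel_constant_gt0 : 0 < kernel_constant.
Proof. by rewrite !mulr_gt0 ?exprn_gt0 ?cosmom00_gt0 ?halfmom_gt0. Qed.

Lemma gauss_weight_gt0 y : 0 < v y.
Proof.
apply: mulr_gt0; last exact: gaussn_gt0.
apply: ltr_wpDr; first by apply: mulr_ge0 => //; exact: exprn_even_ge0.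
by rewrite mulr_gt0// ltr0n.
Qed.

Lemma measurable_dilated_cosint : measurable_fun setT
  (fun z : measurableTypeR R * borelRn R n.+1 =>
    (posX p z.1 * cosint f (z.1 *: (z.2 : 'rV[R]_n.+1)))%:E).
Proof.
apply/measurable_EFinP; apply: measurable_funM.
  exact: (measurableT_comp (@measurable_posX R p) measurable_fst).
exact: (measurableT_comp (measurable_cosint mf) (@measurable_scale R n.+1)).
Qed.

Let F1 (z : measurableTypeR R * borelRn R n.+1) :=
  (posX p z.1 * cosint f (z.1 *: (z.2 : 'rV[R]_n.+1)) * v z.2)%:E.
Let F2 (z : measurableTypeR R * borelRn R n.+1) :=
  (posX p z.1 * vh (z.1 *: (z.2 : 'rV[R]_n.+1)) * f z.2)%:E.

Let iF1 : (lebcons R n.+1).-integrable setT F1.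
Proof.
have [C C0 HC] := cosint_bound sf; have [D D0 HD] := gauss_weight_bound R p n.
apply: integrable_dilated_product HC HD => //; first exact: measurable_cosint.
exact: measurable_gauss_weight.
Qed.

Let iF2 : (lebcons R n.+1).-integrable setT F2.
Proof.
have [C C0 HC] := schwartz_bound sf; have [D D0 HD] := gauss_weight_hat_bound R p n.
apply: integrable_dilated_product HD HC => //.
exact: measurable_gauss_weight_hat.
Qed.

Let GE y : (\int[leb]_s F1 (s, y) = (v y)%:E * radial_cosint y)%E.
Proof.
rewrite -gt0_integralZl ?gauss_weight_gt0//; last first.
  exact: (measurableT_comp measurable_dilated_cosint (pair2_measurable _)).
by apply: eq_integral => s _; rewrite /F1/= mulrC EFinM.
Qed.

Lemma integrable_weighted_radial_cosint :
  (lebn n.+1).-integrable setT (fun y : borelRn R n.+1 => (v y)%:E * radial_cosint y)%E.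
Proof.
have := @integrable_inner_integral _ _ _ _ leb (lebn n.+1) F1 iF1.
by apply: eq_integrable => // y _; rewrite -GE.
Qed.

Let swap (s : R) : (\int[lebn n.+1]_y F1 (s, y) = \int[lebn n.+1]_x F2 (s, x))%E.
Proof.
have [C C0 HC] := schwartz_bound sf; have [D D0 HD] := gauss_weight_bound R p n.
pose H (z : borelRn R n.+1 * borelRn R n.+1) : R :=
  posX p s * (f z.1 * (v z.2 * cos (dotp (s *: (z.1 : 'rV[R]_n.+1)) z.2))).
have mH : measurable_fun setT (EFin \o H).
  apply/measurable_EFinP; apply: measurable_funM => //; apply: measurable_funM.
    exact: (measurableT_comp mf measurable_fst).
  apply: measurable_funM.
    exact: (measurableT_comp (@measurable_gauss_weight R p n) measurable_snd).
  apply: (measurableT_comp (f := @cos R)); first exact: continuous_measurable_fun (@continuous_cos R).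
  apply: measurable_dotp; last exact: measurable_snd.
  exact: (measurableT_comp (measurableT_comp (@measurable_scale R n.+1)
     (pair1_measurable s)) measurable_fst).
have iH : (lebn n.+1 \x lebn n.+1)%E.-integrable setT (EFin \o H).
  apply: (@integrable_lorentzn_product n.+1 _ (posX p s * (C * D)) mH) => z.
  rewrite lee_fin /H normrM ger0_norm ?posX_ge0// -mulrA ler_wpM2l ?posX_ge0//.
  rewrite normrM mulrACA ler_pM// normrM (le_trans _ (HD _))//.
  by rewrite ler_piMr// cos_norm_le1.
transitivity (\int[lebn n.+1]_y \int[lebn n.+1]_x (EFin \o H) (x, y))%E.
  apply: eq_integral => y _; rewrite /F1/=.
  have := integrable_schwartz_dotp (s *: (y : 'rV[R]_n.+1)) sf (@continuous_cos R) (@cos_norm_le1 R).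
  move=> /(integral_cst_mul (posX p s * v y)).
  rewrite -/(cosint f _) mulrAC => <-; apply: eq_integral => x _.
  rewrite /H/=; congr EFin.
  have -> : dotp (s *: (x : 'rV[R]_n.+1)) y = dotp (s *: (y : 'rV[R]_n.+1)) x.
    by apply: eq_bigr => i _; rewrite !mxE; ring.
  by ring.
rewrite -(@Fubini _ _ _ _ R (lebn n.+1) (lebn n.+1) _ iH).
apply: eq_integral => x _; rewrite /F2/=.
have := integrable_gauss_weight_cos p (s *: (x : 'rV[R]_n.+1)).
move=> /(integral_cst_mul (posX p s * f x)).
rewrite integral_gauss_weight_cos mulrAC => <-; apply: eq_integral => y _.
by rewrite /H /v/=; congr EFin; ring.
Qed.

(** Exchange the integrals over the ray and over [y]; on each dilate exchange the
    two transforms; then exchange the ray and the variable of [f], and integrate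
    the transform of the weight along the ray. *)
Lemma weighted_radial_cosint :
  (\int[lebn n.+1]_y ((v y)%:E * radial_cosint y) =
   \int[lebn n.+1]_x (kernel_constant * (cone_gauge p x * f x))%:E)%E.
Proof.
under eq_integral do rewrite -GE.
rewrite -(@Fubini _ _ _ _ R leb (lebn n.+1) _ iF1).
under eq_integral do rewrite swap.
rewrite (@Fubini _ _ _ _ R leb (lebn n.+1) _ iF2).
apply: ae_eq_integral => //.
- exact: measurable_int (@integrable_inner_integral _ _ _ _ leb (lebn n.+1) F2 iF2).
- apply/measurable_EFinP; apply: measurable_funM => //; apply: measurable_funM => //.
  exact: measurable_cone_gauge.
- apply: ae_neq0 => x x0; have [ix Ix] := integral_posX_gauss_weight_hat p x0.
  have := integral_cst_mul (f x) ix; rewrite /Rintegral Ix/= => E.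
  transitivity (\int[leb]_s (f x * (posX p s * vh (s *: x)))%:E)%E.
    by apply: eq_integral => s _; rewrite /F2/= mulrC.
  by rewrite [LHS]E; congr EFin; rewrite /kernel_constant; ring.
Qed.

End IntegralIdentity.

(** * The measure on the sphere *)

Section EmbeddingMeasure.
Variable R : realType.
Local Notation leb := (@lebesgue_measure R).
Local Notation lebn n := (lebesgue_Rn R n).
Variables (p n : nat) (pn : (p < n)%N) (p0 : (0 < p)%N).

Let v := @gauss_weight R p n.
Let kappa : R := kernel_constant R p n.
Let kappa_gt0 : 0 < kappa. Proof. exact: kernel_constant_gt0. Qed.

(** The substitution of [c * s] for [s]. *)
Lemma radial_cosint_dilate (f : 'rV[R]_n.+1 -> R) (c : R) y : schwartz f -> 0 < c ->
  (radial_cosint p f y = (c ^+ p.+1)%:E * radial_cosint p f (c *: y))%E.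
Proof.
move=> sf c0; rewrite /radial_cosint.

have m1 (z : borelRn R n.+1) : measurable_fun setT
    (fun s : measurableTypeR R => (posX p s * cosint f (s *: (z : 'rV[R]_n.+1)))%:E).
  exact: (measurableT_comp (@measurable_dilated_cosint R p n f sf) (pair2_measurable z)).
rewrite (integral_dilation c0 (m1 y)).
rewrite -[RHS](gt0_integralZl _ (exprn_gt0 _ c0) (m1 (c *: y))).
have m2 : measurable_fun setT (fun s : measurableTypeR R =>
    (posX p (c * s) * cosint f ((c * s) *: y))%:E).
  apply: (measurableT_comp (m1 y)).
  exact: (@measurable_funM _ _ R setT (cst c) id).
apply: etrans (esym (gt0_integralZl _ c0 m2)) _.
apply: eq_integral => s _; rewrite -!EFinM exprS; congr EFin.
rewrite {1}/posX pmulr_rgt0// /posX; case: ifPn => _; last by rewrite !mul0r !mulr0.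
by rewrite exprMn scalerA (mulrC s) -!mulrA.
Qed.

Lemma measurable_radial_cosint (f : 'rV[R]_n.+1 -> R) : schwartz f ->
  measurable_fun setT (radial_cosint p f : borelRn R n.+1 -> \bar R).
Proof.
move=> sf.
apply: (@measurable_integral_param R _ _ (borelRn R n.+1) (measurableTypeR R) leb
  (fun z => (posX p z.2 * cosint f (z.2 *: (z.1 : 'rV[R]_n.+1)))%:E)).
exact: (measurableT_comp (@measurable_dilated_cosint R p n f sf)
  (measurable_fun_pair measurable_snd measurable_fst)).
Qed.

(** The density on [R^(n+1)] whose image under [y |-> y / |y|] is the measure
    on the sphere; the value [0^-1 = 0] removes the origin. *)
Definition sphere_density (y : 'rV[R]_n.+1) : R :=
  kappa^-1 * v y * (enorm y ^+ p.+1)^-1.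

Let w := sphere_density.

Lemma sphere_density_ge0 y : 0 <= w y.
Proof.
apply: mulr_ge0; last by rewrite invr_ge0 exprn_ge0// enorm_ge0.
by apply: mulr_ge0; [rewrite invr_ge0 ltW|exact: gauss_weight_ge0].
Qed.

Lemma sphere_density0 : w 0 = 0.
Proof.
have e0 : enorm (0 : 'rV[R]_n.+1) = 0 by apply/eqP; rewrite enorm_eq0.
by rewrite /w /sphere_density e0 expr0n invr0 mulr0.
Qed.

Lemma measurable_sphere_density : measurable_fun setT (w : borelRn R n.+1 -> R).
Proof.
apply: measurable_funM; last exact: measurable_enorm_invX.
by apply: measurable_funM => //; exact: measurable_gauss_weight.
Qed.

Let m0 : {measure set (borelRn R n.+1 * measurableTypeR R) -> \bar R} :=
  (lebn n.+1 \x leb)%E.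

(** The Lebesgue measure of the subgraph replaces the measure with density
    [sphere_density]: by Fubini's theorem the two have the same integrals. *)
Let under (z : borelRn R n.+1 * measurableTypeR R) : bool :=
  (0 < z.2) && (z.2 < w z.1).

Let measurable_under : measurable_fun setT under.
Proof.
apply: measurable_and.
  by apply: measurable_fun_ltr => //; exact: measurable_snd.
apply: measurable_fun_ltr; first exact: measurable_snd.
exact: (measurableT_comp measurable_sphere_density measurable_fst).
Qed.

Definition normalize (y : 'rV[R]_n.+1) : 'rV[R]_n.+1 := (enorm y)^-1 *: y.

Lemma measurable_normalize :
  measurable_fun setT (normalize : borelRn R n.+1 -> borelRn R n.+1).
Proof.
apply: measurable_fun_borelRn => j; under eq_fun do rewrite mxE -[enorm _]expr1.
by apply: measurable_funM; [exact: measurable_enorm_invX|exact: measurable_coord].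
Qed.

Let psi (z : borelRn R n.+1 * measurableTypeR R) : borelRn R n.+1 :=
  if under z then normalize z.1 else 0.

Let measurable_psi : measurable_fun setT psi.
Proof.
apply: measurable_fun_ifT => //.
exact: (measurableT_comp measurable_normalize measurable_fst).
Qed.

Lemma enorm_normalize y : y != 0 -> enorm (normalize y) = 1.
Proof.
move=> y0; have e0 : 0 < enorm y by rewrite enorm_gt0.
rewrite {1}/enorm /normalize dotpZ -enorm_sqr -exprMn mulVf ?gt_eqF//.
by rewrite expr1n sqrtr1.
Qed.

Let under_neq0 z : under z -> z.1 != 0.
Proof.
move=> /andP[h0 hw]; apply/eqP => z0; move: hw.
by rewrite z0 sphere_density0 ltNge (ltW h0).
Qed.

Let preimage_sphere : psi @^-1` @unit_sphere R n.+1 = under.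
Proof.
apply/seteqP; split => z; rewrite /= /unit_sphere/= /psi; case: ifPn => // uz.
  move=> /eqP; rewrite (_ : (enorm 0 == 1) = false)//.
  by apply/negbTE; rewrite (_ : enorm 0 = 0) 1?eq_sym ?oner_eq0//; apply/eqP; rewrite enorm_eq0.
by move=> _; rewrite enorm_normalize// (under_neq0 uz).
Qed.

Lemma measurable_unit_sphere :
  measurable (@unit_sphere R n.+1 : set (borelRn R n.+1)).
Proof.
rewrite -[X in measurable X]setTI.
exact: (@measurable_enorm R n.+1 measurableT _ (measurable_set1 (1 : R))).
Qed.

Let push : {measure set (borelRn R n.+1) -> \bar R} :=
  measure_function_pushforward__canonical__measure_function_Measure m0 measurable_psi.

Definition sphere_measure : {measure set (borelRn R n.+1) -> \bar R} :=
  mrestr push measurable_unit_sphere.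

Lemma sphere_measureC : sphere_measure (~` @unit_sphere R n.+1) = 0%E.
Proof. by rewrite /sphere_measure/= /mrestr setICl measure0. Qed.

Section Integral.
Variable f : 'rV[R]_n.+1 -> R.
Hypothesis sf : schwartz f.
Let g := (radial_cosint p f : borelRn R n.+1 -> \bar R).
Let mg : measurable_fun setT g. Proof. exact: measurable_radial_cosint. Qed.

Let H (z : borelRn R n.+1 * measurableTypeR R) : \bar R :=
  if under z then g (psi z) else 0%E.

Let HE : H = (g \o psi) \_ under.
Proof.
apply/funext => z; rewrite /H patchE; case: ifPn => uz.
  by rewrite ifT//; exact/mem_set.
by rewrite ifF//; apply/negbTE/negP => /set_mem; exact/negP.
Qed.

Let munder : measurable (under : set _).
Proof.
have : measurable (setT `&` under @^-1` [set true]) by exact: measurable_under.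
by rewrite setTI.
Qed.

Let mH : measurable_fun setT H.
Proof.
rewrite HE; apply: ((measurable_restrictT (g \o psi) munder).1).
exact: (measurable_funTS (measurableT_comp mg measurable_psi)).
Qed.

Let inner (F : \bar R -> \bar R) y : F 0%E = 0%E ->
  (\int[leb]_h F (H (y, h)) = (w y)%:E * F (g (normalize y)))%E.
Proof.
move=> F0.
transitivity (\int[leb]_h ((cst (F (g (normalize y)))) \_ `]0%R, w y[) h)%E.
  apply: eq_integral => h _; rewrite /H patchE mem_setE in_itv -/(under (y, h)) /psi.
  by case: (under (y, h)).
rewrite -integral_mkcond integral_cst//= lebesgue_measure_itv/= lte_fin muleC.
case: ltgtP (sphere_density_ge0 y) => // [y0|<-] _; first by rewrite -EFinB subr0.
by [].
Qed.

(** The homogeneity of [radial_cosint] cancels the power of the norm in the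
    density. *)
Let density_radial y : y != 0 ->
  ((w y)%:E * g (normalize y) = kappa^-1%:E * ((v y)%:E * g y))%E.
Proof.
move=> y0; have c0 : 0 < (enorm y)^-1 by rewrite invr_gt0 enorm_gt0.
rewrite /g (radial_cosint_dilate y sf c0) -/(normalize y) !muleA -!EFinM.
by congr (_%:E * _)%E; rewrite /w /sphere_density exprVn mulrA.
Qed.

Let ig : (lebn n.+1).-integrable setT (fun y : borelRn R n.+1 => kappa^-1%:E * ((v y)%:E * g y))%E.
Proof. by apply: integrableZl => //; exact: integrable_weighted_radial_cosint. Qed.

Let mwg : measurable_fun setT (fun y : borelRn R n.+1 => (w y)%:E * g (normalize y))%E.
Proof.
apply: emeasurable_funM.
  by apply/measurable_EFinP; exact: measurable_sphere_density.
exact: measurableT_comp mg measurable_normalize.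
Qed.

Let iwg : (lebn n.+1).-integrable setT (fun y : borelRn R n.+1 => (w y)%:E * g (normalize y))%E.
Proof.
apply/integrableP; split; first exact: mwg.
have /integrableP[mg' goo] := ig; apply: le_lt_trans goo.
rewrite le_eqVlt; apply/orP; left; apply/eqP; apply: ae_eq_integral => //.
- exact: measurableT_comp.
- exact: measurableT_comp.
- by apply: ae_neq0 => y y0; rewrite density_radial.
Qed.

Let iH : m0.-integrable setT H.
Proof.
apply: ((@integrable12ltyP _ _ _ _ R (lebn n.+1) leb H mH).2).
under eq_integral do rewrite (inner (F := abse)) ?abse0//.
have /integrableP[_] := iwg; congr (_ < _)%E; apply: eq_integral => y _.
by rewrite abseM gee0_abs ?lee_fin ?sphere_density_ge0.
Qed.

Let igpsi : m0.-integrable (psi @^-1` @unit_sphere R n.+1) (g \o psi).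
Proof.
by rewrite preimage_sphere; apply: ((integrable_mkcond (g \o psi) munder).2); rewrite -HE; exact: iH.
Qed.

Let sphere_measureE (A : set (borelRn R n.+1)) : measurable A -> A `<=` @unit_sphere R n.+1 ->
  push A = sphere_measure A.
Proof. by move=> mA AS; rewrite /sphere_measure/= /mrestr setIidl. Qed.

Lemma integrable_radial_cosint :
  sphere_measure.-integrable (@unit_sphere R n.+1) (radial_cosint p f : borelRn R n.+1 -> \bar R).
Proof.
apply/integrableP; split; first exact: measurable_funTS mg.
rewrite (@eq_measure_integral _ _ _ _ push); last first.
  by move=> A mA AS; rewrite sphere_measureE.
have := integrable_pushforward measurable_psi mg igpsi measurable_unit_sphere.
by move=> /integrableP[].
Qed.

Lemma integral_sphere_measure :
  (\int[sphere_measure]_(x in @unit_sphere R n.+1) radial_cosint p f x =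
   \int[lebn n.+1]_x (cone_gauge p x * f x)%:E)%E.
Proof.
rewrite (@eq_measure_integral _ _ _ _ push); last first.
  by move=> A mA AS; rewrite sphere_measureE.
have -> := integral_pushforward measurable_psi mg igpsi measurable_unit_sphere.
rewrite preimage_sphere.
rewrite integral_mkcond -HE -(@integral12_prod_meas1 _ _ _ _ R (lebn n.+1) leb H iH).
transitivity (\int[lebn n.+1]_y ((w y)%:E * g (normalize y)))%E.
  by apply: eq_integral => y _; rewrite /fubini_F (inner (F := id)).
transitivity (\int[lebn n.+1]_y (kappa^-1%:E * ((v y)%:E * g y)))%E.
  apply: ae_eq_integral => //; first exact: measurable_int ig.
  exact: ae_neq0 density_radial.
apply: etrans (integralZl measurableT (integrable_weighted_radial_cosint pn p0 sf) _) _.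
rewrite (weighted_radial_cosint pn p0 sf) -/kappa.
transitivity (kappa^-1%:E * (kappa%:E * \int[lebn n.+1]_x (cone_gauge p x * f x)%:E))%E.
  congr (_ * _)%E; rewrite -gt0_integralZl//; apply/measurable_EFinP.
  apply: measurable_funM; first exact: measurable_cone_gauge.
  exact: continuous_measurable_Rn (schwartz_continuous sf).
by rewrite muleA -EFinM mulVf ?mul1e// gt_eqF.
Qed.
End Integral.

End EmbeddingMeasure.

(** * Radial functions *)

Section Bodies.
Variable R : realType.
Variable n : nat.
Implicit Types (K L : set 'rV[R]_n) (x y : 'rV[R]_n).

Lemma coord_le_enorm x i : `|x ord0 i| <= enorm x.
Proof.
rewrite -(ler_pXn2r (n := 2))// ?nnegrE ?enorm_ge0// enorm_sqr real_normK ?num_real//.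
rewrite /dotp (bigD1 i)//= -expr2 lerDl; apply: sumr_ge0 => j _.
by rewrite -expr2 sqr_ge0.
Qed.

Lemma mx_norm_le_enorm x : `|x| <= enorm x.
Proof.
rewrite [leLHS]/Num.norm/= mx_normrE; apply/bigmax_leP; split => [|[i j] _ /=].
  exact: enorm_ge0.
by rewrite (ord1 i); exact: coord_le_enorm.
Qed.

Lemma enorm_sqr_le_mx_norm x : enorm x ^+ 2 <= n%:R * `|x| ^+ 2.
Proof.
rewrite enorm_sqr /dotp -[n in n%:R]card_ord mulr_natl -sumr_const.
apply: ler_sum => i _; rewrite -expr2 -real_normK ?num_real//.
rewrite lerXn2r ?nnegrE//= [leRHS]/Num.norm/= mx_normrE.
by apply/bigmax_geP; right => /=; exists (ord0, i).
Qed.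

Lemma enormZ (t : R) x : enorm (t *: x) = `|t| * enorm x.
Proof. by rewrite {1}/enorm dotpZ sqrtrM ?sqr_ge0// sqrtr_sqr. Qed.

Lemma continuous_enorm : continuous (@enorm R n).
Proof.
move=> x; apply: (continuous_comp (f := fun x => dotp x x)); last exact: sqrt_continuous.
by apply: continuous_dotp => y; exact: cvg_id.
Qed.

Lemma near_neq0 y : y != 0 -> \forall z \near y, z != 0.
Proof.
move=> y0; near=> z; rewrite -enorm_gt0; near: z.
by apply: (cvgr_gt (enorm y)); [exact: continuous_enorm|rewrite enorm_gt0].
Unshelve. all: by end_near. Qed.

Definition starlike K :=
  [/\ compact K, K 0 & forall t x, 0 <= t <= 1 -> K x -> K (t *: x)].

(** The class in which sums, limits and linear images are handled. Continuity off
    the origin, unlike continuity on the sphere, is visibly stable under linear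
    maps. *)
Definition radial_body K :=
  starlike K /\ forall x, x != 0 -> {for x, continuous (radial K)}.

Section Starlike.
Variable K : set 'rV[R]_n.
Hypothesis sK : starlike K.

Lemma starlike_bounded : exists2 M, 0 < M & forall x, K x -> enorm x <= M.
Proof.
have [cK _ _] := sK; have [M [_ HM]] := compact_bounded cK.
pose B := `|M| + 1; have B0 : 0 < B by rewrite ltr_wpDl.
have MB : M < B by rewrite (le_lt_trans (ler_norm M))// ltrDl.
exists ((n%:R + 1) * B) => [|x Kx]; first by rewrite mulr_gt0// ltr_wpDl.
rewrite -(ler_pXn2r (n := 2))// ?nnegrE ?enorm_ge0 ?mulr_ge0 ?addr_ge0 ?(ltW B0)//.
apply: le_trans (enorm_sqr_le_mx_norm x) _.
apply: (@le_trans _ _ (n%:R * B ^+ 2)).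
  by rewrite ler_wpM2l// lerXn2r ?nnegrE ?(ltW B0)//; exact: HM.
rewrite exprMn ler_wpM2r ?sqr_ge0// sqrrD1 -addrA.
have : 0 <= n%:R ^+ 2 :> R by exact: sqr_ge0.
have : 0 <= n%:R :> R by [].
by rewrite mulr2n; lra.
Qed.

Let S x := [set r | 0 <= r /\ K (r *: x)].

Lemma radial_has_sup x : x != 0 -> has_sup (S x).
Proof.
move=> x0; have [_ K0 _] := sK; split; first by exists 0; split=> //; rewrite scale0r.
have [M M0 HM] := starlike_bounded; exists (M / enorm x) => r [r0 /HM].
by rewrite enormZ ger0_norm// ler_pdivlMr// enorm_gt0.
Qed.

Lemma radial_ge0 x : x != 0 -> 0 <= radial K x.
Proof.
move=> x0; apply: sup_upper_bound; first exact: radial_has_sup.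
by have [_ K0 _] := sK; split=> //; rewrite scale0r.
Qed.

(** The supremum is attained because [K] is closed. *)
Lemma radial_mem x : x != 0 -> K (radial K x *: x).
Proof.
move=> x0; have hs := radial_has_sup x0; have [cK K0 _] := sK.
have clK : closed K by apply: compact_closed => //; exact: norm_hausdorff.
apply: clK => B /nbhs_ballP[e /= e0 HB].
have ex0 : 0 < enorm x by rewrite enorm_gt0.
have d0 : 0 < e / enorm x by rewrite divr_gt0.
have [r [r0 Kr] rS] := sup_adherent d0 hs.
exists (r *: x); split=> //; apply: HB.
rewrite -ball_normE/= -scalerBl (le_lt_trans (mx_norm_le_enorm _))//.
rewrite enormZ -ltr_pdivlMr// ger0_norm; last first.
  by rewrite subr_ge0; apply: sup_upper_bound.
by rewrite ltrBlDr -ltrBlDl.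
Qed.

Lemma radialP x r : x != 0 -> 0 <= r -> K (r *: x) <-> r <= radial K x.
Proof.
move=> x0 r0; split => [Kr|rr].
  by apply: sup_upper_bound; first exact: radial_has_sup.
have [->|rn0] := eqVneq r 0; first by rewrite scale0r; have [] := sK.
have rp : 0 < r by rewrite lt_def rn0.
have R0 := lt_le_trans rp rr; have [_ _ st] := sK.
have := st (r / radial K x) _ _ (radial_mem x0).
rewrite scalerA divfK ?gt_eqF//; apply.
by apply/andP; split; [rewrite divr_ge0// ltW|rewrite ler_pdivrMr// mul1r].
Qed.

Lemma radialZ (t : R) x : 0 < t -> x != 0 -> radial K (t *: x) = radial K x / t.
Proof.
move=> t0 x0; have tx0 : t *: x != 0 by rewrite scaler_eq0 negb_or gt_eqF.
apply/eqP; rewrite eq_le; apply/andP; split.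
  rewrite ler_pdivlMr//; apply/radialP => //.
    by rewrite mulr_ge0 ?radial_ge0// ltW.
  by rewrite -scalerA; exact: radial_mem.
apply/radialP => //; first by rewrite divr_ge0 ?radial_ge0// ltW.
by rewrite scalerA divfK ?gt_eqF//; exact: radial_mem.
Qed.

(** If [K] contains no positive multiple of [x], the functional is the infimum of
    the empty set, which is 0, and [0 `^ (- p.+1%:R) = 0] is the power of the
    radial function as well. *)
Lemma minkowski_powRN p x : x != 0 ->
  Defs.minkowski K x `^ (- p.+1%:R) = radial K x ^+ p.+1.
Proof.
move=> x0; have R0 := radial_ge0 x0; rewrite /Defs.minkowski.
have mem t : 0 < t -> ((fun y => t *: y) @` K) x <-> t^-1 <= radial K x.
  move=> t0; have ti0 : 0 <= t^-1 by rewrite invr_ge0 ltW.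
  split=> [[y Ky yx]|/radialP]; last first.
    by move=> /(_ x0 ti0) Kx; exists (t^-1 *: x) => //; rewrite scalerA divff ?scale1r// gt_eqF.
  by apply/radialP => //; rewrite -yx scalerA mulVf ?scale1r// gt_eqF.
have zero : ~ ((fun y => 0 *: y) @` K) x.
  by move=> [y _]; rewrite scale0r => /esym/eqP; exact/negP.
have [r0|rn0] := eqVneq (radial K x) 0.
  rewrite r0 (_ : [set t | _] = set0).
    by rewrite inf0 powR0 ?oppr_eq0 ?pnatr_eq0// expr0n.
  apply/seteqP; split=> // t [t0].
  have [->|tn0] := eqVneq t 0; first by move/zero.
  have tp : 0 < t by rewrite lt_def tn0.
  by move/(mem _ tp); rewrite r0 leNgt invr_gt0 tp.
have Rp : 0 < radial K x by rewrite lt_def rn0.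
have -> : inf [set t | 0 <= t /\ ((fun y => t *: y) @` K) x] = (radial K x)^-1.
  apply/eqP; rewrite eq_le; apply/andP; split.
    apply: ge_inf; first by exists 0 => t [].
    by split; [rewrite invr_ge0|apply/mem; rewrite ?invr_gt0// invrK].
  apply: lb_le_inf.
    by exists (radial K x)^-1; split; [rewrite invr_ge0|apply/mem; rewrite ?invr_gt0// invrK].
  move=> t [t0]; have [->|tn0] := eqVneq t 0; first by move/zero.
  have tp : 0 < t by rewrite lt_def tn0.
  move/(mem _ tp) => tr; rewrite -[leRHS]invrK lef_pV2// ?posrE ?invr_gt0//.
by rewrite powR_invn ?invr_ge0// exprVn invrK.
Qed.

End Starlike.

(** The radial function is homogeneous of degree [-1], which extends its
    continuity from the sphere to all nonzero vectors. *)
Lemma star_body_radial_body K : star_body K -> radial_body K.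
Proof.
move=> [[cK [x Kx]] _ st cr _].
have K0 : K 0.
  apply: (st 0); first by rewrite lexx ler01.
  by exists x; [exact: interior_subset Kx|rewrite scale0r].
have sK : starlike K.
  by split=> // t y t01 Ky; apply: (st t t01); exists y.
split => // y y0; have ey0 : 0 < enorm y by rewrite enorm_gt0.
pose nz z : 'rV[R]_n := (enorm z)^-1 *: z.
have Snz z : z != 0 -> unit_sphere (nz z).
  move=> z0; rewrite /unit_sphere/= /nz enormZ normfV ger0_norm ?enorm_ge0//.
  by rewrite mulVf// gt_eqF// enorm_gt0.
have cinv : {for y, continuous (fun z => (enorm z)^-1)}.
  have en0 : enorm y != 0 by rewrite gt_eqF.
  by apply: continuousV; [exact: en0|exact: continuous_enorm].
have cnz : {for y, continuous nz}.
  exact: (continuousZ cinv (@cvg_id _ (nbhs y))).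
have near0 : \forall z \near y, z != 0.
  exact: near_neq0.
have crad : {for y, continuous (radial K \o nz)}.
  have /subspace_continuousP/(_ _ (Snz _ y0)) cS := cr.
  move=> B HB; have H : \forall z \near y, unit_sphere (nz z) -> B (radial K (nz z)).
    exact: cnz _ (cS _ HB).
  by apply: filterS2 near0 H => z z0; apply; exact: Snz.
have E z : z != 0 -> radial K z = radial K (nz z) * (enorm z)^-1.
  move=> z0; rewrite /nz radialZ// ?invr_gt0 ?enorm_gt0// invrK mulfK//.
  by rewrite gt_eqF// enorm_gt0.
have cE : (fun z => radial K (nz z) * (enorm z)^-1) @ y --> radial K y.
  by rewrite (E y y0); exact: (continuousM crad cinv).
have : {near nbhs y, (fun z => radial K (nz z) * (enorm z)^-1) =1 radial K}.
  by near=> z; apply/esym/E; near: z; exact: near0.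
by move/near_eq_cvg/cvg_trans; apply.
Unshelve. all: by end_near. Qed.

End Bodies.

(** * The bodies of the class D *)

Section DnegBodies.
Variable R : realType.
Variable n : nat.
Implicit Types (K L : set 'rV[R]_n) (x y : 'rV[R]_n).

Lemma starlike_unit_ball : starlike (@unit_ball R n).
Proof.
split.
- apply: bounded_closed_compact.
    exists 1; split; first exact: num_real.
    move=> M M1 x Bx; apply: le_trans (mx_norm_le_enorm x) _.
    by rewrite (le_trans Bx)// ltW.
  rewrite (_ : unit_ball (n := n) = @enorm R n @^-1` [set t | t <= 1])//.
  by apply: closed_comp; [move=> x _; exact: continuous_enorm|exact: closed_le].
- by rewrite /unit_ball/= (_ : enorm 0 = 0)//; apply/eqP; rewrite enorm_eq0.
- move=> t x /andP[t0 t1]; rewrite /unit_ball/= enormZ ger0_norm// => x1.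
  by rewrite -[leRHS]mul1r ler_pM// enorm_ge0.
Qed.

Lemma radial_unit_ball x : x != 0 -> radial (@unit_ball R n) x = (enorm x)^-1.
Proof.
move=> x0; have e0 : 0 < enorm x by rewrite enorm_gt0.
have B r : 0 <= r -> unit_ball (r *: x) <-> r <= (enorm x)^-1.
  move=> r0; rewrite /unit_ball/= enormZ ger0_norm//.
  by rewrite -[(enorm x)^-1]mul1r ler_pdivlMr.
have sB := starlike_unit_ball; have i0 : 0 <= (enorm x)^-1 by rewrite invr_ge0 ltW.
apply/eqP; rewrite eq_le; apply/andP; split.
  by apply/(B _ (radial_ge0 sB x0)); exact: radial_mem.
by apply/(radialP sB x0 i0)/(B _ i0).
Qed.

Lemma radial_body_unit_ball : radial_body (@unit_ball R n).
Proof.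
split; first exact: starlike_unit_ball.
move=> y y0; rewrite /prop_for /continuous_at (radial_unit_ball y0).
have e0 : enorm y != 0 by rewrite enorm_eq0.
have : {near nbhs y, (fun z => (enorm z)^-1) =1 radial (@unit_ball R n)}.
  by near=> z; apply/esym/radial_unit_ball; near: z; exact: near_neq0.
move/near_eq_cvg/cvg_trans; apply.
by apply: continuousV => //; exact: continuous_enorm.
Unshelve. all: by end_near. Qed.

Lemma continuous_mulmx (m : nat) (B : 'M[R]_(m, n)) :
  continuous ((fun z : 'rV[R]_m => z *m B) : 'rV[R]_m -> 'rV[R]_n).
Proof.
apply: continuous_row => j.
rewrite (_ : (fun _ => _) = (fun z : 'rV[R]_m => dotp z (\row_i B i j))).
  apply: (@continuous_dotp R m _ id (cst (\row_i B i j))); last exact: cst_continuous.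
  by move=> z; exact: cvg_id.
by apply/funext => z; rewrite mxE; apply: eq_bigr => i _; rewrite mxE.
Qed.

Lemma radial_image_mulmx K (A : 'M[R]_n) x : A \in unitmx ->
  radial ((fun x => x *m A) @` K) x = radial K (x *m invmx A).
Proof.
move=> uA; congr sup; apply/seteqP; split=> r [r0].
  move=> [y Ky yx]; split => //.
  by rewrite scalemxAl -yx mulmxK.
by move=> Kr; split => //; exists (r *: (x *m invmx A)) => //; rewrite -scalemxAl mulmxKV.
Qed.

Lemma mulmx_unit_neq0 (A : 'M[R]_n) x : A \in unitmx -> x != 0 -> x *m A != 0.
Proof.
move=> uA; apply: contraNneq => xA0.
by rewrite -(mulmxK uA x) xA0 mul0mx.
Qed.

Lemma radial_body_image K (A : 'M[R]_n) : A \in unitmx ->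
  radial_body K -> radial_body ((fun x => x *m A) @` K).
Proof.
move=> uA [[cK K0 st] cr]; split.
  split.
  - apply: continuous_compact => //; apply: continuous_subspaceT.
    exact: continuous_mulmx.
  - by exists 0 => //; rewrite mul0mx.
  - move=> t _ t01 [x Kx <-]; exists (t *: x); first exact: st.
    by rewrite -scalemxAl.
move=> y y0.
rewrite (_ : radial _ = radial K \o (fun x => x *m invmx A)).
  apply: continuous_comp; first exact: continuous_mulmx.
  by apply: cr; apply: mulmx_unit_neq0 => //; rewrite unitmx_inv.
by apply/funext => x; rewrite /= radial_image_mulmx.
Qed.

Lemma Dneg_radial_body p K : Dneg p K -> radial_body K.
Proof.
elim=> [|{}K A _ IH uA|L1 L2 L _ _ _ _ [sL _]|K_ L _ _ sL _].
- exact: radial_body_unit_ball.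
- exact: radial_body_image.
- exact: star_body_radial_body.
- exact: star_body_radial_body.
Qed.

Lemma radial_sphere_bounded K : starlike K ->
  exists2 M, 0 < M & forall x, unit_sphere x -> radial K x <= M.
Proof.
move=> sK; have [M M0 HM] := starlike_bounded sK; exists M => // x Sx.
have x0 : x != 0 by rewrite -enorm_gt0 Sx.
have := HM _ (radial_mem sK x0); rewrite enormZ Sx mulr1.
by rewrite ger0_norm// radial_ge0.
Qed.

Lemma radial_dist_ub K L x : starlike K -> starlike L -> unit_sphere x ->
  `|radial K x - radial L x| <= radial_dist K L.
Proof.
move=> sK sL Sx; have [M M0 HM] := radial_sphere_bounded sK.
have [N N0 HN] := radial_sphere_bounded sL.
apply: sup_upper_bound; last by exists x.
split; first by exists `|radial K x - radial L x|; exists x.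
exists (M + N) => _ [y Sy <-]; rewrite (le_trans (ler_normB _ _))//.
have y0 : y != 0 by rewrite -enorm_gt0 Sy.
by rewrite !ger0_norm ?radial_ge0// lerD// ?HM ?HN.
Qed.

End DnegBodies.

Section Slices.
Variable R : realType.
Local Notation lebn n := (lebesgue_Rn R n).
Variables (p m : nat).

(** The hyperplane [x_0 = 1]: a radial function, being homogeneous, is studied
    in this affine chart of the projective space. *)
Definition chart (y : 'rV[R]_m) : 'rV[R]_m.+1 := Rn_cons (1, y : borelRn R m).

Definition chart_power (K : set 'rV[R]_m.+1) (A : 'M[R]_m.+1) (y : 'rV[R]_m) : R :=
  radial K (chart y *m A) ^+ p.+1.

Definition eball (r : R) : set 'rV[R]_m := [set y | dotp y y <= r ^+ 2].

(** The invariant of the class. The matrix [A] makes it invariant under linear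
    maps. The factor [l] exceeds 1 to first order at [l = 1], which a radial
    function with a double zero violates; the radius [(2 * l - 1) * r] is that of
    the smallest ball centered at the origin that contains all the homothetic
    images of ratio [l] of [eball r] with center in [eball r]. *)
Definition spreads K := forall (A : 'M[R]_m.+1) (r l : R),
  A \in unitmx -> 0 < r -> 1 <= l ->
  (l%:E * \int[lebn m]_(y in eball r) (chart_power K A y)%:E <=
   \int[lebn m]_(y in eball ((2 * l - 1) * r)) (chart_power K A y)%:E)%E.

Lemma chart_neq0 y : chart y != 0.
Proof.
apply/eqP => /(congr1 (fun x : 'rV[R]_m.+1 => x ord0 ord0)).
by rewrite Rn_cons0 mxE => /eqP; rewrite oner_eq0.
Qed.

Lemma chart_mulmx_neq0 (A : 'M[R]_m.+1) y : A \in unitmx -> chart y *m A != 0.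
Proof. by move=> uA; apply: mulmx_unit_neq0 => //; exact: chart_neq0. Qed.

Lemma continuous_chart_mulmx (A : 'M[R]_m.+1) : continuous (fun y => chart y *m A).
Proof.
move=> y; apply: (@continuous_comp _ _ _ chart (fun x => x *m A) y).
  exact: (@continuous_Rn_cons_tail R m 1 y).
exact: continuous_mulmx.
Qed.

Lemma continuous_chart_power K A : A \in unitmx -> radial_body K ->
  continuous (chart_power K A).
Proof.
move=> uA [sK cr] y; rewrite /chart_power.
apply: (@continuous_comp _ _ _ (fun y => radial K (chart y *m A)) (fun t => t ^+ p.+1) y).
  apply: (@continuous_comp _ _ _ (fun y => chart y *m A) (radial K) y).
    exact: continuous_chart_mulmx.
  by apply: cr; exact: chart_mulmx_neq0.
exact: exprn_continuous.
Qed.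

Lemma measurable_chart_power K A (D : set (borelRn R m)) : A \in unitmx -> radial_body K ->
  measurable_fun D ((fun y => (chart_power K A y)%:E) : borelRn R m -> \bar R).
Proof.
move=> uA bK; apply: measurable_funTS; apply/measurable_EFinP.
exact: continuous_measurable_Rn (continuous_chart_power uA bK).
Qed.

Lemma chart_power_ge0 K A y : A \in unitmx -> starlike K -> 0 <= chart_power K A y.
Proof. by move=> uA sK; rewrite exprn_ge0// radial_ge0// chart_mulmx_neq0. Qed.

Lemma measurable_eball r : measurable (eball r : set (borelRn R m)).
Proof.
rewrite -[X in measurable X]setTI.
have md : measurable_fun setT ((fun y => dotp y y) : borelRn R m -> R).
  by apply: measurable_dotp; exact: measurable_id.
have := md measurableT _ (measurable_itv `]-oo, r ^+ 2]).
by congr measurable; apply/seteqP; split => y /=; rewrite /eball/= in_itv.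
Qed.

Lemma compact_eball r : 0 <= r -> compact (eball r).
Proof.
move=> r0; apply: bounded_closed_compact.
  exists r; split; first exact: num_real.
  move=> M rM y By; apply: le_trans (mx_norm_le_enorm y) _; apply: le_trans _ (ltW rM).
  by rewrite -(ler_pXn2r (n := 2))// ?nnegrE ?enorm_ge0// enorm_sqr.
rewrite (_ : eball r = (fun y => dotp y y) @^-1` [set t | t <= r ^+ 2])//.
apply: closed_comp; last exact: closed_le.
by move=> y _; apply: continuous_dotp => z; exact: cvg_id.
Qed.

(** On a ball, the integrable function [lorentzn] is bounded below by a positive
    constant. *)
Lemma eball_finite r : (lebn m (eball r) < +oo)%E.
Proof.
have mB := measurable_eball r.
pose K : R := (1 + r ^+ 2) ^+ m.
have K0 : 0 < 1 + r ^+ 2 by rewrite ltr_wpDr// sqr_ge0.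
apply: (@le_lt_trans _ _ (\int[lebn m]_y (K * lorentzn (y : 'rV[R]_m))%:E)%E); last first.
  exact: integrable_lty (integrable_lorentzn m K).
rewrite (_ : lebn m (eball r) = \int[lebn m]_y (\1_(eball r : set (borelRn R m)) y)%:E)%E; last first.
  by rewrite integral_indic// setIT.
apply: ge0_le_integral => //.
- by apply/measurable_EFinP; exact: measurable_indic.
- by apply/measurable_EFinP; apply: measurable_funM => //; exact: measurable_lorentzn.
move=> y _; rewrite lee_fin indicE; have [/set_mem By|_] := boolP (y \in _); last first.
  by rewrite mulr_ge0 ?exprn_ge0 ?(ltW K0)// ltW// lorentzn_gt0.
have P0 : 0 < \prod_(i < m) (1 + (y : 'rV[R]_m) ord0 i ^+ 2).
  by apply: prodr_gt0 => i _; rewrite ltr_wpDr// sqr_ge0.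
rewrite /lorentzn prodfV ler_pdivlMr// mul1r /K -[m in _ ^+ m]card_ord -prodr_const.
apply: ler_prod => i _; rewrite addr_ge0 ?sqr_ge0//= lerD2l.
by rewrite (le_trans _ By)// /dotp (bigD1 i)//= -expr2 lerDl sumr_ge0// => j _; rewrite -expr2 sqr_ge0.
Qed.

End Slices.

(** * The spreading inequality *)

Section Spreading.
Variable R : realType.
Local Notation lebn n := (lebesgue_Rn R n).
Variables (p m : nat).
Hypothesis pm : (p.+2 <= m)%N.
Implicit Types (K L : set 'rV[R]_m.+1) (A : 'M[R]_m.+1) (y z : 'rV[R]_m).

Lemma dotpDZ n (x y : 'rV[R]_n) (s : R) :
  dotp (x + s *: y) (x + s *: y) = dotp x x + 2 * s * dotp x y + s ^+ 2 * dotp y y.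
Proof.
rewrite /dotp !mulr_sumr -!big_split/=; apply: eq_bigr => i _; rewrite !mxE.
by ring.
Qed.

(** The identity used is
    [|l y + (1 - l) z|^2 = l (2 l - 1) |y|^2 + (l - 1) (2 l - 1) |z|^2 - l (l - 1) |y + z|^2]. *)
Lemma eball_homothety (r l : R) y z : 1 <= l -> eball r y -> eball r z ->
  eball ((2 * l - 1) * r) (l *: y + (1 - l) *: z).
Proof.
rewrite /eball/= => l1 yr zr.
have s0 : 0 <= dotp (y + z) (y + z) by exact: dotp_ge0.
have E : dotp (l *: y + (1 - l) *: z) (l *: y + (1 - l) *: z) =
    l * (2 * l - 1) * dotp y y + (l - 1) * (2 * l - 1) * dotp z z -
    l * (l - 1) * dotp (y + z) (y + z).
  rewrite /dotp !mulr_sumr -sumrN -!big_split/=; apply: eq_bigr => i _; rewrite !mxE.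
  by ring.
rewrite E; have l0 : 0 <= l - 1 by rewrite subr_ge0.
have l2 : 0 <= 2 * l - 1 by lra.
have lp : 0 <= l by lra.
have h1 : l * (2 * l - 1) * dotp y y <= l * (2 * l - 1) * r ^+ 2.
  by rewrite ler_wpM2l// mulr_ge0.
have h2 : (l - 1) * (2 * l - 1) * dotp z z <= (l - 1) * (2 * l - 1) * r ^+ 2.
  by rewrite ler_wpM2l// mulr_ge0.
have h3 : 0 <= l * (l - 1) * dotp (y + z) (y + z) by rewrite !mulr_ge0.
rewrite (_ : ((2 * l - 1) * r) ^+ 2 =
  l * (2 * l - 1) * r ^+ 2 + (l - 1) * (2 * l - 1) * r ^+ 2); last by ring.
by lra.
Qed.

Lemma eball_convex (r s : R) y z : 0 <= s <= 1 -> eball r y -> eball r z ->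
  eball r (z + s *: (y - z)).
Proof.
rewrite /eball/= => /andP[s0 s1] yr zr.
have d0 : 0 <= dotp (y - z) (y - z) by exact: dotp_ge0.
have E : dotp (z + s *: (y - z)) (z + s *: (y - z)) =
    s * dotp y y + (1 - s) * dotp z z - s * (1 - s) * dotp (y - z) (y - z).
  rewrite /dotp !mulr_sumr -sumrN -!big_split/=; apply: eq_bigr => i _; rewrite !mxE.
  by ring.
have s2 : 0 <= 1 - s by rewrite subr_ge0.
rewrite E.
have h1 : s * dotp y y <= s * r ^+ 2 by rewrite ler_wpM2l.
have h2 : (1 - s) * dotp z z <= (1 - s) * r ^+ 2 by rewrite ler_wpM2l.
have h3 : 0 <= s * (1 - s) * dotp (y - z) (y - z) by rewrite !mulr_ge0.
rewrite (_ : r ^+ 2 = s * r ^+ 2 + (1 - s) * r ^+ 2); last by ring.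
by lra.
Qed.

Lemma eball0 (r : R) : eball r (0 : 'rV[R]_m).
Proof.
rewrite /eball/= /dotp big1 ?sqr_ge0// => i _.
by rewrite mxE mul0r.
Qed.

Lemma chart_affine y z (s : R) : chart (z + s *: (y - z)) = chart z + s *: (chart y - chart z).
Proof.
have E j (u v : 'rV[R]_m.+1) : (u + s *: (v - u)) ord0 j = u ord0 j + s * (v ord0 j - u ord0 j).
  by rewrite !mxE.
apply/rowP => j; rewrite E /chart; case: (unliftP ord0 j) => [i ->|->].
  by rewrite !Rn_consS !mxE.
by rewrite !Rn_cons0 subrr mulr0 addr0.
Qed.

Lemma continuous_dotp_chart A :
  continuous (fun y => dotp (chart y *m A) (chart y *m A)).
Proof.
move=> y.
exact: (continuous_dotp (@continuous_chart_mulmx R m A) (@continuous_chart_mulmx R m A)).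
Qed.

(** The variational inequality at the point of the ball where the norm of the
    ellipsoid is minimal. *)
Lemma nearest_point A (r : R) : 0 <= r ->
  exists2 z, eball r z &
    forall y, eball r y -> 0 <= dotp (chart z *m A) (chart y *m A - chart z *m A).
Proof.
move=> r0; pose N y := dotp (chart y *m A) (chart y *m A).
have [||z /set_mem Bz Hz] := @compact_EVT_min _ R N (eball r) _ (@compact_eball R m r r0).
- by exists 0; exact: eball0.
- by apply: continuous_subspaceT; exact: continuous_dotp_chart.
exists z => // y By; rewrite leNgt; apply/negP => c0.
set c := dotp _ _ in c0.
pose d := chart y *m A - chart z *m A.
have dd0 : 0 <= dotp d d by exact: dotp_ge0.
have e0 : 0 < dotp d d - c by rewrite subr_gt0 (lt_le_trans c0).
(* The quadratic function [2 * s * c + s ^+ 2 * dotp d d] is negative here. *)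
pose s := - c / (dotp d d - c).
have s0 : 0 < s by rewrite divr_gt0// oppr_gt0.
have s1 : s <= 1 by rewrite ler_pdivrMr// mul1r; lra.
have := Hz (z + s *: (y - z)) _.
rewrite /N chart_affine mulmxDl -scalemxAl mulmxBl -/d dotpDZ -/c.
have Bs : eball r (z + s *: (y - z)) by apply: eball_convex => //; rewrite (ltW s0) s1.
move/(_ (mem_set Bs)); rewrite -addrA lerDl.
have -> : 2 * s * c + s ^+ 2 * dotp d d = s * (2 * c + s * dotp d d) by ring.
rewrite pmulr_rge0// leNgt => /negP; apply.
have : s * (dotp d d - c) = - c by rewrite /s divfK// gt_eqF.
have : 0 <= s * - c by rewrite mulr_ge0 ?(ltW s0)// oppr_ge0 ltW.
by lra.
Qed.

(** With [u] the image of [z] and [d] that of [y - z], the squares to compare are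
    those of [u + l *: d] and [l *: (u + d)], and the mixed product is
    nonnegative. *)
Lemma enorm_chart_homothety A (r l : R) z : 1 <= l ->
  (forall y, eball r y -> 0 <= dotp (chart z *m A) (chart y *m A - chart z *m A)) ->
  forall y, eball r y ->
    enorm (chart (l *: y + (1 - l) *: z) *m A) <= l * enorm (chart y *m A).
Proof.
move=> l1 Hz y By; have l0 : 0 <= l by lra.
rewrite -(ler_pXn2r (n := 2))// ?nnegrE ?enorm_ge0 ?mulr_ge0 ?enorm_ge0//.
rewrite exprMn !enorm_sqr.
have -> : l *: y + (1 - l) *: z = z + l *: (y - z).
  by rewrite scalerBl scalerBr scale1r addrCA.
rewrite chart_affine mulmxDl -scalemxAl mulmxBl.
have := Hz y By; set d := chart y *m A - _ => c0.
have -> : chart y *m A = chart z *m A + 1 *: d by rewrite scale1r addrC subrK.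
rewrite !dotpDZ; set c := dotp _ d in c0 *.
have n0 := dotp_ge0 (chart z *m A).
have h1 : 0 <= (l ^+ 2 - 1) * dotp (chart z *m A) (chart z *m A).
  by rewrite mulr_ge0// subr_ge0 -[leLHS](expr1n _ 2) lerXn2r ?nnegrE.
have h2 : 0 <= l * (l - 1) * c by rewrite !mulr_ge0// subr_ge0.
rewrite -subr_ge0.
have -> : l ^+ 2 * (dotp (chart z *m A) (chart z *m A) + 2 * 1 * c + 1 ^+ 2 * dotp d d) -
  (dotp (chart z *m A) (chart z *m A) + 2 * l * c + l ^+ 2 * dotp d d) =
  (l ^+ 2 - 1) * dotp (chart z *m A) (chart z *m A) + 2 * (l * (l - 1) * c) by ring.
by rewrite addr_ge0// mulr_ge0.
Qed.

(** The homothety of ratio [l] and center [z] divides the [p.+1]-th power of the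
    radial function by at most [l ^+ p.+1] and multiplies volumes by [l ^+ m]. *)
Lemma spreads_ball : spreads p (@unit_ball R m.+1).
Proof.
move=> A r l uA r0 l1; have [z Bz Hz] := nearest_point A (ltW r0).
have l0 : 0 < l by lra.
pose G := chart_power p (@unit_ball R m.+1) A.
have bB := @radial_body_unit_ball R m.+1.
have G0 y : 0 <= G y by apply: chart_power_ge0 => //; exact: bB.1.
have mG (D : set (borelRn R m)) : measurable_fun D (fun y : borelRn R m => (G y)%:E).
  exact: measurable_chart_power.
have GE y : G y = (enorm (chart y *m A))^-1 ^+ p.+1.
  by rewrite /G /chart_power radial_unit_ball//; exact: chart_mulmx_neq0.
have Gl y : eball r y -> G y <= l ^+ p.+1 * G (l *: y + (1 - l) *: z).
  move=> By; rewrite !GE -exprMn lerXn2r ?nnegrE ?mulr_ge0 ?invr_ge0 ?enorm_ge0 ?(ltW l0)//.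
  have e0 u : 0 < enorm (chart u *m A) by rewrite enorm_gt0 chart_mulmx_neq0.
  rewrite ler_pdivlMr// mulrC ler_pdivrMr//.
  exact: enorm_chart_homothety Hz _ By.
rewrite -/G; set r' := (2 * l - 1) * r.
rewrite [leRHS]integral_mkcond.
pose F := (fun y : 'rV[R]_m => (G y)%:E) \_ (eball r').
have F0 y : (0 <= F y)%E by apply: erestrict_ge0 => ? _; rewrite lee_fin.
have mF : measurable_fun setT (F : borelRn R m -> \bar R).
  by apply/(measurable_restrictT _ _).1 => //; exact: measurable_eball.
rewrite (ge0_integral_Rn_affine ((1 - l) *: z) l0 mF F0).
have mB := @measurable_eball R m r.
apply: (@le_trans _ _ ((l ^+ m)%:E * \int[lebn m]_(y in eball r) ((l ^- p.+1)%:E * (G y)%:E))%E).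
  rewrite ge0_integralZl//; last 2 first.
  - by move=> y _; rewrite lee_fin.
  - by rewrite lee_fin invr_ge0 exprn_ge0// ltW.
  rewrite muleA -EFinM lee_wpmul2r//.
    by apply: integral_ge0 => y _; rewrite lee_fin.
  rewrite lee_fin ler_pdivlMr ?exprn_gt0// -exprS.
  by apply: ler_weXn2l.
rewrite lee_wpmul2l ?lee_fin ?exprn_ge0 ?(ltW l0)//.
have mFa := measurableT_comp mF (@measurable_Rn_affine R m l ((1 - l) *: z)).
have c0 : 0 <= l ^- p.+1 by rewrite invr_ge0 exprn_ge0// ltW.
have mH : measurable_fun (eball r : set (borelRn R m)) (fun y => ((l ^- p.+1)%:E * (G y)%:E)%E).
  exact: measurable_funeM.
rewrite integral_mkcond; apply: ge0_le_integral; [exact: measurableT| | |exact: mFa|].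
- by move=> y _; apply: erestrict_ge0 => ? _; rewrite -EFinM lee_fin mulr_ge0.
- exact: (measurable_restrictT _ mB).1 mH.
move=> y _; rewrite /F !patchE; case: ifPn => [/set_mem By|_]; last first.
  by case: ifPn => // _; rewrite lee_fin.
rewrite mem_set; last exact: eball_homothety.
by rewrite -EFinM lee_fin mulrC ler_pdivrMr ?exprn_gt0// mulrC; exact: Gl.
Qed.

Lemma spreads_image K (B : 'M[R]_m.+1) : B \in unitmx -> spreads p K ->
  spreads p ((fun x => x *m B) @` K).
Proof.
move=> uB sK A r l uA r0 l1.
have E : chart_power p ((fun x => x *m B) @` K) A = chart_power p K (A *m invmx B).
  by apply/funext => y; rewrite /chart_power radial_image_mulmx// mulmxA.
by rewrite E; apply: sK => //; rewrite unitmx_mul uA unitmx_inv.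
Qed.

Lemma spreads_sum K1 K2 K : radial_body K1 -> radial_body K2 ->
  spreads p K1 -> spreads p K2 -> is_neg_norm_sum p.+1%:R K1 K2 K -> spreads p K.
Proof.
move=> b1 b2 s1 s2 [sK HK] A r l uA r0 l1.
have bK := star_body_radial_body sK.
have E y : (chart_power p K A y)%:E = ((chart_power p K1 A y)%:E + (chart_power p K2 A y)%:E)%E.
  have x0 := chart_mulmx_neq0 y uA.
  rewrite -EFinD /chart_power -!minkowski_powRN//.
  - by rewrite HK.
  - by case: b2.
  - by case: b1.
  - by case: bK.
have D (r' : R) : (\int[lebn m]_(y in eball r') (chart_power p K A y)%:E =
   \int[lebn m]_(y in eball r') (chart_power p K1 A y)%:E +
   \int[lebn m]_(y in eball r') (chart_power p K2 A y)%:E)%E.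
  under eq_integral do rewrite E.
  apply: ge0_integralD.
  - exact: measurable_eball.
  - by move=> y _; rewrite lee_fin chart_power_ge0//; case: b1.
  - exact: measurable_chart_power.
  - by move=> y _; rewrite lee_fin chart_power_ge0//; case: b2.
  - exact: measurable_chart_power.
rewrite !D ge0_muleDr; last 2 first.
- by apply: integral_ge0 => y _; rewrite lee_fin chart_power_ge0//; case: b1.
- by apply: integral_ge0 => y _; rewrite lee_fin chart_power_ge0//; case: b2.
by apply: leeD; [exact: s1|exact: s2].
Qed.

(** A single unit vector serves all bodies, so that two radial functions can be
    compared at [x]. *)
Lemma radial_sphereE x : x != 0 ->
  exists2 u, unit_sphere u & forall K, starlike K -> radial K x = radial K u / enorm x.
Proof.
move=> x0; have e0 : 0 < enorm x by rewrite enorm_gt0.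
exists ((enorm x)^-1 *: x).
  by rewrite /unit_sphere/= enormZ ger0_norm ?invr_ge0 ?enorm_ge0// mulVf// gt_eqF.
by move=> K sK; rewrite radialZ// ?invr_gt0// invrK mulfK// gt_eqF.
Qed.

Lemma radial_dist_enorm K L x : starlike K -> starlike L -> x != 0 ->
  `|radial K x - radial L x| <= radial_dist K L / enorm x.
Proof.
move=> sK sL x0; have [u Su E] := radial_sphereE x0.
rewrite !E// -mulrBl normrM normfV (ger0_norm (enorm_ge0 x)).
by rewrite ler_wpM2r ?invr_ge0 ?enorm_ge0//; exact: radial_dist_ub.
Qed.

(** The radial functions converge pointwise off the origin. They are uniformly
    bounded on the compact image of the ball, which avoids the origin. *)
Lemma cvg_integral_chart_power (K_ : nat -> set 'rV[R]_m.+1) L A (r : R) :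
  0 <= r -> A \in unitmx -> (forall i, radial_body (K_ i)) -> radial_body L ->
  radial_dist (K_ i) L @[i --> \oo] --> 0 ->
  (\int[lebn m]_(y in eball r) (chart_power p (K_ i) A y)%:E)%E @[i --> \oo] -->
  (\int[lebn m]_(y in eball r) (chart_power p L A y)%:E)%E.
Proof.
move=> r0 uA bK bL cK.
have [M [_ HM]] := cvg_seq_bounded (cvgP _ cK).
have dM i : radial_dist (K_ i) L <= `|M| + 1.
  apply: le_trans (ler_norm _) _; apply: (HM (`|M| + 1) _ i I).
  by rewrite (le_lt_trans (ler_norm M))// ltrDl.
have [N N0 HN] := radial_sphere_bounded bL.1.
have [||z /set_mem Bz Hz] := @compact_EVT_min _ R (fun y => enorm (chart y *m A)) (eball r) _ (@compact_eball R m r r0).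
- by exists 0; exact: eball0.
- apply: continuous_subspaceT => y.
  apply: (@continuous_comp _ _ _ (fun y => chart y *m A) (@enorm R _) y).
    exact: continuous_chart_mulmx.
  exact: continuous_enorm.
set a := enorm _ in Hz.
have a0 : 0 < a by rewrite enorm_gt0 chart_mulmx_neq0.
pose C := ((`|M| + 1 + N) / a) ^+ p.+1.
have C0 : 0 <= `|M| + 1 + N by rewrite !addr_ge0// ltW.
have radL x : x != 0 -> radial L x <= N / enorm x.
  move=> x0; have e0 : 0 < enorm x by rewrite enorm_gt0.
  have [u Su ->] := radial_sphereE x0; last by case: bL.
  by rewrite ler_wpM2r ?invr_ge0 ?(ltW e0)//; exact: HN.
have cvg y : eball r y ->
    (chart_power p (K_ i) A y)%:E @[i --> \oo] --> (chart_power p L A y)%:E.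
  move=> _; apply: cvg_EFin; first by near=> i.
  rewrite /= /chart_power.
  have x0 := chart_mulmx_neq0 y uA.
  apply: (@cvg_comp _ _ _ (fun i => radial (K_ i) (chart y *m A)) (fun t => t ^+ p.+1) _ (nbhs (radial L (chart y *m A)))); last exact: exprn_continuous.
  apply/cvgrPdist_le => e e0.
  have e1 : 0 < e * enorm (chart y *m A) by rewrite mulr_gt0 ?enorm_gt0.
  near=> i; rewrite distrC (le_trans (radial_dist_enorm (bK i).1 bL.1 x0))//.
  rewrite ler_pdivrMr ?enorm_gt0//; apply: ltW; near: i.
  by apply: (cvgr_lt 0).
have iC : (lebn m).-integrable (eball r) (fun=> C%:E).
  apply/integrableP; split; first exact: measurable_cst.
  rewrite integral_cst; last exact: measurable_eball.
  by rewrite lte_mul_pinfty// ?eball_finite// ?abse_fin_num.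
have le_C y i : eball r y -> (`|(chart_power p (K_ i) A y)%:E| <= C%:E)%E.
  move=> By; rewrite gee0_abs ?lee_fin; last by apply: chart_power_ge0 => //; case: (bK i).
  have x0 := chart_mulmx_neq0 y uA.
  rewrite /C /chart_power lerXn2r ?nnegrE ?divr_ge0 ?(ltW a0) ?(radial_ge0 (bK i).1 x0)//.
  have e0 : 0 < enorm (chart y *m A) by rewrite enorm_gt0.
  apply: (@le_trans _ _ ((`|M| + 1 + N) / enorm (chart y *m A))).
    rewrite mulrDl -lerBlDr; apply: (@le_trans _ _ (radial_dist (K_ i) L / enorm (chart y *m A))).
      apply: le_trans (le_trans (ler_norm _) (radial_dist_enorm (bK i).1 bL.1 x0)).
      by rewrite lerB// radL.
    by rewrite ler_wpM2r ?invr_ge0 ?(ltW e0).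
  by rewrite ler_wpM2l// lef_pV2// ?posrE//; apply: Hz; exact: mem_set.
have ae_cvg : {ae lebn m, forall y, eball r y ->
    (chart_power p (K_ i) A y)%:E @[i --> \oo] --> (chart_power p L A y)%:E}.
  by apply: aeW => y; exact: cvg.
have ae_le : {ae lebn m, forall y, forall i, eball r y ->
    (`|(chart_power p (K_ i) A y)%:E| <= C%:E)%E}.
  by apply: aeW => y i; exact: le_C.
by have [] := @dominated_convergence _ _ _ (lebn m) (eball r) (@measurable_eball R m r)
  (fun i (y : borelRn R m) => (chart_power p (K_ i) A y)%:E)
  (fun y : borelRn R m => (chart_power p L A y)%:E) (fun=> C%:E)
  (fun i => measurable_chart_power p uA (bK i)) (measurable_chart_power p uA bL)
  ae_cvg iC ae_le.
Unshelve. all: by end_near. Qed.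

Lemma spreads_lim (K_ : nat -> set 'rV[R]_m.+1) L :
  (forall i, radial_body (K_ i)) -> radial_body L -> (forall i, spreads p (K_ i)) ->
  radial_dist (K_ i) L @[i --> \oo] --> 0 -> spreads p L.
Proof.
move=> bK bL sK cK A r l uA r0 l1.
have r'0 : 0 <= (2 * l - 1) * r by rewrite mulr_ge0 ?(ltW r0)//; lra.
have c1 := cvg_integral_chart_power (ltW r0) uA bK bL cK.
have c2 := cvg_integral_chart_power r'0 uA bK bL cK.
have c3 := @cvgeZl _ _ _ _ _ l%:E isT c1.
by apply: lee_cvg_to c3 c2 _; near=> i; exact: sK.
Unshelve. all: by end_near. Qed.

(** The sum is the case in which the exponent of the class matters: the integrands
    of [spreads] are the powers that are added. *)
Lemma Dneg_spreads K : Dneg p.+1%:R K -> spreads p K.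
Proof.
elim=> [|{}K A DK IH uA|L1 L2 L D1 s1 D2 s2 sL|K_ L D sK sL cK].
- exact: spreads_ball.
- exact: spreads_image.
- by apply: spreads_sum s1 s2 sL; exact: Dneg_radial_body D1 || exact: Dneg_radial_body D2.
- apply: spreads_lim cK => //; last exact: star_body_radial_body.
  by move=> i; exact: Dneg_radial_body (D i).
Qed.

End Spreading.

(** * The quartic body *)

Section QuarticBody.
Variable R : realType.
Variables (p m : nat).
Hypothesis p_gt0 : (0 < p)%N.
Implicit Types (x : 'rV[R]_m.+1) (y : 'rV[R]_m).

Definition quadratic x : R := p.+3%:R * x ord0 ord0 ^+ 2 - 3 * dotp x x.

(** The square of a form of degree 2 against the power of the norm that makes the
    quotient homogeneous of degree [- p.+1]. The body reduces to the origin along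
    the cone on which [quadratic] vanishes. *)
Definition quartic_body : set 'rV[R]_m.+1 :=
  [set x | enorm x ^+ (p + 5) <= quadratic x ^+ 2].

Lemma quadraticZ (t : R) x : quadratic (t *: x) = t ^+ 2 * quadratic x.
Proof. by rewrite /quadratic dotpZ mxE exprMn; ring. Qed.

Let continuousX (T : topologicalType) (f : T -> R) (z : T) k :
  {for z, continuous f} -> {for z, continuous (fun z => f z ^+ k)}.
Proof.
move=> cf; apply: (@continuous_comp _ _ _ f (fun t => t ^+ k) z cf).
exact: exprn_continuous.
Qed.

Lemma continuous_quadratic : continuous quadratic.
Proof.
move=> x; rewrite /quadratic.
have c0 : {for x, continuous (fun x : 'rV[R]_m.+1 => x ord0 ord0)}.
  exact: coord_continuous.
have cd : {for x, continuous (fun x : 'rV[R]_m.+1 => dotp x x)}.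
  by apply: continuous_dotp => z; exact: cvg_id.
apply: (@continuousB _ _ _ (fun x => p.+3%:R * x ord0 ord0 ^+ 2) (fun x => 3 * dotp x x) x).
  apply: (@continuousM _ _ (cst p.+3%:R) (fun x => x ord0 ord0 ^+ 2) x).
    exact: cst_continuous.
  exact: (continuousX c0).
apply: (@continuousM _ _ (cst 3) (fun x => dotp x x) x); last exact: cd.
exact: cst_continuous.
Qed.

Lemma continuous_quadratic_sqr : continuous (fun x => quadratic x ^+ 2).
Proof. by move=> x; apply: continuousX; exact: continuous_quadratic. Qed.

Lemma continuous_enormX k : continuous (fun x => enorm x ^+ k).
Proof. by move=> x; apply: continuousX; exact: continuous_enorm. Qed.

Let continuous_quartic_gap : continuous (fun x => quadratic x ^+ 2 - enorm x ^+ (p + 5)).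
Proof.
move=> x.
apply: (@continuousB _ _ _ (fun x => quadratic x ^+ 2) (fun x => enorm x ^+ (p + 5)) x).
  exact: continuous_quadratic_sqr.
exact: continuous_enormX.
Qed.

Lemma quadratic_bound x : `|quadratic x| <= (p + 6)%:R * enorm x ^+ 2.
Proof.
have x0 : x ord0 ord0 ^+ 2 <= enorm x ^+ 2.
  by rewrite -real_normK ?num_real// lerXn2r ?nnegrE ?enorm_ge0//; exact: coord_le_enorm.
rewrite /quadratic (le_trans (ler_normB _ _))// (normrM p.+3%:R) (normrM 3) !normr_nat.
rewrite -enorm_sqr !(ger0_norm (sqr_ge0 _)).
rewrite (_ : (p + 6)%:R = p.+3%:R + 3 :> R); last by rewrite -(natrD _ p.+3 3) -[p.+3]addn3 -addnA.
by rewrite [leRHS]mulrDl; apply: lerD; rewrite ?ler_wpM2l ?enorm_ge0.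
Qed.

(** Divide by [r ^+ 4]; for [r = 0] both sides hold. *)
Lemma quartic_bodyP x (r : R) : x != 0 -> 0 <= r ->
  quartic_body (r *: x) <-> r ^+ p.+1 <= cone_gauge p x.
Proof.
move=> x0 r0; have e0 : 0 < enorm x ^+ (p + 5) by rewrite exprn_gt0// enorm_gt0.
have g0 : 0 <= cone_gauge p x by rewrite divr_ge0 ?sqr_ge0// ltW.
rewrite /quartic_body/= enormZ quadraticZ ger0_norm//.
have [->|rn0] := eqVneq r 0.
  split=> _; first by rewrite expr0n.
  by rewrite mul0r expr0n addnS/= expr0n mul0r expr0n.
have r4 : 0 < r ^+ 4 by rewrite exprn_gt0// lt_def rn0.
rewrite exprMn [(r ^+ 2 * _) ^+ 2]exprMn -exprM.
have -> : r ^+ (p + 5) = r ^+ 4 * r ^+ p.+1 by rewrite -exprD addnC -addSnnS.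
by rewrite -mulrA ler_pM2l// /cone_gauge ler_pdivlMr.
Qed.

Lemma quartic_body0 : quartic_body 0.
Proof.
rewrite /quartic_body/= (_ : enorm 0 = 0); last by apply/eqP; rewrite enorm_eq0.
by rewrite expr0n addnS/= sqr_ge0.
Qed.

Lemma quartic_body_star (t : R) x : 0 <= t <= 1 -> quartic_body x -> quartic_body (t *: x).
Proof.
move=> /andP[t0 t1]; rewrite /quartic_body/= enormZ quadraticZ ger0_norm// => Kx.
rewrite exprMn exprMn -exprM ler_pM ?exprn_ge0 ?enorm_ge0//.
by apply: ler_wiXn2l => //; apply: leq_trans (leq_addl p 5).
Qed.

Lemma quartic_body_enorm x : quartic_body x -> enorm x <= (p + 6)%:R ^+ 2.
Proof.
rewrite /quartic_body/= => Kx.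
have c1 : 1 <= (p + 6)%:R ^+ 2 :> R by rewrite exprn_ege1// ler1n addn_gt0 orbT.
have [e1|/ltW e1] := leP (enorm x) 1; first exact: le_trans c1.
have e0 : 0 < enorm x by rewrite (lt_le_trans ltr01).
have : enorm x ^+ (p + 5) <= (p + 6)%:R ^+ 2 * enorm x ^+ 4.
  apply: (le_trans Kx); rewrite -real_normK ?num_real//.
  rewrite [X in _ * X](_ : _ = (enorm x ^+ 2) ^+ 2); last by rewrite -exprM.
  by rewrite -exprMn lerXn2r ?nnegrE ?mulr_ge0 ?enorm_ge0//; exact: quadratic_bound.
rewrite (addnS p 4) -addSn exprD ler_pM2r ?exprn_gt0// => H.
by apply: le_trans H; apply: ler_eXnr.
Qed.

Lemma compact_quartic_body : compact quartic_body.
Proof.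
apply: bounded_closed_compact.
  exists ((p + 6)%:R ^+ 2); split; first exact: num_real.
  move=> M rM y By; apply: le_trans (mx_norm_le_enorm y) _; apply: le_trans _ (ltW rM).
  exact: quartic_body_enorm.
rewrite (_ : quartic_body = (fun x => quadratic x ^+ 2 - enorm x ^+ (p + 5)) @^-1` [set t | 0 <= t]).
  apply: closed_comp; last exact: closed_ge.
  by move=> x _; apply: continuous_quartic_gap.
by apply/seteqP; split => x; rewrite /quartic_body/= subr_ge0.
Qed.

Lemma starlike_quartic_body : starlike quartic_body.
Proof.
split; [exact: compact_quartic_body|exact: quartic_body0|].
by move=> t x; exact: quartic_body_star.
Qed.

Lemma radial_quartic_body x : x != 0 -> radial quartic_body x ^+ p.+1 = cone_gauge p x.
Proof.
move=> x0; have sK := starlike_quartic_body; have r0 := radial_ge0 sK x0.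
have g0 : 0 <= cone_gauge p x by rewrite divr_ge0 ?sqr_ge0// exprn_ge0// enorm_ge0.
apply/eqP; rewrite eq_le; apply/andP; split.
  by apply/quartic_bodyP => //; exact: radial_mem.
pose s := cone_gauge p x `^ p.+1%:R^-1.
have s0 : 0 <= s by exact: powR_ge0.
have sp : s ^+ p.+1 = cone_gauge p x.
  by rewrite -powR_mulrn// /s -powRrM mulVf ?pnatr_eq0// powRr1.
by rewrite -sp lerXn2r ?nnegrE//; apply/(radialP sK x0 s0)/quartic_bodyP => //; rewrite sp.
Qed.

Lemma exprn_superadditive (a b : R) k : 0 <= a -> 0 <= b ->
  a ^+ k.+1 + b ^+ k.+1 <= (a + b) ^+ k.+1.
Proof.
move=> a0 b0; elim: k => [|k IH]; first by rewrite !expr1.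
rewrite [leRHS]exprS; apply: (@le_trans _ _ ((a + b) * (a ^+ k.+1 + b ^+ k.+1))).
  rewrite mulrDl !mulrDr -!exprS -addrA lerD2l addrA lerDr.
  by rewrite addr_ge0// mulr_ge0// exprn_ge0.
by rewrite ler_wpM2l// addr_ge0.
Qed.

Lemma dist_exprn_le (a b : R) k : 0 <= a -> 0 <= b ->
  `|a - b| ^+ k.+1 <= `|a ^+ k.+1 - b ^+ k.+1|.
Proof.
move=> a0 b0; wlog ba : a b a0 b0 / b <= a => [H|].
  have [ba|/ltW ab] := leP b a; first exact: H.
  by rewrite distrC (distrC (a ^+ _)); exact: H.
rewrite !ger0_norm ?subr_ge0//; last by rewrite lerXn2r.
by rewrite lerBrDr (le_trans (exprn_superadditive _ _ _))// ?subr_ge0// subrK.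
Qed.

(** Continuity of a root, including at the zeros: by [dist_exprn_le] the root is
    uniformly continuous. *)
Lemma continuous_radial_quartic_body x : x != 0 ->
  {for x, continuous (radial quartic_body)}.
Proof.
move=> x0; have sK := starlike_quartic_body.
have cg : {for x, continuous (fun x : 'rV[R]_m.+1 => cone_gauge p x)}.

  apply: (@continuousM _ _ (fun x => quadratic x ^+ 2) (fun x => (enorm x ^+ (p + 5))^-1) x).
    exact: continuous_quadratic_sqr.
  apply: continuousV; last exact: continuous_enormX.
  by rewrite expf_neq0// enorm_eq0.
apply/(@cvgrPdist_lt _ _ _ (nbhs x)) => e e0.
have ek : 0 < e ^+ p.+1 by rewrite exprn_gt0.
have /(@cvgrPdist_lt _ _ _ (nbhs x))/(_ _ ek) Hg := cg.
near=> y; have y0 : y != 0 by near: y; exact: near_neq0.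
rewrite -(ltr_pXn2r (n := p.+1)) ?nnegrE ?(ltW e0)//.
apply: le_lt_trans (dist_exprn_le _ (radial_ge0 sK x0) (radial_ge0 sK y0)) _.
by rewrite !radial_quartic_body//; near: y; exact: Hg.
Unshelve. all: by end_near. Qed.

Lemma dotp_chart y : dotp (chart y) (chart y) = 1 + dotp y y.
Proof.
rewrite dotp_recl /chart Rn_cons0 mulr1; congr (_ + dotp _ _);
  by apply/rowP => i; rewrite mxE Rn_consS.
Qed.

Lemma quadratic_chart y : quadratic (chart y) = p%:R - 3 * dotp y y.
Proof.
rewrite /quadratic dotp_chart /chart Rn_cons0 expr1n mulr1 -[p.+3]addn3 natrD.
by ring.
Qed.

Lemma quadraticN x : quadratic (- x) = quadratic x.
Proof. by rewrite -scaleN1r quadraticZ sqrrN expr1n mul1r. Qed.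

Lemma enormN x : enorm (- x) = enorm x.
Proof. by rewrite -scaleN1r enormZ normrN1 mul1r. Qed.

Lemma quartic_bodyN x : quartic_body (- x) = quartic_body x.
Proof. by rewrite /quartic_body/= enormN quadraticN. Qed.

(** Half of the head basis vector is an interior point, where
    [quadratic] has the value [p / 4]. *)
Lemma star_body_quartic_body : star_body quartic_body.
Proof.
split.
- split; first exact: compact_quartic_body.
  exists (2^-1 *: chart 0); rewrite /interior/=.
  pose F x := quadratic x ^+ 2 - enorm x ^+ (p + 5).
  have cF : {for (2^-1 *: chart 0), continuous F}.
    by apply: continuous_quartic_gap.
  have d0 : dotp (0 : 'rV[R]_m) 0 = 0.
    by rewrite /dotp big1// => i _; rewrite mxE mul0r.
  have F0 : 0 < F (2^-1 *: chart 0).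
    rewrite /F quadraticZ quadratic_chart d0 mulr0 subr0 enormZ.
    have -> : enorm (chart (0 : 'rV[R]_m)) = 1 by rewrite /enorm dotp_chart d0 addr0 sqrtr1.
    rewrite mulr1 subr_gt0 ger0_norm ?invr_ge0// exprMn -exprM.
    have h4 : 0 < 2^-1 ^+ 4 :> R by rewrite exprn_gt0// invr_gt0.
    rewrite (addnS p 4) -addSn exprD mulrC ltr_pM2l//.
    apply: (@lt_le_trans _ _ 1); last by rewrite exprn_ege1// ler1n.
    by rewrite exprn_ilt1 ?invr_ge0// invf_lt1// ltr1n.
  near=> x; rewrite /quartic_body/= -subr_ge0 ltW//.
  by near: x; apply: (cvgr_gt (F (2^-1 *: chart 0))).
- apply/seteqP; split=> [x Kx|_ [x Kx <-]]; last by rewrite quartic_bodyN.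
  by exists (- x); rewrite ?opprK// quartic_bodyN.
- by move=> t t01 _ [x Kx <-]; exact: quartic_body_star.
- apply: continuous_in_subspaceT => x /set_mem Sx.
  by apply: continuous_radial_quartic_body; rewrite -enorm_gt0 Sx.
- move=> x _; congr sup; apply/seteqP; split=> r [r0 Kr]; split=> //.
    by rewrite -quartic_bodyN -scalerN.
  by rewrite scalerN quartic_bodyN.
Unshelve. all: by end_near. Qed.

End QuarticBody.

(** * Embedding and exclusion *)

Section Embedding.
Variable R : realType.
Variables (p m : nat).
Hypotheses (p_gt0 : (0 < p)%N) (pm : (p < m)%N).

Lemma minkowski0 n (K : set 'rV[R]_n) : K 0 -> Defs.minkowski K 0 = 0.
Proof.
move=> K0; apply/eqP; rewrite eq_le; apply/andP; split.
  by apply: ge_inf; [exists 0 => t []|split=> //; exists 0 => //; rewrite scaler0].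
by apply: lb_le_inf => [|t []//]; exists 0; split=> //; exists 0 => //; rewrite scaler0.
Qed.

Lemma minkowski_quartic_body (x : 'rV[R]_m.+1) :
  Defs.minkowski (quartic_body p (m := m)) x `^ (- p.+1%:R) = cone_gauge p x.
Proof.
have [->|x0] := eqVneq x 0; last first.
  by rewrite minkowski_powRN ?radial_quartic_body//; exact: starlike_quartic_body.
rewrite minkowski0; last exact: quartic_body0.
rewrite powR0 ?oppr_eq0 ?pnatr_eq0// /cone_gauge (_ : enorm 0 = 0).
  by rewrite expr0n addnS invr0 mulr0.
by apply/eqP; rewrite enorm_eq0.
Qed.

(** The inner integral of the embedding is real-valued, and thus the finite part
    of [radial_cosint]; the two agree almost everywhere for the measure on the
    sphere because [radial_cosint] is integrable. *)
Lemma SLneg_quartic_body : SLneg p.+1%:R (quartic_body p (m := m) : set 'rV[R]_m.+1).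
Proof.
split; first exact: star_body_quartic_body.
exists (sphere_measure R p m); first exact: sphere_measureC.
move=> f [sf rf _].
transitivity (\int[lebesgue_Rn R m.+1]_x (cone_gauge p x * f x)%:E)%E.
  by apply: eq_integral => x _; rewrite minkowski_quartic_body.
rewrite -integral_sphere_measure//.
have mS := @measurable_unit_sphere R m.
have ig := @integrable_radial_cosint R p m pm p_gt0 f (conj sf rf).
have E (x : 'rV[R]_m.+1) : (\int[lebesgue_measure]_(t in `]0, +oo[)
    (t `^ (p.+1%:R - 1) * complex.Re (fourier f (t *: x))))%R = fine (radial_cosint p f x).
  transitivity (\int[lebesgue_measure]_(s in `]0%R, +oo[) (s ^+ p * cosint f (s *: x)))%R.
    apply: eq_Rintegral => t; rewrite Re_fourier inE/= in_itv/= andbT => t0.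
    by rewrite -natr1 addrK powR_mulrn// ltW.
  by rewrite /Rintegral integral_posX.
under [RHS]eq_integral do rewrite E.
apply: ae_eq_integral => //.
- exact: measurable_int ig.
- apply/measurable_EFinP.
  exact: measurableT_comp (fine_measurable measurableT) (measurable_int _ ig).
have := integrable_ae mS ig; apply: filterS => x /= fx Sx.
by rewrite fineK// fx.
Qed.

End Embedding.

Section Exclusion.
Variable R : realType.
Local Notation leb := (@lebesgue_measure R).
Local Notation lebn n := (lebesgue_Rn R n).

Lemma integral_cube_gt0 n (a : R) : 0 < a ->
  (0 < \int[lebn n]_x (\prod_(i < n) (\1_(`[- a, a] : set R) ((x : 'rV[R]_n) ord0 i)))%:E)%E.
Proof.
move=> a0.
have m1 : measurable_fun setT (\1_(`[- a, a] : set R) : R -> R) by exact: measurable_indic.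
have mP j : measurable_fun setT
    ((fun x => \prod_(i < j) \1_(`[- a, a] : set R) ((x : 'rV[R]_j) ord0 i)) : borelRn R j -> R).
  by apply: measurable_prod => i _; exact: (measurableT_comp m1 (measurable_coord i)).
elim: n => [|n IH].
  rewrite integral_Rn0; last by apply/measurable_EFinP; exact: mP.
  by rewrite big_ord0 lte_fin.
under eq_integral do rewrite big_ord_recl.
have E := @ge0_integral_Rn_tensor R n (\1_(`[- a, a] : set R))
  (fun x => \prod_(i < n) \1_(`[- a, a] : set R) (x ord0 i)) m1 (mP n) _ _.
have {}E : (\int[lebn n.+1]_x (\1_(`[- a, a] : set R) ((x : 'rV[R]_n.+1) ord0 ord0) *
    \prod_(i < n) \1_(`[- a, a] : set R) ((x : 'rV[R]_n.+1) ord0 (lift ord0 i)))%:E =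
  \int[leb]_t (\1_(`[- a, a] : set R) t)%:E *
  \int[lebn n]_x (\prod_(i < n) (\1_(`[- a, a] : set R) ((x : 'rV[R]_n) ord0 i)))%:E)%E.
  rewrite -E//; last by move=> x; exact: prodr_ge0.
  apply: eq_integral => x _; congr (_ * _)%:E.
  by apply: eq_bigr => i _; rewrite mxE.
have L : (\int[leb]_t (\1_(`[- a, a] : set R) t)%:E)%E = leb `[- a, a]%classic.
  by rewrite integral_indic// setIT.
have a2 : - a < a by rewrite gtrN.
rewrite E L lebesgue_measure_itv/= lte_fin a2 -EFinD opprK.
by apply: mule_gt0 IH; rewrite lte_fin addr_gt0.
Qed.

(** A ball contains a cube. *)
Lemma eball_gt0 n (r : R) : 0 < r -> (0 < lebn n (eball r))%E.
Proof.
move=> r0; pose a := r / n.+1%:R; have a0 : 0 < a by rewrite divr_gt0.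
apply: lt_le_trans (integral_cube_gt0 n a0) _.
have mB := @measurable_eball R n r.
rewrite (_ : lebn n (eball r) = \int[lebn n]_y (\1_(eball r : set (borelRn R n)) y)%:E)%E; last first.
  by rewrite integral_indic// setIT.
apply: ge0_le_integral => //.
- by move=> x _; rewrite lee_fin prodr_ge0.
- apply/measurable_EFinP; apply: measurable_prod => i _.
  apply: (measurableT_comp _ (measurable_coord i)); exact: measurable_indic.
- by apply/measurable_EFinP; exact: measurable_indic.
move=> x _; rewrite lee_fin [leRHS]indicE; have [_|xB] := boolP (_ \in _).
  by apply: prodr_ile1 => i _; rewrite indicE; case: (_ \in _); rewrite ?ler01 ?lexx.
have [/existsP[i xi]|/existsPn H] := boolP [exists i, (x : 'rV[R]_n) ord0 i \notin `[- a, a]].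
  by rewrite (bigD1 i)//= indicE mem_setE (negbTE xi) mul0r.
move: xB; rewrite notin_setE; case; rewrite /eball/=.
apply: (@le_trans _ _ (\sum_(i < n) a ^+ 2)).
  apply: ler_sum => i _; rewrite -expr2 -real_normK ?num_real// lerXn2r ?nnegrE ?(ltW a0)//.
  by have := H i; rewrite negbK in_itv/= -ler_norml.
rewrite sumr_const card_ord -mulr_natl /a expr_div_n mulrA ler_pdivrMr ?exprn_gt0//.
rewrite mulrC ler_wpM2l ?sqr_ge0// -natrX ler_nat (leq_trans (leqnSn n))//.
by rewrite expnS leq_pmulr.
Qed.

Section Slice.
Variables (p m : nat).
Implicit Type y : 'rV[R]_m.
Hypothesis p_gt0 : (0 < p)%N.

Let K : set 'rV[R]_m.+1 := quartic_body p (m := m).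
Let G (y : 'rV[R]_m) : R := chart_power p K 1%:M y.

Let G_def y : G y = (p%:R - 3 * dotp y y) ^+ 2 / enorm (chart y) ^+ (p + 5).
Proof.
by rewrite /G /chart_power mulmx1 radial_quartic_body ?chart_neq0// -quadratic_chart.
Qed.

Let enorm_chart_ge1 y : 1 <= enorm (chart y) :> R.
Proof.
rewrite -(ler_pXn2r (n := 2))// ?nnegrE ?enorm_ge0// enorm_sqr dotp_chart expr1n.
by rewrite lerDl dotp_ge0.
Qed.

Let G_le y : G y <= (p%:R - 3 * dotp y y) ^+ 2.
Proof.
have e1 : 1 <= enorm (chart y) ^+ (p + 5) by rewrite exprn_ege1.
by rewrite G_def ler_pdivrMr ?(lt_le_trans ltr01)// ler_peMr ?sqr_ge0.
Qed.

Let G_ge0 y : 0 <= G y.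
Proof. by rewrite G_def divr_ge0 ?sqr_ge0// exprn_ge0// enorm_ge0. Qed.

Let mG (D : set (borelRn R m)) : measurable_fun D (fun y : borelRn R m => (G y)%:E).
Proof.
apply: measurable_chart_power; first exact: unitmx1.
exact/star_body_radial_body/star_body_quartic_body.
Qed.

(** The radius at which the numerator of [G] vanishes. *)
Let r : R := Num.sqrt (p%:R / 3).

Let p_gt0R : 0 < p%:R :> R. Proof. by rewrite ltr0n. Qed.

Let r_gt0 : 0 < r. Proof. by rewrite sqrtr_gt0 divr_gt0. Qed.

Let r_sqr : 3 * r ^+ 2 = p%:R.
Proof. by rewrite sqr_sqrtr ?divr_ge0// mulrC divfK. Qed.

Let I := (\int[lebn m]_(y in eball r) (G y)%:E)%E.

Let I_fin : (I < +oo)%E.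
Proof.
have mB := @measurable_eball R m r.
apply: (@le_lt_trans _ _ (\int[lebn m]_(y in eball r) (p%:R ^+ 2)%:E)%E).
  apply: ge0_le_integral => //.
  - by move=> y _; rewrite lee_fin.
  - move=> y By; rewrite lee_fin (le_trans (G_le y))//.
    have d0 := dotp_ge0 y; have d1 : 3 * dotp y y <= p%:R by rewrite -r_sqr ler_wpM2l.
    by rewrite lerXn2r ?nnegrE ?subr_ge0// lerBlDr lerDl mulr_ge0.
by rewrite integral_cst// lte_mul_pinfty ?lee_fin ?sqr_ge0// eball_finite.
Qed.

Let I_gt0 : (0 < I)%E.
Proof.
have mB := @measurable_eball R m.
pose c : R := (3 / 4 * p%:R) ^+ 2 / (1 + p%:R) ^+ (p + 5).
have c0 : 0 < c by rewrite divr_gt0 ?exprn_gt0 ?mulr_gt0 ?divr_gt0// addr_gt0.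
apply: (@lt_le_trans _ _ (\int[lebn m]_(y in eball (r / 2)) c%:E)%E).
  by rewrite integral_cst// mule_gt0// eball_gt0// divr_gt0.
have half y : eball (r / 2) y -> 3 * dotp y y <= p%:R / 4.
  rewrite /eball/= expr_div_n -r_sqr (_ : 2 ^+ 2 = 4); last by rewrite -natrX.
  by move=> ?; rewrite -mulrA ler_wpM2l.
apply: (@le_trans _ _ (\int[lebn m]_(y in eball (r / 2)) (G y)%:E)%E).
  apply: ge0_le_integral => //.
  - by move=> y _; rewrite lee_fin ltW.
  move=> y By; have := half y By; have := dotp_ge0 y; rewrite lee_fin G_def => d0 d1.
  apply: ler_pM.
  - exact: sqr_ge0.
  - by rewrite invr_ge0 exprn_ge0// addr_ge0.
  - by rewrite lerXn2r ?nnegrE ?mulr_ge0 ?divr_ge0//; lra.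
  have e0 : 0 < enorm (chart y) by rewrite (lt_le_trans ltr01).
  rewrite lef_pV2 ?posrE ?exprn_gt0 ?addr_gt0// lerXn2r ?nnegrE ?enorm_ge0 ?addr_ge0//.
  rewrite -(ler_pXn2r (n := 2))// ?nnegrE ?enorm_ge0 ?addr_ge0// enorm_sqr dotp_chart.
  apply: (@le_trans _ _ (1 + p%:R)); first by lra.
  by apply: ler_eXnr => //; rewrite lerDl.
apply: ge0_subset_integral => //; first by move=> y _; rewrite lee_fin.
move=> y; rewrite /eball/= => /le_trans; apply.
by rewrite lerXn2r ?nnegrE ?divr_ge0 ?(ltW r_gt0)// ler_pdivrMr// ler_peMr ?(ltW r_gt0) ?ler1n.
Qed.

(** Where [3 * dotp y y] lies between [p] and [(1 + 2 * e) ^+ 2 * p], it differs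
    from [p] by at most [8 * p * e]. *)
Let annulus (e : R) y : 0 <= e <= 1 -> eball ((2 * (1 + e) - 1) * r) y -> ~ eball r y ->
  G y <= 64 * p%:R ^+ 2 * e ^+ 2.
Proof.
move=> /andP[e0 e1] By /negP; rewrite /eball/= -ltNge => rN.
have p3 : p%:R <= 3 * dotp y y by rewrite -r_sqr ler_wpM2l// ltW.
have N3 : 3 * dotp y y - p%:R <= 8 * p%:R * e.
  have : 3 * dotp y y <= 3 * ((2 * (1 + e) - 1) * r) ^+ 2 by rewrite ler_wpM2l.
  rewrite exprMn mulrCA r_sqr => H.
  have : p%:R * e * e <= p%:R * e * 1 by rewrite ler_wpM2l// mulr_ge0.
  by move: H; rewrite expr2; lra.
apply: (le_trans (G_le y)); rewrite -sqrrN opprB.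
rewrite (_ : 64 * p%:R ^+ 2 * e ^+ 2 = (8 * p%:R * e) ^+ 2); last by ring.
by rewrite lerXn2r ?nnegrE ?mulr_ge0// subr_ge0.
Qed.

Let integral_annulus (e : R) : 0 <= e <= 1 ->
  (\int[lebn m]_(y in eball ((2 * (1 + e) - 1) * r)) (G y)%:E <=
   I + (64 * p%:R ^+ 2 * e ^+ 2)%:E * lebn m (eball (3 * r)))%E.
Proof.
move=> e01; have /andP[e0 e1] := e01; set r' := _ * r; set c := 64 * _ * _.
have mB := @measurable_eball R m.
have c0 : 0 <= c by rewrite !mulr_ge0 ?sqr_ge0.
have rr' : eball r `<=` (eball r' : set 'rV[R]_m).
  move=> y; rewrite /eball/= => /le_trans; apply.
  rewrite lerXn2r ?nnegrE ?mulr_ge0 ?(ltW r_gt0)//; first by lra.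
  by rewrite /r' ler_peMl ?(ltW r_gt0)//; lra.
have mGr : measurable_fun (eball r' : set (borelRn R m)) ((fun y => (G y)%:E) \_ (eball r)).
  by apply: measurable_funTS; apply/(measurable_restrictT _ _).1.
apply: (@le_trans _ _ (\int[lebn m]_(y in eball r') (((fun y => (G y)%:E) \_ (eball r)) y + c%:E))%E).
  apply: ge0_le_integral; [exact: mB|by move=> y _; rewrite lee_fin|exact: mG| |].
    by apply: emeasurable_funD => //; exact: measurable_cst.
  move=> y By; rewrite patchE; case: ifPn => [_|/negP yB].
    by rewrite -EFinD lee_fin lerDl.
  by rewrite add0e lee_fin annulus// => /mem_set.
rewrite ge0_integralD//; last first.
  by move=> y _; apply: erestrict_ge0 => ? _; rewrite lee_fin.
rewrite -integral_mkcondr setIidr// integral_cst//.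
apply: leeD => //; apply: lee_wpmul2l; first by rewrite lee_fin.
apply: le_measure; rewrite ?inE//.
move=> y; rewrite /eball/= => /le_trans; apply.
rewrite lerXn2r ?nnegrE ?mulr_ge0 ?(ltW r_gt0)//; first by lra.
by rewrite /r' ler_wpM2r ?(ltW r_gt0)//; lra.
Qed.

(** The inequality gives [e * i <= C * e ^+ 2] for the positive integral [i] and
    every [e] with [0 < e <= 1]. *)
Lemma quartic_body_not_spreads : ~ spreads p K.
Proof.
move=> sp.
have V_fin := @eball_finite R m (3 * r).
have Vn : lebn m (eball (3 * r)) \is a fin_num by rewrite ge0_fin_numE.
have In : I \is a fin_num by rewrite ge0_fin_numE// ltW.
set V := fine (lebn m (eball (3 * r))); set i := fine I.
have i0 : 0 < i by rewrite fine_gt0// I_gt0.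
have V0 : 0 <= V by exact: fine_ge0.
pose C := 64 * p%:R ^+ 2 * V.
have C0 : 0 <= C by rewrite !mulr_ge0 ?sqr_ge0.
(* Small enough for [C * e < i], and at most 1. *)
pose e := i / (C + i).
have d0 : 0 < C + i by rewrite ltr_wpDl.
have e0 : 0 < e by rewrite divr_gt0.
have e1 : e <= 1 by rewrite ler_pdivrMr// mul1r lerDr.
have le1 : 1 <= 1 + e by rewrite lerDl ltW.
have e01 : 0 <= e <= 1 by rewrite ltW.
have := le_trans (sp 1%:M r (1 + e) (unitmx1 _ _) r_gt0 le1) (integral_annulus e01).
rewrite -/G -/I -(fineK In) -(fineK Vn) -/i -/V -!EFinM -EFinD lee_fin.
rewrite mulrDl mul1r lerD2l => H.
have E : e * (C + i) = i by rewrite /e divfK// gt_eqF.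
have : i <= C * e.
  rewrite -(ler_pM2l e0) (le_trans H)// /C.
  by rewrite le_eqVlt; apply/orP; left; apply/eqP; ring.
have := mulr_gt0 e0 i0.
by move: E; rewrite mulrDr (mulrC C); lra.
Qed.

End Slice.
End Exclusion.

Theorem corollary5p4 (R : realType) (n k : nat)
  (hn : (4 <= n)%N) (hk2 : (2 <= k)%N) (hkn : (k <= n - 2)%N) :
  @SLneg R n k%:R `\` @Dneg R n k%:R !=set0.
Proof.
case: n k hn hk2 hkn => [//|m] [//|p] m3 p1 pm.
have p0 : (0 < p)%N by [].
have {}pm : (p.+2 <= m)%N by move: pm; rewrite subn2 /= ltn_predRL.
exists (quartic_body p (m := m)); split.
  by apply: SLneg_quartic_body => //; exact: leq_trans (leqnSn _) pm.
by move=> /(Dneg_spreads pm); exact: quartic_body_not_spreads.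
Qed.
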